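(* For every pair of fixed positive integers $k$ and $t$, the following decision problem is NP-complete: given an oriented graph $D$, decide whether $\mathrm{sinv}'_k(D) \leq t$.
   Context: An oriented graph is a digraph with no loops, no parallel arcs and no digons. For a digraph $D$ and $X \subseteq V(D)$, inverting $X$ means reversing the direction of every arc of $D$ with both endvertices in $X$. A digraph $D$ is $k$-arc-strong if for every partition $(V_1,V_2)$ of $V(D)$ into nonempty sets there are at least $k$ arcs with tail in $V_1$ and head in $V_2$. $\mathrm{sinv}'_k(D)$ is the minimum number of sets whose successive inversion transforms $D$ into a $k$-arc-strong digraph ($+\infty$ if no such family exists). *)

(* Defs.v *)
From mathcomp Require Import all_boot.
Set Implicit Arguments. Unset Strict Implicit. Unset Printing Implicit Defensive.

(* A digraph on vertex set 'I_n is given by its arc relation A (A u v = arc u->v). *)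

Definition oriented n (A : rel 'I_n) : Prop :=
  (forall u, ~~ A u u) /\ (forall u v, A u v -> ~~ A v u).

Definition invert n (A : rel 'I_n) (X : {set 'I_n}) : rel 'I_n :=
  fun u v => if (u \in X) && (v \in X) then A v u else A u v.

Definition invert_seq n (A : rel 'I_n) (Xs : seq {set 'I_n}) : rel 'I_n :=
  foldl (@invert n) A Xs.

Definition out_arcs n (A : rel 'I_n) (V1 : {set 'I_n}) : nat :=
  #|[set p : 'I_n * 'I_n | [&& p.1 \in V1, p.2 \notin V1 & A p.1 p.2]]|.

Definition arc_strong k n (A : rel 'I_n) : Prop :=
  forall V1 : {set 'I_n}, V1 != set0 -> V1 != setT -> k <= out_arcs A V1.

Definition sinv_le k t n (A : rel 'I_n) : Prop :=
  exists Xs : seq {set 'I_n}, size Xs <= t /\ arc_strong k (invert_seq A Xs).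

(* Single-tape Turing machines over tape alphabet option bool (None = blank). *)

Inductive move := MoveL | MoveR | MoveS.

Record TM := {
  tm_state : finType;
  tm_start : tm_state;
  tm_halt  : pred tm_state;
  tm_acc   : pred tm_state;
  tm_delta : tm_state -> option bool -> tm_state * option bool * move
}.

(* configuration: state, left part (reversed, nearest cell first), head cell,
   right part *)
Definition config (M : TM) :=
  (tm_state M * seq (option bool) * option bool * seq (option bool))%type.

Definition step (M : TM) (c : config M) : config M :=
  let: (q, l, h, r) := c in
  if @tm_halt M q then c else
  let: (q', w, m) := @tm_delta M q h in
  match m with
  | MoveS => (q', l, w, r)
  | MoveL => match l with
             | [::] => (q', [::], None, w :: r)
             | a :: l' => (q', l', a, w :: r)
             end
  | MoveR => match r with
             | [::] => (q', w :: l, None, [::])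
             | a :: r' => (q', w :: l, a, r')
             end
  end.

Definition run (M : TM) (m : nat) (c : config M) : config M := iter m (@step M) c.

Definition init (M : TM) (x : seq bool) : config M :=
  match x with
  | [::] => (@tm_start M, [::], None, [::])
  | b :: x' => (@tm_start M, [::], Some b, map Some x')
  end.

Definition cstate (M : TM) (c : config M) : tm_state M :=
  let: (q, _, _, _) := c in q.

Fixpoint read_bits (s : seq (option bool)) : seq bool :=
  match s with
  | Some b :: s' => b :: read_bits s'
  | _ => [::]
  end.

Definition output (M : TM) (c : config M) : seq bool :=
  let: (_, _, h, r) := c in read_bits (h :: r).

Definition language := seq bool -> Prop.

Definition decides_in (M : TM) (L : language) (T : nat -> nat) : Prop :=
  forall x, exists m, m <= T (size x) /\
    @tm_halt M (cstate (run m (init M x))) /\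
    (@tm_acc M (cstate (run m (init M x))) <-> L x).

Definition computes_in (M : TM) (f : seq bool -> seq bool) (T : nat -> nat) : Prop :=
  forall x, exists m, m <= T (size x) /\
    @tm_halt M (cstate (run m (init M x))) /\
    output (run m (init M x)) = f x.

Definition in_P (L : language) : Prop :=
  exists (M : TM) (c : nat), decides_in M L (fun n => n ^ c + c).

Definition poly_computable (f : seq bool -> seq bool) : Prop :=
  exists (M : TM) (c : nat), computes_in M f (fun n => n ^ c + c).

Definition pair_enc (x y : seq bool) : seq bool :=
  flatten [seq [:: b; b] | b <- x] ++ [:: false; true] ++ y.

Definition in_NP (L : language) : Prop :=
  exists (V : language) (c : nat), in_P V /\
    forall x, L x <-> exists y, size y <= size x ^ c + c /\ V (pair_enc x y).

Definition poly_reduces (L1 L2 : language) : Prop :=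
  exists f, poly_computable f /\ forall x, L1 x <-> L2 (f x).

Definition NP_hard (L : language) : Prop :=
  forall L', in_NP L' -> poly_reduces L' L.

Definition NP_complete (L : language) : Prop := in_NP L /\ NP_hard L.

Definition encodes (x : seq bool) n (A : rel 'I_n) : Prop :=
  size x = n * n /\ forall i j : 'I_n, nth false x (i * n + j) = A i j.

Definition SINV_lang (k t : nat) : language :=
  fun x => exists n (A : rel 'I_n), encodes x A /\ oriented A /\ sinv_le k t A.

(* Main.v *)
Require Import Defs.
From mathcomp Require Import all_boot zify.
Set Implicit Arguments. Unset Strict Implicit. Unset Printing Implicit Defensive.

(* Membership in NP: the certificate is the list of inverted sets, and a digraph is k-arc-strong
   iff it remains strong after the deletion of any k - 1 arcs; for fixed k all choices of
   k - 1 arcs can be tried.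

   Hardness: for t inverted sets, give every vertex w the vector x_w in F_2^t of the sets
   containing it, so that the arc uv is reversed iff <x_u, x_v> = 1. Let w have in-neighbours S
   together with p_1, ..., p_(k-1), and out-neighbours r_1, ..., r_(k-1), where p_i and
   r_i have equal vectors: these 2k - 2 neighbours always contribute k - 1 in-arcs and k - 1
   out-arcs, hence w gets in- and out-degree at least k for a suitable x_w iff the vectors of
   S are not all equal. The pairs (p_i, r_i) are found by the pigeonhole principle in a
   grid of helper vertices, and the remaining vertices are attached to a k-arc-strong base,
   so the problem encodes the colouring of a hypergraph with 2^t colours. Taking 2^t pairwise
   adjacent points as a palette and forcing literals to use the first two colours, a clause
   is the hyperedge made of its literals and of the point standing for false.

   The tableau of a Turing machine only needs Horn clauses propagating the actual run,
   except where the certificate is guessed. All the machines needed are obtained by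
   implementing, on a tape that stores registers separated by blanks, a class of functions closed
   under composition and under loops with accumulators of polynomial size. *)

(** * Automata composed through their exits *)

(** The inverted sets are arbitrary, so no vertex can be assumed to keep its arcs. The converse
    direction therefore looks only at the two cuts around a single vertex w: whatever happens
    elsewhere, if the vectors of S are all equal then S lies entirely on one side of w, and the
    paired helpers leave only k - 1 arcs on the other side. Which two columns of helpers have equal
    vectors depends on the sets, so each hyperedge gets one such w for every ordered pair of
    distinct columns. In the direct direction base and helpers belong to no set; if two vectors of S
    differ in coordinate r, the r-th unit vector is a suitable x_w, since its inner products are the
    r-th bits. High connectivity then follows from that of the base, because every other vertex has
    k arcs from and to vertices already connected with the base. In the tableau, no clause says that
    a cell holds at most one symbol: every model contains the actual run, and the only negative
    requirement, that the final state is not a rejecting one, already applies to that run. *)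

Definition tape := (seq (option bool) * option bool * seq (option bool))%type.

Definition tmove (w : option bool) (m : move) (tp : tape) : tape :=
  let: (l, _, r) := tp in
  match m with
  | MoveS => (l, w, r)
  | MoveL => if l is a :: l' then (l', a, w :: r) else ([::], None, w :: r)
  | MoveR => if r is a :: r' then (w :: l, a, r') else (w :: l, None, [::])
  end.

(* The transition [None] leaves the automaton, so that automata can be plugged one into another. *)
Record aut := Aut {
  ast : finType;
  astart : ast;
  adelta : ast -> option bool -> option ast * option bool * move }.

Inductive reach (M : aut) : ast M -> tape -> nat -> tape -> Prop :=
| reach_exit q tp w m : adelta q tp.1.2 = (None, w, m) ->
    reach q tp 1 (tmove w m tp)
| reach_step q q' tp w m n tp' : adelta q tp.1.2 = (Some q', w, m) ->
    reach q' (tmove w m tp) n tp' -> reach q tp n.+1 tp'.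

(** Only an upper bound on the time, so that estimates can be relaxed at every composition. *)
Definition runs (M : aut) (tp : tape) (n : nat) (tp' : tape) : Prop :=
  exists2 m, m <= n & reach (astart M) tp m tp'.

Lemma runs_le M tp n n' tp' : n <= n' -> runs M tp n tp' -> runs M tp n' tp'.
Proof. by move=> le [m mn Hm]; exists m => //; apply: leq_trans le. Qed.

Section Embedding.
Variables (M M' : aut) (e : ast M -> ast M') (X : option (ast M')).
Hypothesis delta_e : forall q h, adelta (e q) h =
  let: (o, w, m) := adelta q h in
  (if o is Some q' then Some (e q') else X, w, m).

(** One simulation serves all combinators: a copy of [M] inside [M'] follows [M] step by step, and
    [X] tells where its exits are redirected, [None] meaning that they leave [M'] too. *)
Lemma reach_embed_exit q tp n tp' :
  X = None -> reach q tp n tp' -> reach (e q) tp n tp'.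
Proof.
move=> X0; elim=> {q tp n tp'} [q tp w m Hd|q q' tp w m n tp' Hd _ IH].
  by apply: reach_exit; rewrite delta_e Hd X0.
by apply: reach_step IH; rewrite delta_e Hd.
Qed.

Lemma reach_embed_next q tp n tp' q2 n2 tp2 : X = Some q2 ->
  reach q tp n tp' -> reach q2 tp' n2 tp2 -> reach (e q) tp (n + n2) tp2.
Proof.
move=> X2; elim=> {q tp n tp'} [q tp w m Hd|q q' tp w m n tp' Hd _ IH] H2.
  by apply: reach_step H2; rewrite delta_e Hd X2.
by apply: reach_step (IH H2); rewrite delta_e Hd.
Qed.
End Embedding.

Definition abasic (w : option bool -> option bool) (m : move) : aut :=
  @Aut unit tt (fun _ h => (None, w h, m)).

Definition aseq (M1 M2 : aut) : aut :=
  @Aut (ast M1 + ast M2)%type (inl (astart M1))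
    (fun q h => match q with
     | inl q => let: (o, w, m) := adelta q h in
         (Some (if o is Some q' then inl q' else inr (astart M2)), w, m)
     | inr q => let: (o, w, m) := adelta q h in (omap inr o, w, m)
     end).

(** The extra state [None] reads the symbol and jumps without changing the tape; in [awhile] it is
    also where the exits of the body return. *)
Definition aif (test : option bool -> bool) (M1 M2 : aut) : aut :=
  @Aut (option (ast M1 + ast M2)) None
    (fun q h => match q with
     | None =>
         (Some (Some (if test h then inl (astart M1) else inr (astart M2))), h, MoveS)
     | Some (inl q) => let: (o, w, m) := adelta q h in (omap (Some \o inl) o, w, m)
     | Some (inr q) => let: (o, w, m) := adelta q h in (omap (Some \o inr) o, w, m)
     end).

Definition awhile (test : option bool -> bool) (M : aut) : aut :=
  @Aut (option (ast M)) None
    (fun q h => match q with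
     | None => (if test h then Some (Some (astart M)) else None, h, MoveS)
     | Some q => let: (o, w, m) := adelta q h in (Some o, w, m)
     end).

Lemma tmove_stay (tp : tape) : tmove tp.1.2 MoveS tp = tp.
Proof. by case: tp => [[]]. Qed.

Lemma runs_basic w m tp : runs (abasic w m) tp 1 (tmove (w tp.1.2) m tp).
Proof. by exists 1 => //; apply: reach_exit. Qed.

Lemma runs_seq M1 M2 tp n1 tp1 n2 tp2 :
  runs M1 tp n1 tp1 -> runs M2 tp1 n2 tp2 -> runs (aseq M1 M2) tp (n1 + n2) tp2.
Proof.
move=> [m1 le1 H1] [m2 le2 H2]; exists (m1 + m2); first exact: leq_add.
apply: (@reach_embed_next M1 (aseq M1 M2) inl (Some (inr (astart M2)))) H1 _ => //.
  by move=> q h /=; case: (adelta q h) => [[[]]].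
by apply: (@reach_embed_exit M2 (aseq M1 M2) inr None) H2.
Qed.

Lemma runs_if test M1 M2 tp n tp' :
  runs (if test tp.1.2 then M1 else M2) tp n tp' -> runs (aif test M1 M2) tp n.+1 tp'.
Proof.
case E: (test tp.1.2) => -[m le H]; exists m.+1 => //.
- apply: (@reach_step (aif test M1 M2) None (Some (inl (astart M1))) tp tp.1.2 MoveS).
    by rewrite /= E.
  rewrite tmove_stay.
  by apply: (@reach_embed_exit M1 (aif test M1 M2) (Some \o inl) None) H.
- apply: (@reach_step (aif test M1 M2) None (Some (inr (astart M2))) tp tp.1.2 MoveS).
    by rewrite /= E.
  rewrite tmove_stay.
  by apply: (@reach_embed_exit M2 (aif test M1 M2) (Some \o inr) None) H.
Qed.

Lemma runs_while_stop test M tp : ~~ test tp.1.2 -> runs (awhile test M) tp 1 tp.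
Proof.
move=> /negPf E; exists 1 => //; rewrite -{2}(tmove_stay tp).
by apply: reach_exit; rewrite /= E.
Qed.

Lemma runs_while_next (test : option bool -> bool) M tp n1 tp1 n2 tp2 : test tp.1.2 ->
  runs M tp n1 tp1 -> runs (awhile test M) tp1 n2 tp2 ->
  runs (awhile test M) tp (n1 + n2).+1 tp2.
Proof.
move=> E [m1 le1 H1] [m2 le2 H2].
exists (m1 + m2).+1; first by rewrite ltnS leq_add.
apply: (@reach_step (awhile test M) None (Some (astart M)) tp tp.1.2 MoveS).
  by rewrite /= E.
rewrite tmove_stay.
apply: (@reach_embed_next M (awhile test M) Some (Some None)) H1 H2 => // q h /=.
by case: (adelta q h) => [[[]]].
Qed.

(* On leaving the automaton, the symbol under the head decides acceptance. *)
Definition tm_of (M : aut) : TM := {|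
  tm_state := (ast M + option bool)%type;
  tm_start := inl (astart M);
  tm_halt := fun q => if q is inr (Some _) then true else false;
  tm_acc := fun q => if q is inr (Some true) then true else false;
  tm_delta := fun q h => match q with
    | inl q => let: (o, w, m) := adelta q h in
        (if o is Some q' then inl q' else inr None, w, m)
    | inr None => (inr (Some (h == Some true)), h, MoveS)
    | inr (Some b) => (inr (Some b), h, MoveS)
    end |}.

Definition conf (M : TM) (q : tm_state M) (tp : tape) : config M :=
  (q, tp.1.1, tp.1.2, tp.2).

Lemma step_conf (M : TM) q tp : ~~ @tm_halt M q ->
  step (conf q tp) = let: (q', w, m) := tm_delta q tp.1.2 in conf q' (tmove w m tp).
Proof.
case: tp => [[l h] r] /negPf qh; rewrite /step /conf /= qh.
by case: (tm_delta q h) => [[q' w] []] //; [case: l | case: r].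
Qed.

Lemma runS (M : TM) n (c : config M) : run n.+1 c = run n (step c).
Proof. exact: iterSr. Qed.

(** The additional step is made in state [inr None], which records the symbol under the head before
    halting. *)
Lemma tm_of_run M tp n tp' : runs M tp n tp' -> exists2 m, m <= n.+1 &
  run m (conf (tm_start (tm_of M)) tp) =
  conf (inr (Some (tp'.1.2 == Some true)) : tm_state (tm_of M)) tp'.
Proof.
case=> m le H; exists m.+1 => //.
change (run m.+1 (conf (inl (astart M) : tm_state (tm_of M)) tp) =
  conf (inr (Some (tp'.1.2 == Some true)) : tm_state (tm_of M)) tp').
elim: H {le} => {tp m tp'} [q tp w m Hd|q q' tp w m k tp' Hd _ IH];
  rewrite runS (@step_conf (tm_of M)) // [tm_delta _ _]/= Hd; last exact: IH.
by rewrite runS (@step_conf (tm_of M)) //; move: (tmove _ _ _) => [[]].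
Qed.

(** * Registers on the tape *)

Definition mvL := abasic id MoveL.
Definition mvR := abasic id MoveR.
Definition wr (s : option bool) := abasic (fun _ => s) MoveS.
Definition anop := abasic id MoveS.
(** The closing [anop] costs one step, hence the [+ 1] in the time bounds of repetitions. *)
Definition arep n (M : aut) : aut := iter n (aseq M) anop.

Definition isbit (h : option bool) := isSome h.

(** [tmove] ignores the symbol under the head, so [None] stands for it. In this form no case
    distinction on an empty side of the tape is needed, and loop invariants can keep the last symbol
    [h] abstract. *)
Lemma runs_mvL l h r : runs mvL (l, h, r) 1 (tmove h MoveL (l, None, r)).
Proof. exact: runs_basic. Qed.

Lemma runs_mvR l h r : runs mvR (l, h, r) 1 (tmove h MoveR (l, None, r)).
Proof. exact: runs_basic. Qed.

Lemma runs_goL tp : runs mvL tp 1 (tmove tp.1.2 MoveL tp).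
Proof. exact: runs_basic. Qed.

Lemma runs_goR tp : runs mvR tp 1 (tmove tp.1.2 MoveR tp).
Proof. exact: runs_basic. Qed.

Lemma runs_wr s tp : runs (wr s) tp 1 (tp.1.1, s, tp.2).
Proof. by move: (runs_basic (fun=> s) MoveS tp); case: tp => [[]]. Qed.

Lemma runs_nop tp : runs anop tp 1 tp.
Proof. by move: (runs_basic id MoveS tp); rewrite tmove_stay. Qed.

Lemma runs_cast M tp n tp' n' tp2 :
  runs M tp n tp' -> n <= n' -> tp' = tp2 -> runs M tp n' tp2.
Proof. by move=> H le <-; apply: runs_le H. Qed.

(* A register is a word of bits closed by a blank; [seg] puts it to the right of the head
   and [rseg] to the left. *)
Definition seg (v : seq bool) (r : seq (option bool)) := map Some v ++ None :: r.
Definition rseg (v : seq bool) (l : seq (option bool)) := catrev (map Some v) (None :: l).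
Definition segs (vs : seq (seq bool)) r := foldr seg r vs.
Definition rsegs (vs : seq (seq bool)) l := foldl (fun l v => rseg v l) l vs.

Lemma segs_cat vs1 vs2 r : segs (vs1 ++ vs2) r = segs vs1 (segs vs2 r).
Proof. exact: foldr_cat. Qed.

Lemma rseg_rcons v b l : rseg (rcons v b) l = Some b :: rseg v l.
Proof. by rewrite /rseg map_rcons !catrevE rev_rcons. Qed.

(** Between operations the head rests on the blank in front of a register; the blank that closes a
    register is also the one in front of the next. *)
Definition skip1 := aseq mvR (awhile isbit mvR).
Definition back1 := aseq mvL (awhile isbit mvL).

Lemma runs_skip1 l v r :
  runs skip1 (l, None, seg v r) (size v * 2 + 2) (rseg v l, None, r).
Proof.
have W u : forall c l', runs (awhile isbit mvR) (tmove c MoveR (l', None, seg u r))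
    (size u * 2 + 1) (catrev (map Some u) (c :: l'), None, r).
  elim: u => [|b u IH] c l' /=; first exact: runs_while_stop.
  apply: runs_cast; first by apply: runs_while_next _ (runs_mvR _ _ _) (IH (Some b) (c :: l')).
    by rewrite /=; lia.
  by [].
apply: runs_cast (runs_seq (runs_mvR l None (seg v r)) (W v None l)) _ erefl; lia.
Qed.

Lemma runs_back1 l v r :
  runs back1 (rseg v l, None, r) (size v * 2 + 2) (l, None, seg v r).
Proof.
have W u : forall c r', runs (awhile isbit mvL) (tmove c MoveL (rseg u l, None, r'))
    (size u * 2 + 1) (l, None, map Some u ++ c :: r').
  elim/last_ind: u => [|u b IH] c r' /=; first exact: runs_while_stop.
  rewrite rseg_rcons map_rcons cat_rcons size_rcons.
  apply: runs_cast; first by apply: runs_while_next _ (runs_mvL _ _ _) (IH (Some b) (c :: r')).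
    by rewrite /=; lia.
  by [].
apply: runs_cast (runs_seq (runs_mvL (rseg v l) None r) (W v None r)) _ erefl; lia.
Qed.

Definition below N (vs : seq (seq bool)) := all (fun v => size v <= N) vs.

Lemma runs_skip N vs l r : below N vs ->
  runs (arep (size vs) skip1) (l, None, segs vs r) (size vs * (N * 2 + 2) + 1)
    (rsegs vs l, None, r).
Proof.
elim: vs l => [|v vs IH] l /=; first by move=> _; exact: runs_nop.
case/andP=> vN bvs; apply: runs_cast (runs_seq (runs_skip1 _ _ _) (IH _ bvs)) _ erefl; lia.
Qed.

Lemma runs_back N vs l r : below N vs ->
  runs (arep (size vs) back1) (rsegs vs l, None, r) (size vs * (N * 2 + 2) + 1)
    (l, None, segs vs r).
Proof.
elim/last_ind: vs r => [|vs v IH] r; first by move=> _; exact: runs_nop.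
rewrite /below all_rcons size_rcons => /andP[vN bvs].
rewrite /rsegs foldl_rcons /segs foldr_rcons.
apply: runs_cast (runs_seq (runs_back1 _ _ _) (IH _ bvs)) _ erefl; lia.
Qed.

(** The bit is remembered by the branch taken. It overwrites the cell on the right, and the head
    ends on the cell to the left, ready for the next bit. *)
Definition copyR := aif (pred1 (Some true))
  (aseq mvR (aseq (wr (Some true)) (aseq mvL mvL)))
  (aseq mvR (aseq (wr (Some false)) (aseq mvL mvL))).

Definition copyL := aif (pred1 (Some true))
  (aseq mvL (aseq (wr (Some true)) (aseq mvR mvR)))
  (aseq mvL (aseq (wr (Some false)) (aseq mvR mvR))).

Lemma runs_copyR l b g r :
  runs copyR (l, Some b, g :: r) 5 (tmove (Some b) MoveL (l, None, Some b :: r)).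
Proof.
have H c : runs (aseq mvR (aseq (wr (Some c)) (aseq mvL mvL))) (l, Some b, g :: r) 4
    (tmove (Some b) MoveL (l, None, Some c :: r)).
  exact: runs_cast (runs_seq (runs_goR (l, Some b, g :: r)) (runs_seq (runs_wr _ _)
    (runs_seq (runs_goL _) (runs_goL _)))) (leqnn _) erefl.
by apply: runs_if; case: b H => H; apply: H.
Qed.

Lemma runs_copyL l b g r :
  runs copyL (g :: l, Some b, r) 5 (tmove (Some b) MoveR (Some b :: l, None, r)).
Proof.
have H c : runs (aseq mvL (aseq (wr (Some c)) (aseq mvR mvR))) (g :: l, Some b, r) 4
    (tmove (Some b) MoveR (Some c :: l, None, r)).
  exact: runs_cast (runs_seq (runs_goL (g :: l, Some b, r)) (runs_seq (runs_wr _ _)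
    (runs_seq (runs_goR _) (runs_goR _)))) (leqnn _) erefl.
by apply: runs_if; case: b H => H; apply: H.
Qed.

Definition shiftR1 := aseq (aseq mvR (aseq (wr None) mvL)) (aseq mvL (awhile isbit copyR)).
Definition shiftL1 := aseq mvR (aseq mvR (aseq (awhile isbit copyL) (aseq mvL (wr None)))).

(** The spare cell [g] becomes the closing blank and every bit moves into the cell to its right; the
    cell freed in front keeps its old content, hence the existential [g']. *)
Lemma runs_shiftR1 l v g r : exists g',
  runs shiftR1 (rseg v l, None, g :: r) (size v * 6 + 5) (l, None, g' :: seg v r).
Proof.
have W u : forall c y, exists g',
    runs (awhile isbit copyR) (tmove c MoveL (rseg u l, None, y))
    (size u * 6 + 1) (l, None, g' :: map Some u ++ y).
  elim/last_ind: u => [|u b IH] c y; first by exists c; exact: runs_while_stop.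
  have [g' Hg] := IH (Some b) (Some b :: y); exists g'.
  rewrite rseg_rcons map_rcons cat_rcons size_rcons.
  by apply: runs_cast; [apply: runs_while_next _ (runs_copyR _ _ _ _) Hg | lia | ].
have [g' Hg] := W v None (None :: r); exists g'.
have Hm : runs (aseq mvR (aseq (wr None) mvL)) (rseg v l, None, g :: r) 3
    (rseg v l, None, None :: r).
  exact: runs_seq (runs_goR (rseg v l, None, g :: r)) (runs_seq (runs_wr _ _) (runs_goL _)).
apply: runs_cast (runs_seq Hm (runs_seq (runs_mvL _ _ _) Hg)) _ erefl; lia.
Qed.

(** The spare cell travels from the front of the register to its end, where it serves as the [g] of
    the next register. *)
Lemma runs_shiftL1 l v g r :
  runs shiftL1 (l, None, g :: seg v r) (size v * 6 + 5) (rseg v l, None, None :: r).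
Proof.
have W u : forall l' c, exists g',
    runs (awhile isbit copyL) (tmove c MoveR (l', None, seg u r))
    (size u * 6 + 1) (g' :: catrev (map Some u) l', None, r).
  elim: u => [|b u IH] l' c; first by exists c; exact: runs_while_stop.
  have [g' Hg] := IH (Some b :: l') (Some b); exists g'.
  by apply: runs_cast; [apply: runs_while_next _ (runs_copyL _ _ _ _) Hg | rewrite /=; lia | ].
have [g' Hg] := W v (None :: l) g.
have H0 : runs mvR (l, None, g :: seg v r) 1 (None :: l, g, seg v r) by exact: runs_mvR.
have H1 := runs_seq Hg (runs_seq (runs_goL _) (runs_wr None _)).
apply: runs_cast (runs_seq H0 (runs_seq (runs_mvR _ _ _) H1)) _ erefl; lia.
Qed.

Lemma runs_shiftR N vs l g r : below N vs -> exists g',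
  runs (arep (size vs) shiftR1) (rsegs vs l, None, g :: r) (size vs * (N * 6 + 5) + 1)
    (l, None, g' :: segs vs r).
Proof.
elim/last_ind: vs g r => [|vs v IH] g r; first by exists g; exact: runs_nop.
rewrite /below all_rcons size_rcons => /andP[vN bvs].
rewrite /rsegs foldl_rcons /segs foldr_rcons.
have [g1 H1] := runs_shiftR1 (rsegs vs l) v g r.
have [g2 H2] := IH g1 (seg v r) bvs; exists g2.
apply: runs_cast (runs_seq H1 H2) _ erefl; lia.
Qed.

(** The list is nonempty because it is the passage through a register that turns the spare cell from
    [g] into a blank. *)
Lemma runs_shiftL N v vs l g r : below N (v :: vs) ->
  runs (arep (size (v :: vs)) shiftL1) (l, None, g :: segs (v :: vs) r)
    ((size vs).+1 * (N * 6 + 5) + 1) (rsegs (v :: vs) l, None, None :: r).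
Proof.
elim: vs v l g => [|w vs IH] v l g /andP[vN bvs].
  apply: runs_cast (runs_seq (runs_shiftL1 _ _ _ _) (runs_nop _)) _ erefl; lia.
apply: runs_cast (runs_seq (runs_shiftL1 _ _ _ _) (IH _ _ _ bvs)) _ erefl.
by rewrite /=; lia.
Qed.

(** * Stores and operations on registers *)

Definition store := nat -> seq bool.
Definition upd (s : store) i v : store := fun j => if j == i then v else s j.
Definition bounded N (s : store) := forall i, size (s i) <= N.

(** The blanks written after the last register are part of the tape; their number changes as
    registers grow and shrink, hence [b] and [b']. *)
Definition exec R (M : aut) (s s' : store) (n : nat) : Prop :=
  forall l b, exists b', runs M (l, None, segs (mkseq s R) (nseq b None)) n
    (l, None, segs (mkseq s' R) (nseq b' None)).

Lemma exec_eq R M s s' n s2 n' : exec R M s s' n -> s' =1 s2 -> n <= n' ->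
  exec R M s s2 n'.
Proof.
move=> H E le l b; have [b' Hb] := H l b; exists b'.
by apply: runs_cast Hb le _; rewrite (eq_mkseq E).
Qed.

Lemma exec_seq R M1 M2 s s1 s2 n1 n2 :
  exec R M1 s s1 n1 -> exec R M2 s1 s2 n2 -> exec R (aseq M1 M2) s s2 (n1 + n2).
Proof.
move=> H1 H2 l b; have [b1 {}H1] := H1 l b; have [b2 {}H2] := H2 l b1.
by exists b2; apply: runs_seq H1 H2.
Qed.

Lemma exec_nop R s : exec R anop s s 1.
Proof. by move=> l b; exists b; exact: runs_nop. Qed.

Lemma below_map N (s : store) (I : seq nat) : bounded N s -> below N (map s I).
Proof. by move=> bs; apply/allP=> v /mapP[i _ ->]. Qed.

Lemma mkseq_split R (s : store) i : i < R ->
  mkseq s R = mkseq s i ++ s i :: map s (iota i.+1 (R - i).-1).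
Proof.
move=> iR; rewrite /mkseq -{1}(subnKC (ltnW iR)) iotaD map_cat add0n.
by have ->: R - i = ((R - i).-1).+1 by lia.
Qed.

Lemma mkseq_upd R s i v : i < R ->
  mkseq (upd s i v) R = mkseq s i ++ v :: map s (iota i.+1 (R - i).-1).
Proof.
move=> iR; rewrite (mkseq_split _ iR) /upd eqxx; congr (_ ++ _ :: _).
  by apply/eq_in_map=> j; rewrite mem_iota => /andP[_ ji]; case: eqP => // E; lia.
by apply/eq_in_map=> j; rewrite mem_iota => /andP[ij _]; case: eqP => // E; lia.
Qed.

(** A generous common bound for one sweep over [R] registers of length at most [N], so that cost
    estimates need no precise count. *)
Definition opcost R N := (R + 1) * (30 * N + 50).

Definition push i R b := aseq (arep R skip1) (aseq (aseq mvR mvL)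
  (aseq (arep (R - i) shiftR1) (aseq (aseq mvR (aseq (wr (Some b)) mvL)) (arep i back1)))).

Definition pop i R := aseq (arep i skip1) (aseq (arep (R - i) shiftL1) (arep R back1)).

Section RegisterOperations.
Variables (R i N : nat) (s : store).
Hypotheses (iR : i < R) (bs : bounded N s).
Let vs1 := mkseq s i.
Let vs2 := map s (iota i.+1 (R - i).-1).

Let size_vs1 : size vs1 = i. Proof. exact: size_mkseq. Qed.
Let size_vs2 : (size vs2).+1 = R - i. Proof. by rewrite size_map size_iota; lia. Qed.
Let below_vs1 : below N vs1. Proof. exact: below_map. Qed.
Let below_vs2 : below N vs2. Proof. exact: below_map. Qed.
Let below_svs2 : below N (s i :: vs2). Proof. by rewrite /= bs. Qed.

Lemma exec_push b : exec R (push i R b) s (upd s i (b :: s i)) (opcost R N).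
Proof.
move=> l k; rewrite (mkseq_upd _ _ iR) (mkseq_split _ iR) -/vs1 -/vs2.
have ball : below N (vs1 ++ s i :: vs2) by rewrite /below all_cat; apply/andP.
have sza : size (vs1 ++ s i :: vs2) = R by rewrite size_cat /= size_vs1 size_vs2; lia.
exists k.-1; rewrite !segs_cat.
have H1 := runs_skip l (nseq k None) ball; rewrite sza segs_cat in H1.
pose L := rsegs (vs1 ++ s i :: vs2) l.
have H2 : runs (aseq mvR mvL) (L, None, nseq k None) 2 (L, None, None :: nseq k.-1 None).
  apply: runs_cast (runs_seq (runs_goR (L, None, nseq k None)) (runs_goL _)) _ _ => //.
  by case: (k).
have [g] := @runs_shiftR N (s i :: vs2) (rsegs vs1 l) None (nseq k.-1 None) below_svs2.
rewrite [size _]/= size_vs2 => H3.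
have H3' : runs (aseq mvR (aseq (wr (Some b)) mvL))
    (rsegs vs1 l, None, g :: segs (s i :: vs2) (nseq k.-1 None)) 3
    (rsegs vs1 l, None, segs ((b :: s i) :: vs2) (nseq k.-1 None)).
  exact: runs_seq (runs_goR _) (runs_seq (runs_wr _ _) (runs_goL _)).
have H4 := @runs_back N vs1 l (segs ((b :: s i) :: vs2) (nseq k.-1 None)) below_vs1.
rewrite size_vs1 in H4; rewrite /L /rsegs foldl_cat in H1 H2.
have HH := (runs_seq H1 (runs_seq H2 (runs_seq H3 (runs_seq H3' H4)))).
apply: runs_cast HH _ erefl.
by rewrite /opcost; nia.
Qed.

Lemma exec_pop : s i != [::] -> exec R (pop i R) s (upd s i (behead (s i))) (opcost R N).
Proof.
move=> sin l k; rewrite (mkseq_upd _ _ iR) (mkseq_split _ iR) -/vs1 -/vs2.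
case E: (s i) sin => [//|b v] _ /=; exists k.+1; rewrite !segs_cat.
have bv : below N (v :: vs2) by rewrite /=; move: (bs i); rewrite E /= => /ltnW ->.
have H1 := runs_skip l (segs ((b :: v) :: vs2) (nseq k None)) below_vs1.
have H2 := @runs_shiftL N v vs2 (rsegs vs1 l) (Some b) (nseq k None) bv.
have ball : below N (vs1 ++ v :: vs2) by rewrite /below all_cat; apply/andP.
have H3 := @runs_back N _ l (nseq k.+1 None) ball.
rewrite segs_cat size_cat /= size_vs1 size_vs2 subnKC ?(ltnW iR) // /rsegs foldl_cat in H3.
rewrite size_vs1 in H1; rewrite [size _]/= size_vs2 in H2.
apply: runs_cast (runs_seq H1 (runs_seq H2 H3)) _ erefl.
by rewrite /opcost; nia.
Qed.

Definition rtest (test : option bool -> bool) (M1 M2 : aut) :=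
  let home := aseq mvL (arep i back1) in
  aseq (aseq (arep i skip1) mvR) (aif test (aseq home M1) (aseq home M2)).

(** The loop lasts while register [i] is nonempty: its first cell is then a bit and not the closing
    blank. The head goes home before the body, which expects it in front of register 0. *)
Definition rwhile (M : aut) :=
  let home := aseq mvL (arep i back1) in
  let look := aseq (arep i skip1) mvR in
  aseq look (aseq (awhile isbit (aseq home (aseq M look))) home).

Let looking l k : tape :=
  tmove None MoveR (rsegs vs1 l, None, segs (s i :: vs2) (nseq k None)).

Lemma looking_head l k : (looking l k).1.2 = ohead (s i).
Proof. by rewrite /looking /=; case: (s i). Qed.

Lemma runs_look l k : runs (aseq (arep i skip1) mvR)
  (l, None, segs (mkseq s R) (nseq k None)) (opcost R N) (looking l k).
Proof.
rewrite (mkseq_split _ iR) -/vs1 -/vs2 segs_cat.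
have := runs_skip l (segs (s i :: vs2) (nseq k None)) below_vs1.
rewrite size_vs1 => H1; apply: runs_cast (runs_seq H1 (runs_goR _)) _ erefl.
by rewrite /opcost; nia.
Qed.

Lemma runs_home l k : runs (aseq mvL (arep i back1)) (looking l k) (opcost R N)
  (l, None, segs (mkseq s R) (nseq k None)).
Proof.
rewrite (mkseq_split _ iR) -/vs1 -/vs2 segs_cat.
have := @runs_back N _ l (segs (s i :: vs2) (nseq k None)) below_vs1.
rewrite size_vs1 => H1; have H0 : runs mvL (looking l k) 1
    (rsegs vs1 l, None, segs (s i :: vs2) (nseq k None)).
  by rewrite /looking /=; case: (s i) => [|b v]; exact: runs_mvL.
apply: runs_cast (runs_seq H0 H1) _ erefl; rewrite /opcost; nia.
Qed.

Lemma exec_rtest test M1 M2 s' n :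
  exec R (if test (ohead (s i)) then M1 else M2) s s' n ->
  exec R (rtest test M1 M2) s s' (n + 3 * opcost R N).
Proof.
move=> H l k; have [b' {}H] := H l k; exists b'.
have H2 : runs (aif test (aseq (aseq mvL (arep i back1)) M1)
    (aseq (aseq mvL (arep i back1)) M2)) (looking l k) (opcost R N + n).+1
    (l, None, segs (mkseq s' R) (nseq b' None)).
  apply: runs_if; rewrite looking_head.
  by case: (test _) H => H; apply: runs_seq (runs_home _ _) H.
apply: runs_cast (runs_seq (runs_look l k) H2) _ erefl.
by rewrite /opcost; nia.
Qed.
End RegisterOperations.

Lemma exec_rwhile R i N M (S : nat -> store) m n : i < R ->
  (forall j, j <= m -> bounded N (S j)) ->
  (forall j, j < m -> S j i != [::] /\ exec R M (S j) (S j.+1) n) ->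
  S m i = [::] ->
  exec R (rwhile i M) (S 0) (S m) (m * (n + 3 * opcost R N) + 3 * opcost R N).
Proof.
move=> iR bS step Sm l k.
set look := aseq (arep i skip1) mvR; set home := aseq mvL (arep i back1).
pose lk (s : store) k := tmove None MoveR
  (rsegs (mkseq s i) l, None, segs (s i :: map s (iota i.+1 (R - i).-1)) (nseq k None)).
(* [m'] is the number of turns still to be made. *)
have W m' : m' <= m -> exists b', runs (awhile isbit (aseq home (aseq M look)))
    (lk (S (m - m')) k) (m' * (n + 3 * opcost R N) + 1) (lk (S m) b').
  elim: m' k => [|m' IH] k' lem.
    exists k'; rewrite subn0; apply: runs_while_stop.
    by rewrite looking_head Sm.
  have lt : m - m'.+1 < m by lia.
  have [ne ex] := step _ lt; have [b1 H1] := ex l k'.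
  have e1 : (m - m'.+1).+1 = m - m' by lia.
  rewrite e1 in H1; have [b2 H2] := IH b1 (ltnW lem); exists b2.
  apply: runs_cast; first (apply: runs_while_next _ _ H2).
  - by rewrite looking_head; case: (S _ i) ne.
  - apply: runs_seq (runs_home iR (bS _ (ltnW lt)) l k') (runs_seq H1 _).
    exact: (runs_look iR (bS _ (leq_subr _ _)) l b1).
  - by rewrite /opcost; nia.
  - by [].
have [b' H] := W m (leqnn _); rewrite subnn in H; exists b'.
have H0 := runs_look iR (bS 0 isT) l k; have H1 := runs_home iR (bS m (leqnn _)) l b'.
apply: runs_cast (runs_seq H0 (runs_seq H H1)) _ erefl.
by rewrite /opcost; nia.
Qed.

(** * Polynomial bounds *)

Definition pb (T : nat -> nat) := exists c, forall N, T N <= (N + 2) ^ c.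

Lemma pb_le T U : pb U -> (forall N, T N <= U N) -> pb T.
Proof. by move=> [c Hc] le; exists c => N; apply: leq_trans (le N) (Hc N). Qed.

Lemma pb_const k : pb (fun _ => k).
Proof.
exists k => N; apply: leq_trans (ltnW (ltn_expl k (ltnSn 1))) _.
by case: k => // k; rewrite leq_exp2r // addn2.
Qed.

Lemma pb_id : pb id.
Proof. by exists 1 => N; rewrite expn1 leq_addr. Qed.

Lemma exp2_mono N a b : a <= b -> (N + 2) ^ a <= (N + 2) ^ b.
Proof. by move=> le; rewrite leq_exp2l // addn2. Qed.

(** Two powers are absorbed by one with a larger exponent because the base [N + 2] is at least 2,
    even for [N = 0]. *)
Lemma pb_add T U : pb T -> pb U -> pb (fun N => T N + U N).
Proof.
move=> [c Hc] [d Hd]; exists (maxn c d).+1 => N; rewrite expnS.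
have := leq_trans (Hc N) (exp2_mono N (leq_maxl c d)).
have := leq_trans (Hd N) (exp2_mono N (leq_maxr c d)).
by nia.
Qed.

Lemma pb_mul T U : pb T -> pb U -> pb (fun N => T N * U N).
Proof. by move=> [c Hc] [d Hd]; exists (c + d) => N; rewrite expnD leq_mul. Qed.

Lemma pb_comp T U : pb T -> pb U -> pb (fun N => T (U N)).
Proof.
move=> [c Hc] [d Hd]; exists (d.+2 * c) => N; apply: leq_trans (Hc _) _.
rewrite expnM; case: c Hc => [//|c] _; rewrite leq_exp2r // !expnS.
have := Hd N; have : 0 < (N + 2) ^ d by rewrite expn_gt0 addn2.
by nia.
Qed.

Lemma pb_exp T c : pb T -> pb (fun N => T N ^ c).
Proof.
move=> pT; elim: c => [|c IH]; first exact: pb_const.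
by apply: pb_le (pb_mul pT IH) _ => N; rewrite expnS.
Qed.

Lemma pb_opcost R T : pb T -> pb (fun N => opcost R (T N)).
Proof.
move=> pT; apply: (pb_comp (T := opcost R)) pT; apply: pb_mul; first exact: pb_const.
by apply: pb_add (pb_const _); apply: pb_mul pb_id; apply: pb_const.
Qed.

Ltac pbt := try assumption; lazymatch goal with
  | |- pb (fun N => N) => exact: pb_id
  | |- pb (fun _ => ?k) => exact: (pb_const k)
  | |- pb (fun N => addn (@?f N) (@?g N)) => refine (@pb_add f g _ _); pbt
  | |- pb (fun N => muln (@?f N) (@?g N)) => refine (@pb_mul f g _ _); pbt
  | |- pb (fun N => expn (@?f N) ?c) => refine (@pb_exp f c _); pbt
  | |- pb (fun N => S (@?f N)) => refine (@pb_le _ (fun N => f N + 1) _ _);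
       [pbt | by move=> ?; rewrite addn1]
  | |- pb (fun N => opcost ?R (@?g N)) => refine (@pb_opcost R g _); pbt
  | |- pb (fun N => ?T (@?g N)) => refine (@pb_comp T g _ _); [assumption | pbt]
  | |- pb (fun N => ?T N) => assumption
  end.

Lemma bounded_le N N' s : N <= N' -> bounded N s -> bounded N' s.
Proof. by move=> le bs i; apply: leq_trans (bs i) le. Qed.

Lemma bounded_upd N s i v : bounded N s -> size v <= N -> bounded N (upd s i v).
Proof. by move=> bs vN j; rewrite /upd; case: ifP. Qed.

Definition pushes js R b := foldr (fun j M => aseq (push j R b) M) anop js.

Lemma exec_pushes R js b s N : uniq js -> all (gtn R) js -> bounded N s ->
  exec R (pushes js R b) s (fun k => if k \in js then b :: s k else s k)
    (size js * opcost R N.+1 + 1).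
Proof.
(* Each register grows once: those still to be pushed have length at most [N], the others at most
   [N.+1]. *)
have H jss : uniq jss -> all (gtn R) jss -> forall s, bounded N.+1 s ->
    (forall j, j \in jss -> size (s j) <= N) ->
    exec R (pushes jss R b) s (fun k => if k \in jss then b :: s k else s k)
    (size jss * opcost R N.+1 + 1).
  elim: jss => [|j jss IH] /=; first by move=> _ _ s0 _ _; exact: exec_nop.
  move=> /andP[jn uj] /andP[jR aj] s0 bs0 le.
  have bu : bounded N.+1 (upd s0 j (b :: s0 j)).
    by apply: bounded_upd => //; rewrite /= ltnS; apply: le; rewrite mem_head.
  apply: exec_eq (exec_seq (exec_push jR bs0 b) (IH uj aj _ bu _)) _ _.
  - move=> k kj; rewrite /upd; case: eqP => [E|_]; first by rewrite -E kj in jn.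
    by apply: le; rewrite inE kj orbT.
  - move=> k; rewrite /upd inE; case: eqP => [->|//].
    by rewrite (negPf jn).
  - by rewrite mulSn addnA.
move=> uj aj bs; apply: H => //; exact: bounded_le bs.
Qed.

(* The word comes out reversed. *)
Definition dump (phi : bool -> bool) R i js :=
  rwhile i (rtest i (pred1 (Some true))
    (aseq (pop i R) (pushes js R (phi true)))
    (aseq (pop i R) (pushes js R (phi false)))).

(** A target of length at most [N] receives at most [N] bits, hence [2 * N]; the extra 1 is the
    allowance of [exec_pushes]. *)
Definition dumpcost R q N := (N + 1) * ((q + 10) * opcost R (2 * N + 1)).

Lemma pb_dumpcost R q T : pb T -> pb (fun N => dumpcost R q (T N)).
Proof.
move=> pT; apply: (pb_comp (T := fun N => dumpcost R q N)) pT; rewrite /dumpcost; pbt.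
Qed.

Lemma exec_dump phi R i js s N : uniq js -> i \notin js -> all (gtn R) (i :: js) ->
  bounded N s ->
  exec R (dump phi R i js) s (fun k => if k == i then [::] else
    if k \in js then catrev (map phi (s i)) (s k) else s k) (dumpcost R (size js) N).
Proof.
move=> uj inj /= /andP[iR aj] bs; set v := s i.
pose S m : store := fun k => if k == i then drop m v else
  if k \in js then catrev (map phi (take m v)) (s k) else s k.
have bS m : bounded (2 * N) (S m).
  move=> k; have := bs k; have := bs i; rewrite -/v /S => vN kN; case: ifP => _.
    by rewrite size_drop; lia.
  case: ifP => _; last by lia.
  by rewrite catrevE size_cat size_rev size_map size_take_min; lia.
have step j : j < size v -> S j i != [::] /\
    exec R (rtest i (pred1 (Some true)) (aseq (pop i R) (pushes js R (phi true)))
      (aseq (pop i R) (pushes js R (phi false)))) (S j) (S j.+1)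
      (opcost R (2 * N) + (size js * opcost R (2 * N).+1 + 1) + 3 * opcost R (2 * N)).
  move=> jv; have ne : S j i != [::].
    by rewrite /S eqxx -size_eq0 size_drop -lt0n subn_gt0.
  split=> //; apply: (exec_rtest iR (bS j)).
  have E b : ohead (S j i) = Some b ->
      exec R (aseq (pop i R) (pushes js R (phi b))) (S j) (S j.+1)
      (opcost R (2 * N) + (size js * opcost R (2 * N).+1 + 1)).
    move=> hb; have bp : bounded (2 * N) (upd (S j) i (behead (S j i))).
      by apply: bounded_upd => //; rewrite size_behead; apply: leq_trans (leq_pred _) (bS j i).
    apply: exec_eq (exec_seq (exec_pop iR (bS j) ne) (exec_pushes (phi b) uj aj bp)) _ (leqnn _).
    move: hb; rewrite /S eqxx /upd (drop_nth false jv) /= => -[nb] k.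
    case: eqP => [->|_]; first by rewrite (negPf inj).
    case: (k \in js) => //.
    by rewrite (take_nth false jv) map_rcons !catrevE rev_rcons nb.
  have hd : ohead (S j i) = Some (nth false v j).
    by rewrite /S eqxx (drop_nth false jv).
  by case: (nth false v j) hd => hd; rewrite hd; apply: E.
have H := exec_rwhile iR (fun j _ => bS j) step.
rewrite {1}/S eqxx drop_size in H.
have {}H := H erefl; have H0 : exec R (dump phi R i js) s (S (size v)) (dumpcost R (size js) N).
  move=> l b; have [b' Hb] := H l b; exists b'.
  have E0 : mkseq (S 0) R = mkseq s R.
    apply: eq_mkseq => k; rewrite /S drop0 take0 /=.
    by case: eqP => [->//|_]; case: ifP.
  rewrite E0 in Hb; apply: runs_cast Hb _ erefl.
  have := bs i; rewrite -/v => vN; rewrite /dumpcost /opcost; nia.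
by apply: exec_eq H0 _ (leqnn _) => k; rewrite /S drop_size take_size.
Qed.

Lemma exec_move R a b s N : a < R -> b < R -> a != b -> bounded N s ->
  exec R (dump id R a [:: b]) s
    (fun k => if k == a then [::] else if k == b then catrev (s a) (s b) else s k)
    (dumpcost R 1 N).
Proof.
move=> aR bR ab bs; apply: exec_eq (exec_dump id _ _ _ bs) _ (leqnn _) => //.
- by rewrite inE.
- by rewrite /= aR bR.
- by move=> k; rewrite inE map_id; case: eqP => // _; case: eqP => // ->.
Qed.

(** The detour through the scratch register [b] reverses the word a second time. *)
Definition replace R d a b :=
  aseq (dump id R d [::]) (aseq (dump id R a [:: b]) (dump id R b [:: d])).

Lemma exec_replace R d a b s N : uniq [:: d; a; b] -> all (gtn R) [:: d; a; b] ->
  bounded N s -> s b = [::] ->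
  exec R (replace R d a b) s (upd (upd s a [::]) d (s a)) (3 * dumpcost R 1 N).
Proof.
rewrite /= !inE negb_or => /and3P[/andP[da db] ab _] /and4P[dR aR bR _] bs sb.
have H1 := @exec_dump id R d [::] s N isT isT _ bs.
have b1 : bounded N (fun k => if k == d then [::] else
    if k \in [::] then catrev (map id (s d)) (s k) else s k).
  by move=> k /=; case: eqP => //; rewrite in_nil.
have H2 := exec_move aR bR ab b1.
have b2 : bounded N (upd (upd (upd s d [::]) a [::]) b (rev (s a))).
  by apply: bounded_upd; rewrite ?size_rev //; do 2!apply: bounded_upd => //.
have H2' := exec_eq H2 (s2 := upd (upd (upd s d [::]) a [::]) b (rev (s a))) _ (leqnn _).
have H3 := exec_move bR dR _ b2.
apply: exec_eq (exec_seq (H1 _) (exec_seq (H2' _) (H3 _))) _ _.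
- by rewrite /= dR.
- move=> k; rewrite /= ?in_nil (eq_sym a) (negPf da) (eq_sym b) (negPf db) /upd sb.
  case: (eqVneq k b) => [->|//]; rewrite eq_sym (negPf ab).
  by rewrite catrevE cats0.
- by rewrite eq_sym.
- move=> k; rewrite /upd eqxx (negPf db) (negPf da) eqxx catrevE revK cats0.
  case: (eqVneq k b) => [->|kb]; last by case: (k == d).
  by rewrite eq_sym (negPf db) sb; case: ifP.
- by rewrite /dumpcost /opcost /=; nia.
Qed.

(** * Polynomial-time functions *)

(** Numbers are in unary: a polynomial bound on lengths then bounds values, and a number can drive a
    loop by having its bits popped. *)
Structure data := Val { vsort :> Type; venc : vsort -> seq bool }.
Canonical bits_val := @Val (seq bool) id.
Canonical nat_val := @Val nat (fun n => nseq n true).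
Canonical bool_val := @Val bool (fun b => nseq b true).

(** An environment plays the role of a typing context: a tuple nested to the left that starts with a
    word, each component in a register of its own. Canonical instances let unification find the
    encoding. *)
Structure env := Env {
  esort :> Type; een : esort -> seq (seq bool); ewidth : nat;
  size_een : forall t, size (een t) = ewidth }.

Definition free d (s : store) := forall i, d <= i -> s i = [::].

Canonical bits_env := @Env (seq bool) (fun x => [:: x]) 1 (fun _ => erefl).

Lemma size_prod_een (E : env) (B : data) (t : E * B) :
  size (rcons (een t.1) (venc t.2)) = (ewidth E).+1.
Proof. by rewrite size_rcons size_een. Qed.
Canonical prod_env (E : env) (B : data) := @Env (E * B)%type _ _ (@size_prod_een E B).

Definition polysize (E : env) (B : data) (f : E -> B) :=
  exists2 S, pb S & forall t N, below N (een t) -> size (venc (f t)) <= S N.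

(* [f] is computed in polynomial time: its arguments are read in the registers [rho], and its
   value is left in register [d], all registers from [d] on being initially empty. *)
Definition PT (E : env) (B : data) (f : E -> B) : Prop := polysize f /\
  forall rho d, size rho = ewidth E -> all (gtn d) rho -> exists R0, forall R, R0 <= R ->
  exists M T, pb T /\ forall s t N, bounded N s -> map s rho = een t -> free d s ->
  exec R M s (upd s d (venc (f t))) (T N).

Lemma PT_ext (E : env) (B : data) (f g : E -> B) : f =1 g -> PT f -> PT g.
Proof.
move=> fg [[S pS HS] H]; split; first by exists S => // t N; rewrite -fg; exact: HS.
move=> rho d sz al; have [R0 H0] := H rho d sz al; exists R0 => R RR.
have [M [T [pT HT]]] := H0 R RR; exists M, T; split=> // s t N.
by rewrite -fg; exact: HT.
Qed.

Lemma below_bounded N s rho (E : env) (t : E) :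
  bounded N s -> map s rho = een t -> below N (een t).
Proof. by move=> bs <-; apply: below_map. Qed.

Lemma map_upd (s : store) d v rho : all (gtn d) rho -> map (upd s d v) rho = map s rho.
Proof.
move=> al; apply/eq_in_map=> i /(allP al) /= lt; rewrite /upd.
by case: eqP => // E; lia.
Qed.

Lemma free_upd d d' (s : store) v : d' <= d -> free d' s -> free d.+1 (upd s d v).
Proof. by move=> le fs i lt; rewrite /upd; case: eqP => [E|_]; [lia | apply: fs; lia]. Qed.

Lemma all_gtn_le d d' rho : d <= d' -> all (gtn d) rho -> all (gtn d') rho.
Proof. by move=> le; apply: sub_all => i /= lt; apply: leq_trans le. Qed.

Lemma nth_below N vs j : below N vs -> size (nth [::] vs j) <= N.
Proof.
move=> al; case: (ltnP j (size vs)) => lt; last by rewrite nth_default.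
exact: (all_nthP _ al).
Qed.

(** Reading a register destroys it. The word is therefore moved to the scratch register [d.+1], and
    from there to [d] and back to [i] at the same time, which also undoes the reversal. *)
Lemma exec_copy R i d s N : i < d -> d.+1 < R -> bounded N s -> free d s ->
  exec R (aseq (dump id R i [:: d.+1]) (dump id R d.+1 [:: d; i])) s (upd s d (s i))
    (dumpcost R 1 N + dumpcost R 2 N).
Proof.
move=> lid dR bs fs.
have sd : s d = [::] by apply: fs.
have sd1 : s d.+1 = [::] by apply: fs; lia.
pose s1 := upd (upd s i [::]) d.+1 (rev (s i)).
have H1 : exec R (dump id R i [:: d.+1]) s s1 (dumpcost R 1 N).
  apply: exec_eq (exec_move _ _ _ bs) _ (leqnn _); try lia.
  move=> k; rewrite /s1 /upd sd1 catrevE cats0.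
  by case: (eqVneq k d.+1) => [->|//]; case: eqP => // E; lia.
apply: exec_seq H1 _.
have b1 : bounded N s1.
  by apply: bounded_upd; rewrite ?size_rev //; apply: bounded_upd.
apply: exec_eq (exec_dump _ _ _ _ b1) _ (leqnn _).
- by rewrite /= inE; lia.
- by rewrite !inE; lia.
- by rewrite /=; lia.
- move=> k; rewrite !inE map_id /s1 /upd eqxx !catrevE revK.
  case: (eqVneq k d.+1) => [->|k1].
    by rewrite sd1; case: eqP => // E; lia.
  case: (eqVneq k d) => [->|kd] /=.
    by rewrite sd; case: eqP => [E|_]; [lia | rewrite cats0].
  by case: (eqVneq k i) => [->|//]; rewrite cats0.
Qed.

Lemma PT_nth (E : env) (B : data) (f : E -> B) j : j < ewidth E ->
  (forall t, venc (f t) = nth [::] (een t) j) -> PT f.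
Proof.
move=> jw Hf; split.
  by exists id; [exact: pb_id | move=> t N bt; rewrite Hf; exact: nth_below].
move=> rho d sz al; exists d.+2 => R RR.
pose i := nth 0 rho j.
exists (aseq (dump id R i [:: d.+1]) (dump id R d.+1 [:: d; i])).
exists (fun N => dumpcost R 1 N + dumpcost R 2 N); split.
  by apply: pb_add; apply: pb_dumpcost; apply: pb_id.
move=> s t N bs ms fs; have -> : venc (f t) = s i.
  by rewrite Hf -ms (nth_map 0) // sz.
apply: exec_copy bs fs => //.
by apply: (all_nthP 0 al); rewrite sz.
Qed.

Lemma PT_input : PT (fun x : seq bool => x).
Proof. exact: (@PT_nth bits_env bits_val _ 0). Qed.

Lemma PT_last (E : env) (B : data) : PT (fun t : E * B => t.2).
Proof.
apply: (@PT_nth _ _ _ (ewidth E)) => //= t.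
by rewrite nth_rcons size_een ltnn eqxx.
Qed.

Lemma PT_weak (E : env) (B C : data) (f : E -> C) : PT f -> PT (fun t : E * B => f t.1).
Proof.
move=> [[S pS HS] H]; split.
  by exists S => // t N; rewrite /= /below all_rcons => /andP[_]; exact: HS.
move=> rho d; case/lastP: rho => [//|rho i].
rewrite size_rcons all_rcons => -[sz] /andP[_ al].
have [R0 H0] := H rho d sz al; exists R0 => R RR.
have [M [T [pT HT]]] := H0 R RR; exists M, T; split=> // s t N bs.
rewrite map_rcons => /rcons_inj[ms _]; exact: HT.
Qed.

Lemma PT_const (E : env) (B : data) (v : B) : PT (fun _ : E => v).
Proof.
split; first by exists (fun _ => size (venc v)); [exact: pb_const|].
move=> rho d sz al; exists d.+1 => R RR.
exists (foldr (fun b M => aseq M (push d R b)) anop (venc v)).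
exists (fun N => size (venc v) * opcost R (N + size (venc v)) + 1).
split; first by pbt.
move=> s t N bs _ fs; elim: (venc v) => [|b u IH] /=.
  apply: exec_eq (exec_nop R s) _ _; last by lia.
  by move=> k; rewrite /upd; case: eqP => // ->; apply: fs.
have bu : bounded (N + (size u).+1) (upd s d u).
  by apply: bounded_upd; [apply: bounded_le bs; lia | lia].
apply: exec_eq (exec_seq IH (exec_push RR bu b)) _ _.
  by move=> k; rewrite /upd eqxx; case: eqP.
by rewrite /opcost; nia.
Qed.

Lemma PT_post (E : env) (B C : data) (f : E -> B) (g : B -> C) k :
  (forall b, size (venc (g b)) <= size (venc b) + k) ->
  (forall d, exists R0, forall R, R0 <= R -> exists M T, pb T /\
    forall s b N, bounded N s -> s d = venc b -> free d.+1 s ->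
    exec R M s (upd s d (venc (g b))) (T N)) ->
  PT f -> PT (fun t => g (f t)).
Proof.
move=> Hs Hg [[S pS HS] Hf]; split.
  exists (fun N => S N + k) => [|t N bt]; first by pbt.
  by apply: leq_trans (Hs _) _; rewrite leq_add2r; apply: HS.
move=> rho d sz al; have [R1 H1] := Hf rho d sz al; have [R2 H2] := Hg d.
exists (maxn R1 R2) => R; rewrite geq_max => /andP[/H1[M1 [T1 [pT1 HT1]]] /H2[M2 [T2 [pT2 HT2]]]].
exists (aseq M1 M2), (fun N => T1 N + T2 (N + S N)); split; first by pbt.
move=> s t N bs ms fs; have bt := below_bounded bs ms.
have bu : bounded (N + S N) (upd s d (venc (f t))).
  apply: bounded_upd; first by apply: bounded_le bs; apply: leq_addr.
  by apply: leq_trans (HS _ _ bt) _; apply: leq_addl.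
apply: exec_eq (exec_seq (HT1 s t N bs ms fs) (HT2 _ (f t) _ bu _ _)) _ (leqnn _).
- by rewrite /upd eqxx.
- exact: free_upd fs.
- by move=> j; rewrite /upd; case: eqP.
Qed.

Lemma PT_cons (E : env) b (f : E -> seq bool) : PT f -> PT (fun t => b :: f t).
Proof.
apply: (@PT_post _ _ bits_val f (cons b) 1); first by move=> v /=; rewrite addn1.
move=> d; exists d.+1 => R dR; exists (push d R b), (fun N => opcost R N); split; first by pbt.
by move=> s v N bs sd _; rewrite -[X in b :: X]sd; apply: exec_push.
Qed.

Lemma PT_behead (E : env) (f : E -> seq bool) : PT f -> PT (fun t => behead (f t)).
Proof.
apply: (@PT_post _ _ bits_val f behead 0) => [v|d] /=; first by rewrite size_behead; lia.
exists d.+1 => R dR; exists (rtest d isbit (pop d R) anop), (fun N => 4 * opcost R N).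
split; first by pbt.
move=> s v N bs sd _.
have H : exec R (if isbit (ohead (s d)) then pop d R else anop) s
    (upd s d (behead v)) (opcost R N).
  rewrite -sd; case E0: (s d) => [|b u] /=.
    apply: exec_eq (exec_nop R s) _ _; last by rewrite /opcost; nia.
    by move=> k; rewrite /upd; case: eqP => // ->.
  by have := exec_pop dR bs; rewrite E0; apply.
apply: exec_eq (exec_rtest dR bs H) _ _ => //; lia.
Qed.

Lemma exec_setbit R d (b : bool) s N : d < R -> bounded N s ->
  exec R (aseq (dump id R d [::]) (if b then push d R true else anop)) s
    (upd s d (nseq b true)) (dumpcost R 0 N + opcost R N).
Proof.
move=> dR bs; have b1 : bounded N (upd s d [::]) by apply: bounded_upd.
have H1 : exec R (dump id R d [::]) s (upd s d [::]) (dumpcost R 0 N).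
  by apply: exec_eq (exec_dump _ _ _ _ bs) _ (leqnn _) => //=; rewrite dR.
have opp : 0 < opcost R N by rewrite /opcost; nia.
apply: exec_seq H1 _; case: b.
  apply: exec_eq (exec_push dR b1 true) _ (leqnn _) => k.
  by rewrite /upd eqxx; case: eqP.
by apply: exec_eq (exec_nop _ _) _ opp.
Qed.

Lemma PT_head (E : env) (f : E -> seq bool) : PT f -> PT (fun t => head false (f t)).
Proof.
apply: (@PT_post _ bits_val bool_val f (head false) 0) => [[|[] v]|d] //=.
exists d.+1 => R dR; exists (rtest d (pred1 (Some true))
  (aseq (dump id R d [::]) (push d R true)) (aseq (dump id R d [::]) anop)).
exists (fun N => dumpcost R 0 N + opcost R N + 3 * opcost R N).
split; first by have := @pb_dumpcost R 0 id pb_id; move=> ?; pbt.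
move=> s v N bs <- _; apply: (exec_rtest dR bs).
by case: (s d) => [|[] u]; [have := exec_setbit false dR bs | have := exec_setbit true dR bs
  | have := exec_setbit false dR bs].
Qed.

(** With [phi] constantly true this turns a word into its length in unary; with the identity it
    changes the type and keeps the encoding. *)
Lemma PT_transfer (E : env) (B C : data) (f : E -> B) (g : B -> C) phi :
  (forall b, venc (g b) = map phi (venc b)) -> PT f -> PT (fun t => g (f t)).
Proof.
move=> Hg; apply: (@PT_post _ _ _ f g 0) => [b|d]; first by rewrite Hg size_map addn0.
exists d.+2 => R dR; exists (aseq (dump phi R d [:: d.+1]) (dump id R d.+1 [:: d])).
exists (fun N => dumpcost R 1 N + dumpcost R 1 N).
split; first by apply: pb_add; apply: pb_dumpcost; pbt.
move=> s b N bs sd fs; have sd1 : s d.+1 = [::] by apply: fs.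
pose s1 := upd (upd s d [::]) d.+1 (rev (map phi (s d))).
have H1 : exec R (dump phi R d [:: d.+1]) s s1 (dumpcost R 1 N).
  apply: exec_eq (exec_dump _ _ _ _ bs) _ (leqnn _) => //=.
  - by rewrite inE; lia.
  - by rewrite dR ltnW.
  - move=> k; rewrite inE /s1 /upd; case: (eqVneq k d.+1) => [->|//].
    by rewrite sd1 catrevE cats0; case: eqP => // E0; lia.
have b1 : bounded N s1.
  by apply: bounded_upd; rewrite ?size_rev ?size_map //; apply: bounded_upd.
apply: exec_seq H1 _; apply: exec_eq (exec_move _ _ _ b1) _ (leqnn _); try lia.
move=> k; rewrite /s1 /upd eqxx catrevE revK Hg sd.
case: (eqVneq k d.+1) => [->|//]; first by rewrite sd1; case: eqP => // E0; lia.
by case: (eqVneq k d) => [->|//]; case: eqP => [E0|_]; [lia | rewrite ?eqxx cats0].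
Qed.

Lemma PT_size (E : env) (f : E -> seq bool) : PT f -> PT (fun t => size (f t)).
Proof.
apply: (@PT_transfer _ bits_val nat_val f size (fun=> true)) => v /=.
by elim: v => //= b v ->.
Qed.

Lemma PT_unary (E : env) (f : E -> nat) : PT f -> PT (fun t => nseq (f t) true).
Proof. by apply: (@PT_transfer _ nat_val bits_val f (nseq^~ true) id) => v /=; rewrite map_id. Qed.

Lemma PT_nat_of_bool (E : env) (f : E -> bool) : PT f -> PT (fun t => nat_of_bool (f t)).
Proof. by apply: (@PT_transfer _ bool_val nat_val f nat_of_bool id) => v /=; rewrite map_id. Qed.

(** The value of [e] stays in [d], which becomes the last register of the extended environment; [F]
    answers in [d.+1], and [replace] moves the answer over the intermediate value. Both machines
    must use the same number of registers, which is why [PT] allows every large enough [R]. *)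
Lemma PT_let (E : env) (B C : data) (e : E -> B) (F : E * B -> C) :
  PT e -> PT F -> PT (fun t => F (t, e t)).
Proof.
move=> [[Se pSe HSe] He] [[SF pSF HSF] HF].
have HS t N : below N (een t) -> below (N + Se N) (een (t, e t)).
  move=> bt; rewrite /= /below all_rcons; apply/andP; split.
    by apply: leq_trans (HSe _ _ bt) _; apply: leq_addl.
  by apply: sub_all bt => v le; apply: leq_trans le (leq_addr _ _).
split.
  by exists (fun N => SF (N + Se N)) => [|t N bt]; [pbt | apply: HSF; apply: HS].
move=> rho d sz al; have [R1 H1] := He rho d sz al.
have sz2 : size (rcons rho d) = ewidth (prod_env E B) by rewrite size_rcons sz.
have al2 : all (gtn d.+1) (rcons rho d).
  by rewrite all_rcons /= ltnSn; apply: all_gtn_le al.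
have [R2 H2] := HF (rcons rho d) d.+1 sz2 al2.
exists (maxn (maxn R1 R2) d.+3) => R; rewrite !geq_max => /andP[/andP[/H1 {}H1 /H2 {}H2] dR].
have [M1 [T1 [pT1 HT1]]] := H1; have [M2 [T2 [pT2 HT2]]] := H2.
exists (aseq M1 (aseq M2 (replace R d d.+1 d.+2))).
exists (fun N => T1 N + (T2 (N + Se N) + 3 * dumpcost R 1 (N + Se N + SF (N + Se N)))).
split; first by have := @pb_dumpcost R 1 id pb_id; move=> ?; pbt.
move=> s t N bs ms fs; have bt := below_bounded bs ms.
set s1 := upd s d (venc (e t)).
have b1 : bounded (N + Se N) s1.
  apply: bounded_upd; first by apply: bounded_le bs; apply: leq_addr.
  by apply: leq_trans (HSe _ _ bt) _; apply: leq_addl.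
have ms1 : map s1 (rcons rho d) = een (t, e t).
  by rewrite map_rcons map_upd // ms /s1 /upd eqxx.
have f1 : free d.+1 s1 by apply: free_upd fs.
have E2 := HT2 s1 (t, e t) _ b1 ms1 f1.
set w := venc (F (t, e t)) in E2 *; set s2 := upd s1 d.+1 w in E2.
have b2 : bounded (N + Se N + SF (N + Se N)) s2.
  apply: bounded_upd; first by apply: bounded_le b1; apply: leq_addr.
  by apply: leq_trans (HSF _ _ (HS _ _ bt)) _; apply: leq_addl.
apply: exec_eq (exec_seq (HT1 s t N bs ms fs) (exec_seq E2 (exec_replace _ _ b2 _))) _ (leqnn _).
- by rewrite /= !inE; lia.
- by rewrite /=; lia.
- rewrite /s2 /s1 /upd; do 2![case: eqP => [|_]; first by lia].
  by apply: fs; lia.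
- move=> k; rewrite /s2 /s1 /upd eqxx; case: eqP => // _; case: eqP => // ->.
  by rewrite fs.
Qed.

Lemma PT_if (E : env) (B : data) (b : E -> bool) (f g : E -> B) :
  PT b -> PT f -> PT g -> PT (fun t => if b t then f t else g t).
Proof.
move=> [[Sb pSb HSb] Hb] [[Sf pSf HSf] Hf] [[Sg pSg HSg] Hg]; split.
  exists (fun N => Sf N + Sg N) => [|t N bt]; first by pbt.
  by have := HSf t N bt; have := HSg t N bt; case: (b t); lia.
move=> rho d sz al; have [R1 H1] := Hb rho d sz al; have [R2 H2] := Hf rho d sz al.
have [R3 H3] := Hg rho d sz al.
exists (maxn (maxn R1 R2) (maxn R3 d.+1)) => R.
rewrite !geq_max => /andP[/andP[/H1 {}H1 /H2 {}H2] /andP[/H3 {}H3 dR]].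
have [M1 [T1 [pT1 HT1]]] := H1; have [M2 [T2 [pT2 HT2]]] := H2.
have [M3 [T3 [pT3 HT3]]] := H3.
exists (aseq M1 (rtest d isbit (aseq (pop d R) M2) M3)).
exists (fun N => T1 N + ((opcost R (N + 1) + T2 N + T3 N) + 3 * opcost R (N + 1))).
split; first by pbt.
move=> s t N bs ms fs.
have sd : s d = [::] by apply: fs.
have b1 : bounded (N + 1) (upd s d (venc (b t))).
  by apply: bounded_upd; [apply: bounded_le bs; lia | rewrite size_nseq; case: (b t) => /=; lia].
apply: exec_seq (HT1 s t N bs ms fs) (exec_rtest dR b1 _).
rewrite {1}/upd eqxx; case bt: (b t) => /=; last first.
  have E0 : upd s d [::] =1 s by move=> k; rewrite /upd; case: eqP => // ->.
  move=> l k; rewrite (eq_mkseq E0); have [k' Hk] := HT3 s t N bs ms fs l k.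
  by exists k'; apply: runs_le Hk; lia.
(* False is the empty word; true leaves a bit in [d], which is popped because the branch expects [d]
   to be empty. *)
rewrite bt in b1; have H := exec_pop dR b1.
have ne : upd s d (venc true) d != [::] by rewrite /upd eqxx.
have E0 : upd (upd s d (venc true)) d (behead (upd s d (venc true) d)) =1 s.
  by move=> k; rewrite /upd eqxx; case: eqP => // ->.
apply: exec_eq (exec_seq (exec_eq (H ne) E0 (leqnn _)) (HT2 s t N bs ms fs)) _ _ => //; lia.
Qed.

(** The accumulator once the indices from [n - 1] down to [i] have been treated: [foldr] meets the
    largest index first, in the order in which a unary counter decreases. *)
Definition iterdown (E : Type) (B : Type) (h : E * nat * B -> B) (t : E) (z : B) (i n : nat) :=
  foldr (fun j acc => h (t, j, acc)) z (iota i (n - i)).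

(* Without the size bound, doubling the accumulator at every step would be allowed. *)
Lemma PT_loop (E : env) (B : data) (n : E -> nat) (z : E -> B) (h : E * nat * B -> B) :
  PT n -> PT z -> PT h ->
  (exists2 S, pb S & forall t N, below N (een t) -> forall i, i <= n t ->
    size (venc (iterdown h t (z t) i (n t))) <= S N) ->
  PT (fun t => foldr (fun i acc => h (t, i, acc)) (z t) (iota 0 (n t))).
Proof.
move=> [[Sn pSn HSn] Hn] [_ Hz] [_ Hh] [S pS HS]; split.
  by exists S => // t N bt; have := HS t N bt 0 isT; rewrite /iterdown subn0.
move=> rho d sz al; have [R1 H1] := Hz rho d sz al.
have [R2 H2] := Hn rho d.+1 sz (all_gtn_le (leqnSn d) al).
(* The body reads the counter in [d.+1] and the accumulator in [d]; its result appears in [d.+2],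
   and [d.+3] is scratch. *)
pose rho' := rcons (rcons rho d.+1) d.
have sz2 : size rho' = ewidth (prod_env (prod_env E nat_val) B) by rewrite !size_rcons sz.
have al2 : all (gtn d.+2) rho'.
  by rewrite !all_rcons /= ltnSn ltnS leqnSn; apply: all_gtn_le al; lia.
have [R3 H3] := Hh rho' d.+2 sz2 al2.
exists (maxn (maxn R1 R2) (maxn R3 d.+4)) => R.
rewrite !geq_max => /andP[/andP[/H1 {}H1 /H2 {}H2] /andP[/H3 {}H3 dR]].
have [M1 [T1 [pT1 HT1]]] := H1; have [M2 [T2 [pT2 HT2]]] := H2.
have [M3 [T3 [pT3 HT3]]] := H3.
pose U N := N + S N + Sn N.
exists (aseq M1 (aseq M2 (rwhile d.+1
  (aseq (pop d.+1 R) (aseq M3 (replace R d d.+2 d.+3)))))).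
exists (fun N => T1 N + (T2 (N + S N) + (Sn N * (opcost R (U N) + (T3 (U N) +
  3 * dumpcost R 1 (U N)) + 3 * opcost R (U N)) + 3 * opcost R (U N)))).
have pU : pb U by rewrite /U; pbt.
split; first by have := @pb_dumpcost R 1 id pb_id; move=> ?; pbt.
move=> s t N bs ms fs; have bt := below_bounded bs ms.
pose acc i := iterdown h t (z t) i (n t).
have accn : acc (n t) = z t by rewrite /acc /iterdown subnn.
have accS i : i < n t -> acc i = h (t, i, acc i.+1).
  by move=> lt; rewrite /acc /iterdown (_ : n t - i = (n t - i.+1).+1) //; lia.
pose st i := upd (upd s d.+1 (nseq i true)) d (venc (acc i)).
have bst i : i <= n t -> bounded (U N) (st i).
  move=> le; apply: bounded_upd; last first.
    by apply: leq_trans (HS t N bt i le) _; rewrite /U; lia.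
  apply: bounded_upd; first by apply: bounded_le bs; rewrite /U; lia.
  have := HSn t N bt; rewrite /U /= !size_nseq; lia.
have E1 := HT1 s t N bs ms fs.
have bz : bounded (N + S N) (upd s d (venc (z t))).
  apply: bounded_upd; first by apply: bounded_le bs; lia.
  by rewrite -accn; apply: leq_trans (HS t N bt _ (leqnn _)) _; lia.
have E2 := HT2 (upd s d (venc (z t))) t _ bz _ (free_upd _ (leqnn d) fs).
rewrite map_upd // in E2; have {}E2 := E2 ms.
have E2' : exec R M2 (upd s d (venc (z t))) (st (n t)) (T2 (N + S N)).
  apply: exec_eq E2 _ (leqnn _) => k; rewrite /st accn /upd /=.
  by case: eqP => // ->; case: eqP => // E0; lia.
have E3 : exec R (rwhile d.+1 (aseq (pop d.+1 R) (aseq M3 (replace R d d.+2 d.+3))))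
    (st (n t - 0)) (st (n t - n t)) (n t * (opcost R (U N) + (T3 (U N) +
  3 * dumpcost R 1 (U N)) + 3 * opcost R (U N)) + 3 * opcost R (U N)).
  apply: (@exec_rwhile R d.+1 (U N) _ (fun j => st (n t - j))).
  - lia.
  - by move=> j le; apply: bst; rewrite leq_subr.
  - move=> j jn; set i := n t - j.+1.
    have ei : n t - j = i.+1 by rewrite /i; lia.
    have lei : i < n t by rewrite /i; lia.
    rewrite ei; have s1 : st i.+1 d.+1 = true :: nseq i true.
      by rewrite /st /upd eqxx; case: eqP => // E0; lia.
    split; first by rewrite s1.
    have P1 := exec_pop (N := U N) (s := st i.+1) (R := R) (i := d.+1) _ (bst _ lei).
    rewrite s1 /= in P1; have {}P1 := P1 ltac:(lia) isT.
    set s2 := upd (st i.+1) d.+1 (nseq i true) in P1.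
    have b2 : bounded (U N) s2.
      apply: bounded_upd; first exact: bst.
      have := HSn t N bt; rewrite /U /= !size_nseq; lia.
    have f2 : free d.+2 s2.
      move=> k le; rewrite /s2 /st /upd; do 2![case: eqP => [|_]; first by lia].
      by apply: fs; lia.
    have m2 : map s2 rho' = een (t, i, acc i.+1).
      rewrite /= !map_rcons /s2 {2}/upd eqxx {2}/upd.
      case: eqP => [|_]; first by lia.
      rewrite {2}/st {2}/upd eqxx -ms; congr (rcons (rcons _ _) _).
      by rewrite map_upd ?(all_gtn_le _ al) // /st map_upd // map_upd // (all_gtn_le _ al).
    have P2 := HT3 s2 (t, i, acc i.+1) _ b2 m2 f2; rewrite -accS // in P2.
    set s3 := upd s2 d.+2 _ in P2.
    have b3 : bounded (U N) s3.
      apply: bounded_upd => //; apply: leq_trans (HS t N bt i (ltnW lei)) _.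
      by rewrite /U; lia.
    apply: exec_eq (exec_seq P1 (exec_seq P2 (exec_replace _ _ b3 _))) _ (leqnn _).
    + by rewrite /= !inE; lia.
    + by rewrite /=; lia.
    + rewrite /s3 /s2 /st /upd; do 3![case: eqP => [|_]; first by lia].
      by apply: fs; lia.
    + move=> k; rewrite /s3 /s2 /st /upd eqxx.
      case: (eqVneq k d) => // kd; case: (eqVneq k d.+2) => [->|_]; last by case: (k == d.+1).
      by rewrite fs ?(gtn_eqF (ltnSn _)) //; lia.
  - by rewrite subnn /st /upd eqxx; case: eqP => // E0; lia.
rewrite subn0 subnn in E3.
apply: exec_eq (exec_seq E1 (exec_seq E2' E3)) _ _.
  move=> k; rewrite /st /upd /acc /iterdown subn0; case: eqP => // _; case: eqP => // ->.
  by rewrite fs.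
have := HSn t N bt; rewrite /= size_nseq => le.
by rewrite !leq_add2l leq_add2r leq_mul2r le orbT.
Qed.

(** * From register programs to Turing machines *)

Lemma pb_std T : pb T -> exists c, forall n, T n <= n ^ c + c.
Proof.
(* From [n = 2] on, [n + 2 <= n ^ 2] gives the exponent [2 * c]; the cases 0 and 1 are absorbed by
   the additive [3 ^ c]. *)
move=> [c Hc]; exists (3 ^ c + 2 * c) => n; apply: leq_trans (Hc n) _.
case: n => [|[|n]].
- apply: leq_trans (leq_addl _ _); apply: leq_trans (leq_addr _ _).
  by case: (c) => // k; rewrite leq_exp2r.
- apply: leq_trans (leq_addl _ _); exact: leq_addr.
- apply: leq_trans (leq_addr _ _); apply: (@leq_trans ((n.+2 ^ 2) ^ c)).
    by case: (c) => // k; rewrite leq_exp2r // -mulnn; nia.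
  by rewrite -expnM leq_exp2l // leq_addl.
Qed.

(** The input word is not closed by a blank; the loop stops on the blank met past the right end of
    the tape. *)
Lemma runs_skip1_end l v :
  runs skip1 (l, None, map Some v) (size v * 2 + 2) (rseg v l, None, [::]).
Proof.
have W u : forall c l', runs (awhile isbit mvR) (tmove c MoveR (l', None, map Some u))
    (size u * 2 + 1) (catrev (map Some u) (c :: l'), None, [::]).
  elim: u => [|b u IH] c l' /=; first exact: runs_while_stop.
  apply: runs_cast; first by apply: runs_while_next _ (runs_mvR _ _ _) (IH (Some b) (c :: l')).
    by rewrite /=; lia.
  by [].
apply: runs_cast (runs_seq (runs_mvR l None (map Some v)) (W v None l)) _ erefl; lia.
Qed.

(** The move to the left creates the blank in front of the input, and the excursion over [R]
    registers materialises the blanks that close the input and the empty registers. *)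
Definition prelude R := aseq mvL (aseq (arep R skip1) (arep R back1)).

Definition start_tape (x : seq bool) : tape :=
  if x is b :: x' then ([::], Some b, map Some x') else ([::], None, [::]).

Lemma runs_prelude R x : runs (prelude R.+1) (start_tape x)
  (2 * opcost R.+1 (size x)) ([::], None, segs (x :: nseq R [::]) [::]).
Proof.
have H0 : exists2 r, runs mvL (start_tape x) 1 ([::], None, r) &
    runs skip1 ([::], None, r) (size x * 2 + 2) (rseg x [::], None, [::]).
  case: x => [|b x]; first by exists [:: None];
    [exact: runs_mvL | exact: (@runs_skip1 [::] [::] [::])].
  by exists (map Some (b :: x)); [exact: runs_mvL | exact: runs_skip1_end].
have [r H1 H2] := H0.
have H3 k l : runs (arep k skip1) (l, None, [::]) (k * 3 + 1) (rsegs (nseq k [::]) l, None, [::]).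
  elim: k l => [|k IH] l; first exact: runs_nop.
  by apply: runs_cast (runs_seq (runs_skip1_end l [::]) (IH _)) _ erefl; rewrite /=; lia.
have bel : below (size x) (x :: nseq R [::]) by rewrite /below /= leqnn all_nseq orbT.
have H4 := runs_back [::] [::] bel; rewrite [size _]/= size_nseq in H4.
apply: runs_cast (runs_seq H1 (runs_seq (runs_seq H2 (H3 R _)) H4)) _ erefl.
by rewrite /opcost; nia.
Qed.

Lemma read_bits_seg v r : read_bits (seg v r) = v.
Proof. by rewrite /seg; elim: v => //= b v ->. Qed.

(** The input is in register 0 and the value in register 1; the final moves bring the head to the
    first cell of the latter, where [output] and the acceptance test read. *)
Definition machine R M := aseq (prelude R) (aseq M (aseq skip1 mvR)).

Lemma init_conf M x : init M x = conf (tm_start M) (start_tape x).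
Proof. by case: x. Qed.

Lemma PT_runs (B : data) (f : seq bool -> B) : PT f -> exists M T, pb T /\ forall x,
  exists l h r, [/\ runs M (start_tape x) (T (size x)) (l, h, r),
    read_bits (h :: r) = venc (f x) & h = ohead (venc (f x))].
Proof.
move=> [[S pS HS] H]; have [R0 {}H] := H [:: 0] 1 erefl isT.
have [M [T [pT HT]]] := H R0.+2 (ltnW (leqnSn _)).
exists (machine R0.+2 M), (fun N => 2 * opcost R0.+2 N + (T N + (N * 2 + 2 + 1))).
split; first by pbt.
move=> x; pose s0 : store := fun i => if i == 0 then x else [::].
have bs0 : bounded (size x) s0 by move=> i; rewrite /s0; case: ifP.
have fs0 : free 1 s0 by case.
have [b Hb] := HT s0 x (size x) bs0 erefl fs0 [::] 0.
have E0 : mkseq s0 R0.+2 = x :: nseq R0.+1 [::].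
  have Hn k : forall i, 0 < i -> map s0 (iota i k) = nseq k [::].
    by elim: k => //= k IH [//|i] _; rewrite IH.
  by have := Hn R0.+1 1 isT; rewrite /mkseq /= => ->.
rewrite E0 in Hb; set v := venc (f x).
set r2 := segs _ (nseq b None) in Hb.
have E2 : r2 = seg x (seg v (segs (map (upd s0 1 v) (iota 2 R0)) (nseq b None))).
  by [].
set r3 := segs _ (nseq b None) in E2; rewrite E2 in Hb.
have H3 := runs_skip1 [::] x (seg v r3).
have [l [h [r [H4 e4]]]] : exists l h r, runs mvR (rseg x [::], None, seg v r3) 1 (l, h, r) /\
    h :: r = seg v r3.
  have := runs_mvR (rseg x [::]) None (seg v r3).
  by case: (v) => [|b' v'] H4; do 3!eexists; split; try exact: H4.
exists l, h, r; split.
- apply: runs_cast (runs_seq (runs_prelude R0.+1 x) (runs_seq Hb (runs_seq H3 H4))) _ erefl.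
  by [].
- by rewrite e4 read_bits_seg.
- by case: (v) e4 => [|b' v'] [-> _].
Qed.

Theorem PT_poly_computable (f : seq bool -> seq bool) : PT f -> poly_computable f.
Proof.
move=> /PT_runs[M [T [pT HT]]].
have [c Hc] : exists c, forall n, T n + 1 <= n ^ c + c by apply: pb_std; pbt.
exists (tm_of M), c => x; have [l [h [r [H Hr _]]]] := HT x.
have [m lem Hm] := tm_of_run H; exists m; rewrite init_conf Hm /=; split=> //.
by apply: leq_trans lem _; rewrite -addn1.
Qed.

Theorem PT_in_P (b : seq bool -> bool) : PT b -> in_P b.
Proof.
move=> /PT_runs[M [T [pT HT]]].
have [c Hc] : exists c, forall n, T n + 1 <= n ^ c + c by apply: pb_std; pbt.
exists (tm_of M), c => x; have [l [h [r [H _ Hh]]]] := HT x.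
have [m lem Hm] := tm_of_run H; exists m; rewrite init_conf Hm /=; split.
  by apply: leq_trans lem _; rewrite -addn1.
by split=> //; rewrite Hh; case: (b x).
Qed.

(** * Changing the environment *)

Lemma PT_select (E E' : env) (C : data) (e : E -> E') (sg : seq nat) (F : E' -> C) :
  all (gtn (ewidth E)) sg -> (forall t, een (e t) = map (nth [::] (een t)) sg) ->
  PT F -> PT (fun t => F (e t)).
Proof.
move=> alg He [[S pS HS] H].
(* If the widths disagree then [E] has no element, and any machine will do. *)
have szg : size sg = ewidth E' \/ forall t : E, False.
  case: (eqVneq (size sg) (ewidth E')) => [|ne]; [by left | right=> t].
  by move/eqP: ne; apply; rewrite -(size_een (e t)) He size_map.
split.
  exists S => // t N bt; apply: HS; rewrite He; apply/allP=> v /mapP[j _ ->].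
  exact: nth_below.
move=> rho d sz al.
case: szg => [szg|no]; last first.
  by exists 0 => R _; exists anop, id; split=> [|s t]; [exact: pb_id | case: (no t)].
have al2 : all (gtn d) (map (nth 0 rho) sg).
  apply/allP=> i /mapP[j /(allP alg) /= jw ->].
  by apply: (all_nthP 0 al); rewrite sz.
(* No code is added: the machine of [F] is built to read its arguments in the selected registers. *)
have [R0 H0] := H (map (nth 0 rho) sg) d (etrans (size_map _ _) szg) al2.
exists R0 => R RR; have [M [T [pT HT]]] := H0 R RR; exists M, T; split=> // s t N bs ms fs.
apply: HT => //; rewrite He -ms -map_comp; apply/eq_in_map=> j /(allP alg) /= jw.
by rewrite /= (nth_map 0) // sz.
Qed.

Lemma nth_een_last (E : env) (B : data) (t : E * B) :
  nth [::] (rcons (een t.1) (venc t.2)) (ewidth E) = venc t.2.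
Proof. by rewrite nth_rcons size_een ltnn eqxx. Qed.

Lemma ltn_widths w : (((w < w) = false) * ((w < w.+1) = true) * ((w < w.+2) = true) *
  ((w < w.+3) = true) * ((w < w.+4) = true) * ((w.+1 == w.+1) = true) * ((w == w) = true))%type.
Proof. by rewrite !eqxx; do ?split; lia. Qed.

(** The pattern of all [PT_app] lemmas: [PT_let] computes the arguments one after the other, then
    [PT_select] hides the environment of the caller. *)
Lemma PT_app1 (E : env) (C : data) (F : seq bool -> C) (e : E -> seq bool) :
  PT F -> PT e -> PT (fun t => F (e t)).
Proof.
move=> pF pe; apply: (PT_let (F := fun p : E * seq bool => F p.2) pe).
apply: (@PT_select _ bits_env _ (fun p : E * seq bool => p.2) [:: ewidth E]) pF => [|t] /=.
  by rewrite ltnSn.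
by rewrite nth_een_last.
Qed.

Lemma PT_app2 (E : env) (B C : data) (F : seq bool * B -> C)
  (e1 : E -> seq bool) (e2 : E -> B) :
  PT F -> PT e1 -> PT e2 -> PT (fun t => F (e1 t, e2 t)).
Proof.
move=> pF p1 p2.
apply: (PT_let (F := fun p : E * seq bool => F (p.2, e2 p.1)) p1).
apply: (PT_let (F := fun p : E * seq bool * B => F (p.1.2, p.2)) (PT_weak _ p2)).
apply: (@PT_select _ (prod_env bits_env B) _ (fun p : E * seq bool * B => (p.1.2, p.2))
  [:: ewidth E; (ewidth E).+1]) pF => [|t] /=; first by rewrite !ltn_widths.
by rewrite !nth_rcons !size_rcons !size_een !ltn_widths.
Qed.

Lemma PT_app3 (E : env) (B1 B2 C : data) (F : seq bool * B1 * B2 -> C)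
  (e1 : E -> seq bool) (e2 : E -> B1) (e3 : E -> B2) :
  PT F -> PT e1 -> PT e2 -> PT e3 -> PT (fun t => F (e1 t, e2 t, e3 t)).
Proof.
move=> pF p1 p2 p3.
apply: (PT_let (F := fun p : E * seq bool => F (p.2, e2 p.1, e3 p.1)) p1).
apply: (PT_let (F := fun p : E * seq bool * B1 => F (p.1.2, p.2, e3 p.1.1)) (PT_weak _ p2)).
apply: (PT_let (F := fun p : E * seq bool * B1 * B2 => F (p.1.1.2, p.1.2, p.2))
  (PT_weak _ (PT_weak _ p3))).
apply: (@PT_select _ (prod_env (prod_env bits_env B1) B2) _
  (fun p : E * seq bool * B1 * B2 => (p.1.1.2, p.1.2, p.2))
  [:: ewidth E; (ewidth E).+1; (ewidth E).+2]) pF => [|t] /=; first by rewrite !ltn_widths.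
by rewrite !nth_rcons !size_rcons !size_een !ltn_widths.
Qed.

Lemma PT_app4 (E : env) (B1 B2 B3 C : data) (F : seq bool * B1 * B2 * B3 -> C)
  (e1 : E -> seq bool) (e2 : E -> B1) (e3 : E -> B2) (e4 : E -> B3) :
  PT F -> PT e1 -> PT e2 -> PT e3 -> PT e4 -> PT (fun t => F (e1 t, e2 t, e3 t, e4 t)).
Proof.
move=> pF p1 p2 p3 p4.
apply: (PT_let (F := fun p : E * seq bool => F (p.2, e2 p.1, e3 p.1, e4 p.1)) p1).
apply: (PT_let (F := fun p : E * seq bool * B1 => F (p.1.2, p.2, e3 p.1.1, e4 p.1.1))
  (PT_weak _ p2)).
apply: (PT_let (F := fun p : E * seq bool * B1 * B2 => F (p.1.1.2, p.1.2, p.2, e4 p.1.1.1))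
  (PT_weak _ (PT_weak _ p3))).
apply: (PT_let (F := fun p : E * seq bool * B1 * B2 * B3 =>
  F (p.1.1.1.2, p.1.1.2, p.1.2, p.2)) (PT_weak _ (PT_weak _ (PT_weak _ p4)))).
apply: (@PT_select _ (prod_env (prod_env (prod_env bits_env B1) B2) B3) _
  (fun p : E * seq bool * B1 * B2 * B3 => (p.1.1.1.2, p.1.1.2, p.1.2, p.2))
  [:: ewidth E; (ewidth E).+1; (ewidth E).+2; (ewidth E).+3]) pF => [|t] /=;
  first by rewrite !ltn_widths.
by rewrite !nth_rcons !size_rcons !size_een !ltn_widths.
Qed.

Lemma PT_v1 (E : env) (B B0 : data) : PT (fun t : E * B * B0 => t.1.2).
Proof. exact: (PT_weak _ (@PT_last E B)). Qed.
Lemma PT_v2 (E : env) (B B0 B1 : data) :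
  PT (fun t : E * B * B1 * B0 => t.1.1.2).
Proof. exact: (PT_weak _ (@PT_v1 E B _)). Qed.
Lemma PT_v3 (E : env) (B B0 B1 B2 : data) :
  PT (fun t : E * B * B2 * B1 * B0 => t.1.1.1.2).
Proof. exact: (PT_weak _ (@PT_v2 E B _ _)). Qed.
Lemma PT_v4 (E : env) (B B0 B1 B2 B3 : data) :
  PT (fun t : E * B * B3 * B2 * B1 * B0 => t.1.1.1.1.2).
Proof. exact: (PT_weak _ (@PT_v3 E B _ _ _)). Qed.
Lemma PT_v5 (E : env) (B B0 B1 B2 B3 B4 : data) :
  PT (fun t : E * B * B4 * B3 * B2 * B1 * B0 => t.1.1.1.1.1.2).
Proof. exact: (PT_weak _ (@PT_v4 E B _ _ _ _)). Qed.
Lemma PT_v6 (E : env) (B B0 B1 B2 B3 B4 B5 : data) :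
  PT (fun t : E * B * B5 * B4 * B3 * B2 * B1 * B0 => t.1.1.1.1.1.1.2).
Proof. exact: (PT_weak _ (@PT_v5 E B _ _ _ _ _)). Qed.
Lemma PT_x1 (B0 : data) : PT (fun t : seq bool * B0 => t.1).
Proof. exact: (PT_weak _ PT_input). Qed.
Lemma PT_x2 (B0 B1 : data) :
  PT (fun t : seq bool * B1 * B0 => t.1.1).
Proof. exact: (PT_weak _ (@PT_x1 _)). Qed.
Lemma PT_x3 (B0 B1 B2 : data) :
  PT (fun t : seq bool * B2 * B1 * B0 => t.1.1.1).
Proof. exact: (PT_weak _ (@PT_x2 _ _)). Qed.
Lemma PT_x4 (B0 B1 B2 B3 : data) :
  PT (fun t : seq bool * B3 * B2 * B1 * B0 => t.1.1.1.1).
Proof. exact: (PT_weak _ (@PT_x3 _ _ _)). Qed.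
Lemma PT_x5 (B0 B1 B2 B3 B4 : data) :
  PT (fun t : seq bool * B4 * B3 * B2 * B1 * B0 => t.1.1.1.1.1).
Proof. exact: (PT_weak _ (@PT_x4 _ _ _ _)). Qed.
Lemma PT_x6 (B0 B1 B2 B3 B4 B5 : data) :
  PT (fun t : seq bool * B5 * B4 * B3 * B2 * B1 * B0 => t.1.1.1.1.1.1).
Proof. exact: (PT_weak _ (@PT_x5 _ _ _ _ _)). Qed.
Lemma PT_x7 (B0 B1 B2 B3 B4 B5 B6 : data) :
  PT (fun t : seq bool * B6 * B5 * B4 * B3 * B2 * B1 * B0 => t.1.1.1.1.1.1.1).
Proof. exact: (PT_weak _ (@PT_x6 _ _ _ _ _ _)). Qed.

Ltac ptvar := first [assumption | exact: PT_input | exact: PT_last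
  | exact: PT_v1 | exact: PT_v2 | exact: PT_v3 | exact: PT_v4 | exact: PT_v5 | exact: PT_v6
  | exact: PT_x1 | exact: PT_x2 | exact: PT_x3 | exact: PT_x4 | exact: PT_x5 | exact: PT_x6
  | exact: PT_x7].

Lemma PT_polysize (E : env) (B : data) (f : E -> B) : PT f -> polysize f.
Proof. by case. Qed.

(** An increment bounded independently of the accumulator adds at most [n * G] in total, which meets
    the size condition of [PT_loop]. *)
Lemma PT_loop_inc (E : env) (B : data) (n : E -> nat) (z : E -> B) (h : E -> nat -> B -> B) :
  PT n -> PT z -> PT (fun p : E * nat * B => h p.1.1 p.1.2 p.2) ->
  (exists2 G, pb G & forall t N i acc, below N (een t) -> i < n t ->
    size (venc (h t i acc)) <= size (venc acc) + G N) ->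
  PT (fun t => foldr (h t) (z t) (iota 0 (n t))).
Proof.
move=> pn pz ph [G pG HG].
have [Sn pSn HSn] := PT_polysize pn; have [Sz pSz HSz] := PT_polysize pz.
apply: (PT_loop (h := fun p => h p.1.1 p.1.2 p.2) pn pz ph).
exists (fun N => Sz N + Sn N * G N) => [|t N bt i le]; first by pbt.
have := HSn t N bt; rewrite /= size_nseq => len.
have H k j : k <= n t - j -> j <= n t ->
    size (venc (foldr (h t) (z t) (iota j k))) <= Sz N + k * G N.
  elim: k j => [|k IH] j lek lej /=; first by apply: leq_trans (HSz t N bt) (leq_addr _ _).
  have lt : j < n t by lia.
  apply: leq_trans (HG t N j _ bt lt) _; have := IH j.+1.
  by rewrite subnS -ltnS prednK ?subn_gt0 // => /(_ lek lt); lia.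
apply: leq_trans (H _ _ (leqnn _) le) _.
by rewrite leq_add2l leq_mul2r; apply/orP; right; lia.
Qed.

Lemma PT_loop_bounded (E : env) (B : data) (n : E -> nat) (z : E -> B) (h : E -> nat -> B -> B) :
  PT n -> PT z -> PT (fun p : E * nat * B => h p.1.1 p.1.2 p.2) ->
  (exists2 G, pb G & forall t N i acc, below N (een t) -> i < n t ->
    size (venc (h t i acc)) <= G N) ->
  PT (fun t => foldr (h t) (z t) (iota 0 (n t))).
Proof.
move=> pn pz ph [G pG HG]; apply: PT_loop_inc => //; exists G => // t N i acc bt lt.
by apply: leq_trans (HG _ _ _ _ bt lt) (leq_addl _ _).
Qed.

(** * Arithmetic, bounded quantifiers and word operations *)

Lemma PT_S (E : env) (f : E -> nat) : PT f -> PT (fun t => (f t).+1).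
Proof.
move=> pf; apply: PT_ext (PT_size (PT_cons true (PT_unary pf))) => t.
by rewrite /= size_nseq.
Qed.

Lemma PT_pred (E : env) (f : E -> nat) : PT f -> PT (fun t => (f t).-1).
Proof.
move=> pf; apply: PT_ext (PT_size (PT_behead (PT_unary pf))) => t.
by rewrite size_behead size_nseq.
Qed.

Lemma PT_gt0 (E : env) (f : E -> nat) : PT f -> PT (fun t => 0 < f t).
Proof.
move=> pf; apply: PT_ext (PT_head (PT_unary pf)) => t; by case: (f t).
Qed.

Lemma PT_neg (E : env) (a : E -> bool) : PT a -> PT (fun t => ~~ a t).
Proof.
move=> pa; apply: PT_ext (PT_if pa (PT_const _ false) (PT_const _ true)) => t.
by case: (a t).
Qed.

Lemma PT_and (E : env) (a b : E -> bool) : PT a -> PT b -> PT (fun t => a t && b t).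
Proof. by move=> pa pb; apply: (PT_if pa pb (PT_const _ false)). Qed.

Lemma PT_or (E : env) (a b : E -> bool) : PT a -> PT b -> PT (fun t => a t || b t).
Proof. by move=> pa pb; apply: (PT_if pa (PT_const _ true) pb). Qed.

Lemma PT_eqb (E : env) (a b : E -> bool) : PT a -> PT b -> PT (fun t => a t == b t).
Proof.
move=> pa pb; apply: PT_ext (PT_if pa pb (PT_neg pb)) => t.
by case: (a t); case: (b t).
Qed.

Lemma PT_addb (E : env) (a b : E -> bool) : PT a -> PT b -> PT (fun t => a t (+) b t).
Proof.
move=> pa pb; apply: PT_ext (PT_if pa (PT_neg pb) pb) => t.
by case: (a t); case: (b t).
Qed.

Lemma PT_add (E : env) (f g : E -> nat) : PT f -> PT g -> PT (fun t => f t + g t).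
Proof.
move=> pf pg; apply: (@PT_ext _ _ (fun t => foldr (fun _ acc => acc.+1) (f t) (iota 0 (g t)))).
  by move=> t; elim: (g t) 0 => [|k IH] i /=; rewrite ?addn0 // IH addnS.
apply: PT_loop_inc => //; first by apply: PT_S; ptvar.
by exists (fun _ => 1) => [|t N i acc _ _] /=; [pbt | rewrite !size_nseq addn1].
Qed.

Lemma PT_sub (E : env) (f g : E -> nat) : PT f -> PT g -> PT (fun t => f t - g t).
Proof.
move=> pf pg; apply: (@PT_ext _ _ (fun t => foldr (fun _ acc => acc.-1) (f t) (iota 0 (g t)))).
  by move=> t; elim: (g t) 0 => [|k IH] i /=; rewrite ?subn0 // IH subnS.
apply: PT_loop_inc => //; first by apply: PT_pred; ptvar.
by exists (fun _ => 1) => [|t N i acc _ _] /=; [pbt | rewrite !size_nseq; lia].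
Qed.

Lemma PT_mul (E : env) (f g : E -> nat) : PT f -> PT g -> PT (fun t => f t * g t).
Proof.
move=> pf pg; apply: (@PT_ext _ _ (fun t => foldr (fun _ acc => f t + acc) 0 (iota 0 (g t)))).
  by move=> t; rewrite -[g t in RHS](size_iota 0); elim: (iota 0 _) => [|i l IH] /=;
    rewrite ?muln0 ?IH ?mulnS.
have [S pS HS] := PT_polysize pf.
apply: (PT_loop_inc (h := fun t _ acc => f t + acc)) => //; first exact: PT_const.
  apply: PT_add; last by ptvar.
  exact: (PT_weak _ (PT_weak _ pf)).
exists S => // t N i acc bt _ /=; have := HS t N bt; rewrite /= !size_nseq; lia.
Qed.

Lemma PT_exp (E : env) (f : E -> nat) c : PT f -> PT (fun t => f t ^ c).
Proof.
move=> pf; elim: c => [|c IH]; first exact: (PT_const _ 1).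
by apply: PT_ext (PT_mul pf IH) => t; rewrite expnS.
Qed.

Lemma PT_leq (E : env) (f g : E -> nat) : PT f -> PT g -> PT (fun t => f t <= g t).
Proof.
move=> pf pg; apply: PT_ext (PT_neg (PT_gt0 (PT_sub pf pg))) => t.
by rewrite -eqn0Ngt.
Qed.

Lemma PT_eqn (E : env) (f g : E -> nat) : PT f -> PT g -> PT (fun t => f t == g t).
Proof.
move=> pf pg; apply: PT_ext (PT_and (PT_leq pf pg) (PT_leq pg pf)) => t.
by rewrite eqn_leq.
Qed.

Lemma PT_imp (E : env) (a b : E -> bool) : PT a -> PT b -> PT (fun t => a t ==> b t).
Proof. by move=> pa pb; apply: (PT_if pa pb (PT_const _ true)). Qed.

Lemma PT_count (E : env) (p : E -> nat -> bool) (n : E -> nat) :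
  PT (fun q : E * nat => p q.1 q.2) -> PT n -> PT (fun t => count (p t) (iota 0 (n t))).
Proof.
move=> pp pn.
apply: (@PT_ext _ _ (fun t => foldr (fun i acc => p t i + acc) 0 (iota 0 (n t)))).
  by move=> t; elim: (iota _ _) => //= i l ->.
apply: (PT_loop_inc (h := fun t i acc => p t i + acc)) => //; first exact: PT_const.
  apply: PT_add; last by ptvar.
  exact: (PT_weak _ (PT_nat_of_bool pp)).
exists (fun=> 1) => [|t N i acc _ _] /=; first exact: pb_const.
by rewrite !size_nseq; case: (p t i) => /=; lia.
Qed.

Lemma PT_has (E : env) (p : E -> nat -> bool) (n : E -> nat) :
  PT (fun q : E * nat => p q.1 q.2) -> PT n -> PT (fun t => has (p t) (iota 0 (n t))).
Proof.
by move=> pp pn; apply: PT_ext (PT_gt0 (PT_count pp pn)) => t; rewrite has_count.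
Qed.

Lemma PT_all (E : env) (p : E -> nat -> bool) (n : E -> nat) :
  PT (fun q : E * nat => p q.1 q.2) -> PT n -> PT (fun t => all (p t) (iota 0 (n t))).
Proof.
move=> pp pn; apply: PT_ext (PT_eqn (PT_count pp pn) pn) => t.
by rewrite all_count size_iota.
Qed.

Lemma PT_mkseq (E : env) (p : E -> nat -> bool) (n : E -> nat) :
  PT (fun q : E * nat => p q.1 q.2) -> PT n -> PT (fun t => mkseq (p t) (n t)).
Proof.
move=> pp pn.
apply: (@PT_ext _ _ (fun t => foldr (fun i acc => if p t i then true :: acc else false :: acc)
    [::] (iota 0 (n t)))).
  by move=> t; rewrite /mkseq; elim: (iota _ _) => //= i l ->; case: (p t i).
apply: (PT_loop_inc (h := fun t i acc => if p t i then true :: acc else false :: acc)) => //.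
- exact: PT_const.
- by apply: PT_if; [exact: (PT_weak _ pp) | apply: PT_cons; ptvar | apply: PT_cons; ptvar].
- exists (fun=> 1) => [|t N i acc _ _]; first exact: pb_const.
  by case: (p t i) => /=; lia.
Qed.

Lemma PT_nthb (E : env) (x : E -> seq bool) (i : E -> nat) :
  PT x -> PT i -> PT (fun t => nth false (x t) (i t)).
Proof.
move=> px pi.
apply: (@PT_ext _ _ (fun t => head false (foldr (fun _ acc => behead acc) (x t) (iota 0 (i t))))).
  move=> t; rewrite -nth0 -[i t in RHS]addn0 -nth_drop; congr nth.
  by elim: (i t) 0 => [|k IH] j /=; rewrite ?drop0 // IH -drop1 drop_drop add1n.
apply: PT_head; apply: (PT_loop_inc (h := fun _ _ acc => behead acc)) => //.
  by apply: PT_behead; ptvar.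
by exists (fun=> 0) => [|t N j acc _ _] /=; [exact: pb_const | rewrite size_behead; lia].
Qed.

Lemma count_iota_lt n k : count (fun i => i < k) (iota 0 n) = minn k n.
Proof.
elim: n => [|n IH]; first by rewrite minn0.
by rewrite -addn1 iotaD count_cat IH add0n /=; lia.
Qed.

(** The quotient is the number of positive multiples of [g] up to [f]; a bounded count replaces the
    division algorithm. *)
Lemma PT_div (E : env) (f g : E -> nat) : PT f -> PT g -> PT (fun t => f t %/ g t).
Proof.
move=> pf pg.
apply: (@PT_ext _ _ (fun t => if 0 < g t then
    count (fun i => i.+1 * g t <= f t) (iota 0 (f t)) else 0)).
  move=> t; case: ltnP => [g0|]; last by rewrite leqn0 => /eqP->; rewrite divn0.
  rewrite (@eq_count _ _ (fun i => i < f t %/ g t)).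
    by rewrite count_iota_lt; apply/minn_idPl; exact: leq_div.
  by move=> i /=; rewrite leq_divRL.
apply: PT_if; [exact: PT_gt0 | | exact: (PT_const _ 0)].
apply: (PT_count (p := fun t i => i.+1 * g t <= f t)) => //.
apply: PT_leq; last exact: (PT_weak _ pf).
by apply: PT_mul; [apply: PT_S; ptvar | exact: (PT_weak _ pg)].
Qed.

Lemma PT_mod (E : env) (f g : E -> nat) : PT f -> PT g -> PT (fun t => f t %% g t).
Proof.
move=> pf pg; apply: PT_ext (PT_sub pf (PT_mul (PT_div pf pg) pg)) => t.
by rewrite [X in X - _](divn_eq (f t) (g t)) addKn.
Qed.

(** The list is fixed in advance, so that selecting in it is a finite cascade of conditionals. *)
Lemma PT_nth_const (E : env) (ps : seq (E -> bool)) (r : E -> nat) :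
  (forall i, PT (nth (fun=> false) ps i)) -> PT r ->
  PT (fun t => nth (fun=> false) ps (r t) t).
Proof.
elim: ps r => [|p ps IH] r Hps pr.
  by apply: PT_ext (PT_const _ false) => t; rewrite nth_nil.
have H := IH (fun t => (r t).-1) (fun i => Hps i.+1) (PT_pred pr).
apply: PT_ext (PT_if (PT_gt0 pr) H (Hps 0)) => t.
by case: (r t).
Qed.

Lemma PT_has_const (E : env) (T : Type) (ps : T -> E -> bool) (l : seq T) :
  (forall i, PT (ps i)) -> PT (fun t => has (ps^~ t) l).
Proof.
move=> H; elim: l => [|i l IH]; first exact: (PT_const _ false).
exact: PT_or.
Qed.

Ltac pt := lazymatch goal with
  | |- PT (fun _ => ?k) => exact: (PT_const _ k)
  | |- PT (fun t => fst (@?f t)) => ptvar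
  | |- PT (fun t => snd (@?f t)) => ptvar
  | |- PT (fun t => t) => ptvar
  | |- PT (fun t => S (@?f t)) => refine (@PT_S _ f _); pt
  | |- PT (fun t => predn (@?f t)) => refine (@PT_pred _ f _); pt
  | |- PT (fun t => addn (@?f t) (@?g t)) => refine (@PT_add _ f g _ _); pt
  | |- PT (fun t => subn (@?f t) (@?g t)) => refine (@PT_sub _ f g _ _); pt
  | |- PT (fun t => muln (@?f t) (@?g t)) => refine (@PT_mul _ f g _ _); pt
  | |- PT (fun t => divn (@?f t) (@?g t)) => refine (@PT_div _ f g _ _); pt
  | |- PT (fun t => modn (@?f t) (@?g t)) => refine (@PT_mod _ f g _ _); pt
  | |- PT (fun t => leq (@?f t) (@?g t)) => refine (@PT_leq _ f g _ _); pt
  | |- PT (fun t => @eq_op _ (@?f t) (@?g t)) =>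
      first [refine (@PT_eqn _ f g _ _) | refine (@PT_eqb _ f g _ _)]; pt
  | |- PT (fun t => negb (@?f t)) => refine (@PT_neg _ f _); pt
  | |- PT (fun t => andb (@?f t) (@?g t)) => refine (@PT_and _ f g _ _); pt
  | |- PT (fun t => orb (@?f t) (@?g t)) => refine (@PT_or _ f g _ _); pt
  | |- PT (fun t => addb (@?f t) (@?g t)) => refine (@PT_addb _ f g _ _); pt
  | |- PT (fun t => implb (@?f t) (@?g t)) => refine (@PT_imp _ f g _ _); pt
  | |- PT (fun t => if _ then _ else _) => apply: PT_if; pt
  | |- PT (fun t => has (@?p t) (iota 0 (@?n t))) => refine (@PT_has _ p n _ _); cbv beta; pt
  | |- PT (fun t => all (@?p t) (iota 0 (@?n t))) => refine (@PT_all _ p n _ _); cbv beta; pt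
  | |- PT (fun t => count (@?p t) (iota 0 (@?n t))) => refine (@PT_count _ p n _ _); cbv beta; pt
  | |- PT (fun t => mkseq (@?p t) (@?n t)) => refine (@PT_mkseq _ p n _ _); cbv beta; pt
  | |- PT (fun t => nat_of_bool (@?f t)) => refine (@PT_nat_of_bool _ f _); pt
  | |- PT (fun t => nth false (@?x t) (@?i t)) => refine (@PT_nthb _ x i _ _); pt
  | |- PT (fun t => size (@?x t)) => refine (@PT_size _ x _); pt
  | |- PT (fun t => expn (@?f t) ?c) => refine (@PT_exp _ f c _); pt
  | |- PT (fun t => ?F (@?x t, @?a t, @?b t, @?c t)) =>
      refine (@PT_app4 _ _ _ _ _ F x a b c _ _ _ _ _); [assumption | pt | pt | pt | pt]
  | |- PT (fun t => ?F (@?x t, @?a t, @?b t)) =>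
      refine (@PT_app3 _ _ _ _ F x a b _ _ _ _); [assumption | pt | pt | pt]
  | |- PT (fun t => ?F (@?x t, @?a t)) =>
      refine (@PT_app2 _ _ _ F x a _ _ _); [assumption | pt | pt]
  | |- PT (fun t => ?F (@?x t)) => refine (@PT_app1 _ _ F x _ _); [assumption | pt]
  | |- _ => ptvar
  end.

(** * Verifying k-arc-strength *)

Definition parity (T : eqType) (P : pred T) (l : seq T) := odd (count P l).

(** Two reversals cancel, so only the parity of the number of sets containing both ends counts: the
    inner product of the two membership vectors over the field with two elements. *)
Lemma invert_seqE n (A : rel 'I_n) Xs u v : invert_seq A Xs u v =
  if parity (fun X : {set 'I_n} => (u \in X) && (v \in X)) Xs then A v u else A u v.
Proof.
rewrite /parity /invert_seq; elim: Xs A => [|X Xs IH] A //=.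
rewrite IH oddD /invert [(v \in X) && _]andbC.
by case: (_ && _); case: (odd _).
Qed.

Lemma eq_arc_strong k n (A B : rel 'I_n) : A =2 B -> arc_strong k A -> arc_strong k B.
Proof.
move=> AB sA V1 V0 VT; apply: leq_trans (sA V1 V0 VT) _.
by apply: subset_leq_card; apply/subsetP=> p; rewrite !inE AB.
Qed.

Definition digit b f g := (f %/ b ^ g) %% b.

(** This lets a quantifier over tuples of a fixed length be a bounded quantifier over numbers, with
    polynomially many values. *)
Lemma digits_exist b (ds : seq nat) : all (gtn b) ds ->
  exists2 f, f < b ^ size ds & forall g, g < size ds -> digit b f g = nth 0 ds g.
Proof.
elim: ds => [|d ds IH] /=; first by exists 0.
case/andP=> db /IH[f lf Hf]; have b0 : 0 < b by apply: leq_ltn_trans db.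
exists (f * b + d); first by rewrite expnSr; nia.
case=> [|g] lg; rewrite /digit.
  by rewrite expn0 divn1 modnMDl modn_small.
by rewrite expnS divnMA divnMDl // (divn_small db) addn0 /= -Hf.
Qed.

Section DeletedArcs.
Variables (n : nat) (B : nat -> nat -> bool).
Let b := n * n.

(* The number [f], written in base [n * n], lists [m] arcs to be deleted. *)
Definition deleted m f u v := has (fun g => digit b f g == u * n + v) (iota 0 m).

Fixpoint reached m f u (j : nat) : seq bool :=
  if j is j'.+1 then mkseq (fun v => (v == u) || has (fun w =>
    [&& nth false (reached m f u j') w, B w v & ~~ deleted m f w v]) (iota 0 n)) n
  else mkseq (fun _ => false) n.

Definition strong_without m := all (fun f => all (fun u => all (fun v =>
   nth false (reached m f u n) v) (iota 0 n)) (iota 0 n)) (iota 0 (b ^ m)).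

Let expand m f (u : 'I_n) (X : {set 'I_n}) := [set v : 'I_n | (v == u) ||
  [exists w : 'I_n, [&& w \in X, B w v & ~~ deleted m f w v]]].

Let reachedE m f (u : 'I_n) j (v : 'I_n) :
  nth false (reached m f u j) v = (v \in iter j (expand m f u) set0).
Proof.
elim: j v => [|j IH] v /=; first by rewrite nth_mkseq ?inE.
rewrite nth_mkseq // inE; congr (_ || _); apply/hasP/existsP.
  case=> w; rewrite mem_iota /= add0n => lw H.
  by exists (Ordinal lw); rewrite -IH.
by case=> w H; exists (val w); rewrite ?mem_iota /= ?add0n // IH.
Qed.

Lemma code_inj (p q : 'I_n * 'I_n) : p.1 * n + p.2 = q.1 * n + q.2 -> p = q.
Proof.
case: p q => [p1 p2] [q1 q2] /= E; have n0 : 0 < n by apply: leq_trans (ltn_ord p1).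
have := congr1 (divn^~ n) E; have := congr1 (modn^~ n) E.
rewrite /= !modnMDl !divnMDl // !modn_small // !divn_small // !addn0 => e2 e1.
by rewrite (val_inj e1) (val_inj e2).
Qed.

(* A cut with at most [m] leaving arcs loses all of them for a suitable choice of [m] arcs. *)
Lemma strong_withoutP m : reflect (arc_strong m.+1 (fun u v : 'I_n => B u v))
  (strong_without m).
Proof.
apply: (iffP idP) => [H V1|H].
  case/set0Pn=> u uV; rewrite -subTset => /subsetPn[v _ vV].
  rewrite ltnNge; apply/negP=> le.
  pose out := [set p : 'I_n * 'I_n | [&& p.1 \in V1, p.2 \notin V1 & B p.1 p.2]].
  pose ds := [seq val p.1 * n + val p.2 | p <- enum out].
  have szd : size ds <= m by rewrite size_map -cardE.
  have n0 : 0 < n by apply: leq_trans (ltn_ord u).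
  have lt (p1 p2 : 'I_n) : p1 * n + p2 < b.
    by rewrite /b; have := ltn_ord p1; have := ltn_ord p2; nia.
  (* A cut with fewer than [m] arcs is padded with the code 0; deleting more arcs makes nothing
     reachable. *)
  have al : all (gtn b) (ds ++ nseq (m - size ds) 0).
    rewrite all_cat all_nseq /= {2}/b muln_gt0 n0 orbT andbT.
    by apply/allP=> d /mapP[p _ ->]; apply: lt.
  have [f] := digits_exist al; rewrite size_cat size_nseq subnKC // => lf Hf.
  have := allP H f; rewrite mem_iota /= add0n => /(_ lf) /allP /(_ (val u)).
  rewrite mem_iota /= add0n => /(_ (ltn_ord u)) /allP /(_ (val v)).
  rewrite mem_iota /= add0n => /(_ (ltn_ord v)).
  rewrite reachedE; apply/negP; apply: contraNN vV.
  suff sub j : iter j (expand m f u) set0 \subset V1 by apply: (subsetP (sub n)).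
  elim: j => [|j IH] /=; first exact: sub0set.
  apply/subsetP=> x; rewrite inE => /orP[/eqP-> //|/existsP[w /and3P[wX Bwx]]].
  apply: contraR => xV; apply/hasP.
  have wx : (w, x) \in out by rewrite inE /= xV Bwx (subsetP IH).
  have cd : val w * n + val x \in ds by apply/mapP; exists (w, x); rewrite ?mem_enum.
  exists (index (val w * n + val x) ds).
    by rewrite mem_iota /= add0n (leq_trans _ szd) // index_mem.
  by rewrite Hf ?(leq_trans _ szd) ?index_mem // nth_cat index_mem cd nth_index.
apply/allP=> f _; apply/allP=> u; rewrite mem_iota /= add0n => lu.
apply/allP=> v; rewrite mem_iota /= add0n => lv.
pose u' := Ordinal lu; pose v' := Ordinal lv.
rewrite -[u]/(val u') -[v]/(val v') reachedE.
have mono : {homo expand m f u' : X Y / X \subset Y}.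
  move=> X Y XY; apply/subsetP=> x; rewrite !inE => /orP[->//|/existsP[w /and3P[wX Bw dw]]].
  by apply/orP; right; apply/existsP; exists w; rewrite (subsetP XY) // Bw.
pose R := fixset (expand m f u').
(* Iterating a monotone operator from the empty set reaches its least fixpoint within [n] rounds,
   since each earlier round adds one of the [n] vertices. *)
have ER : iter n (expand m f u') set0 = R by rewrite /R /fixset card_ord.
have RE := fixsetK mono; rewrite ER.
case: (eqVneq R setT) => [->|RT]; first by rewrite inE.
have uR : u' \in R by rewrite /R -RE inE eqxx.
have R0 : R != set0 by apply/set0Pn; exists u'.
have := H R R0 RT; rewrite leqNgt ltnS => /negP[].
rewrite /out_arcs; set out := [set p | _].
(* [R] is closed under the surviving arcs, so every arc leaving it is one of the [m] arcs listed by
   [f]. *)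
have sub : {subset [seq val p.1 * n + val p.2 | p <- enum out] <=
    [seq digit b f g | g <- iota 0 m]}.
  move=> d /mapP[[w x]]; rewrite mem_enum inE /= => /and3P[wR xR Bwx] ->.
  have : deleted m f w x.
    apply: contraR xR => dw; rewrite /R -RE inE; apply/orP; right.
    by apply/existsP; exists w; rewrite wR Bwx.
  by case/hasP=> g gm /eqP<-; apply/mapP; exists g.
have := uniq_leq_size _ sub; rewrite !size_map size_iota -cardE; apply.
by rewrite map_inj_uniq ?enum_uniq // => p q; apply: code_inj.
Qed.
End DeletedArcs.

(** * The verifier *)

Definition root (x : seq bool) := count (fun i => i.+1 * i.+1 <= size x) (iota 0 (size x)).

Lemma rootE x n : size x = n * n -> root x = n.
Proof.
move=> sx; rewrite /root sx (@eq_count _ _ (fun i => i < n)) ?count_iota_lt => [|i].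
  by apply/minn_idPl; case: n {sx} => // n; nia.
by apply/idP/idP; nia.
Qed.

Definition entry (x : seq bool) n i j := nth false x (i * n + j).

(** The certificate [y] is a [t] by [n] matrix of bits whose row [r] is the characteristic word of
    the [r]-th set. *)
Definition flips (y : seq bool) n t i j :=
  parity (fun r => entry y n r i && entry y n r j) (iota 0 t).

Definition inverted (t : nat) (p : seq bool * seq bool * nat * nat) :=
  let: (x, y, i, j) := p in
  if flips y (root x) t i j then entry x (root x) j i else entry x (root x) i j.

Definition verify m t (p : seq bool * seq bool) :=
  let: (x, y) := p in let n := root x in
  [&& n * n == size x,
    all (fun i => all (fun j => ~~ entry x n i i && (entry x n i j ==> ~~ entry x n j i))
      (iota 0 n)) (iota 0 n) &
    strong_without n (fun i j => inverted t (x, y, i, j)) m].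

Lemma PT_root : PT root.
Proof. rewrite /root; pt. Qed.

Lemma PT_parity_const (E : env) (ps : nat -> E -> bool) (l : seq nat) :
  (forall i, PT (ps i)) -> PT (fun t => parity (ps^~ t) l).
Proof.
move=> H; elim: l => [|i l IH]; first exact: (PT_const _ false).
apply: PT_ext (PT_addb (H i) IH) => t.
by rewrite /parity /= oddD; case: (ps i t).
Qed.

Lemma PT_entry (E : env) (x : E -> seq bool) (n i j : E -> nat) :
  PT x -> PT n -> PT i -> PT j -> PT (fun t => entry (x t) (n t) (i t) (j t)).
Proof. by move=> px pn pi pj; apply: PT_nthb px _; apply: PT_add pj; apply: PT_mul. Qed.

Lemma PT_inverted t : PT (inverted t).
Proof.
pose E := prod_env (prod_env (prod_env bits_env bits_val) nat_val) nat_val.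
have pn : PT (fun p : E => root p.1.1.1) by apply: (PT_app1 PT_root); ptvar.
apply: (@PT_ext E _ (fun p : E => if flips p.1.1.2 (root p.1.1.1) t p.1.2 p.2
  then entry p.1.1.1 (root p.1.1.1) p.2 p.1.2 else entry p.1.1.1 (root p.1.1.1) p.1.2 p.2)).
  by case=> [[[x y] i] j].
apply: PT_if; [|apply: PT_entry; ptvar | apply: PT_entry; ptvar].
apply: (@PT_parity_const E (fun r p => entry p.1.1.2 (root p.1.1.1) r p.1.2 &&
  entry p.1.1.2 (root p.1.1.1) r p.2)) => r.
by apply: PT_and; apply: PT_entry; first [exact: (PT_const _ r) | ptvar].
Qed.

Lemma PT_deleted (E : env) m (n f u v : E -> nat) : PT n -> PT f -> PT u -> PT v ->
  PT (fun t => deleted (n t) m (f t) (u t) (v t)).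
Proof.
move=> pn pf pu pv.
apply: (@PT_has_const _ _ (fun g t => digit (n t * n t) (f t) g == u t * n t + v t)) => g.
apply: PT_eqn; last by apply: PT_add pv; apply: PT_mul.
have pb : PT (fun t => n t * n t) by apply: PT_mul.
by apply: (PT_mod _ pb); apply: (PT_div pf); apply: PT_exp pb.
Qed.

Lemma reached_iter n B m f u j : reached n B m f u j = foldr (fun _ acc =>
  mkseq (fun v => (v == u) || has (fun w =>
    [&& nth false acc w, B w v & ~~ deleted n m f w v]) (iota 0 n)) n)
  (mkseq (fun _ => false) n) (iota 0 j).
Proof. by rewrite -{1}(size_iota 0 j); elim: (iota 0 j) => //= i l ->. Qed.

Lemma PT_reached m t : PT (fun p : seq bool * seq bool * nat * nat =>
  reached (root p.1.1.1) (fun i j => inverted t (p.1.1, i, j)) m p.1.2 p.2 (root p.1.1.1)).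
Proof.
pose E := prod_env (prod_env (prod_env bits_env bits_val) nat_val) nat_val.
apply: (@PT_ext E _ (fun p : E => foldr (fun _ acc =>
  mkseq (fun v => (v == p.2) || has (fun w => [&& nth false acc w,
      inverted t (p.1.1.1, p.1.1.2, w, v) & ~~ deleted (root p.1.1.1) m p.1.2 w v])
      (iota 0 (root p.1.1.1))) (root p.1.1.1))
  (mkseq (fun _ => false) (root p.1.1.1)) (iota 0 (root p.1.1.1)))).
  by case=> [[[x y] f] u]; rewrite reached_iter.
have pr := PT_root; have pn : PT (fun p : E => root p.1.1.1) by pt.
have [G pG HG] := PT_polysize pn.
apply: (@PT_loop_bounded E bits_val _ _ (fun p _ acc =>
  mkseq (fun v => (v == p.2) || has (fun w => [&& nth false acc w,
      inverted t (p.1.1.1, p.1.1.2, w, v) & ~~ deleted (root p.1.1.1) m p.1.2 w v])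
      (iota 0 (root p.1.1.1))) (root p.1.1.1))).
- exact: pn.
- by pt.
- apply: PT_mkseq; last by pt.
  apply: PT_or; first by pt.
  apply: PT_has; last by pt.
  apply: PT_and; first by pt.
  apply: PT_and.
    by have pi := PT_inverted t; pt.
  by apply: PT_neg; apply: PT_deleted; pt.
- exists G => // p N i acc bt _; rewrite /= size_mkseq.
  by have := HG p N bt; rewrite /= size_nseq.
Qed.

Lemma PT_verify m t : PT (verify m t).
Proof.
pose E := prod_env bits_env bits_val; have pr := PT_root.
apply: (@PT_ext E _ (fun p : E => [&& root p.1 * root p.1 == size p.1,
  all (fun i => all (fun j => ~~ entry p.1 (root p.1) i i &&
      (entry p.1 (root p.1) i j ==> ~~ entry p.1 (root p.1) j i))
      (iota 0 (root p.1))) (iota 0 (root p.1)) &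
  all (fun f => all (fun u => all (fun v =>
    nth false (reached (root p.1) (fun i j => inverted t (p, i, j)) m f u (root p.1)) v)
    (iota 0 (root p.1))) (iota 0 (root p.1))) (iota 0 ((root p.1 * root p.1) ^ m))])).
  by case.
apply: PT_and; first by pt.
apply: PT_and; first by rewrite /entry; pt.
apply: PT_all; last by pt.
apply: PT_all; last by pt.
apply: PT_all; last by pt.
apply: PT_nthb; last by pt.
have := PT_reached m t.
have H := @PT_app4 _ _ _ _ _ (fun p : seq bool * seq bool * nat * nat =>
  reached (root p.1.1.1) (fun i j => inverted t (p.1.1, i, j)) m p.1.2 p.2 (root p.1.1.1)).
move=> /H {}H.
pose E3 := prod_env (prod_env (prod_env E nat_val) nat_val) nat_val.
apply: (@PT_ext E3 _ _ _ _ (H E3 (fun q => q.1.1.1.1) (fun q => q.1.1.1.2) (fun q => q.1.1.2)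
  (fun q => q.1.2) _ _ _ _)); try by ptvar.
by case=> [[[[x y] f] u] v].
Qed.

(** * Decoding pairs *)

Definition first_length (z : seq bool) := count (fun i =>
  all (fun j => nth false z (2 * j) == nth false z (2 * j).+1) (iota 0 i.+1)) (iota 0 (size z)).
Definition first_word z := mkseq (fun i => nth false z (2 * i)) (first_length z).
Definition second_word z := mkseq (fun i => nth false z (2 * first_length z + 2 + i))
  (size z - (2 * first_length z + 2)).

Lemma size_double (x : seq bool) : size (flatten [seq [:: b; b] | b <- x]) = 2 * size x.
Proof. by elim: x => //= b x ->; lia. Qed.

Lemma nth_double x y i : i < size x ->
  nth false (pair_enc x y) (2 * i) = nth false x i /\
  nth false (pair_enc x y) (2 * i).+1 = nth false x i.
Proof.
elim: x i => //= b x IH [|i] // lt; have [] := IH i lt.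
by have -> : 2 * i.+1 = (2 * i).+2 by lia.
Qed.

Lemma nth_pair_tail x y i : nth false (pair_enc x y) (2 * size x + i) =
  nth false ([:: false; true] ++ y) i.
Proof. by rewrite /pair_enc nth_cat size_double ltnNge leq_addr /= addKn. Qed.

Lemma size_pair x y : size (pair_enc x y) = 2 * size x + 2 + size y.
Proof. by rewrite /pair_enc !size_cat size_double /=; lia. Qed.

(** All bits of the first word are doubled, so the separator is the first pair of unequal bits, and
    exactly the positions before it are counted. *)
Lemma first_lengthE x y : first_length (pair_enc x y) = size x.
Proof.
rewrite /first_length (@eq_count _ _ (fun i => i < size x)).
  by rewrite count_iota_lt size_pair; apply/minn_idPl; lia.
move=> i; apply/allP/idP => [H|lt j].
  rewrite ltnNge; apply/negP=> le; have := H (size x).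
  rewrite mem_iota /= add0n ltnS => /(_ le).
  by rewrite -[2 * _]addn0 -addnS !nth_pair_tail.
rewrite mem_iota /= add0n ltnS => ji.
by have [-> ->] := nth_double y (leq_ltn_trans ji lt).
Qed.

Lemma first_wordE x y : first_word (pair_enc x y) = x.
Proof.
rewrite /first_word first_lengthE; apply: (@eq_from_nth _ false); rewrite size_mkseq // => i lt.
by rewrite nth_mkseq //; case: (nth_double y lt).
Qed.

Lemma second_wordE x y : second_word (pair_enc x y) = y.
Proof.
rewrite /second_word first_lengthE size_pair addKn.
apply: (@eq_from_nth _ false); rewrite size_mkseq // => i lt.
by rewrite nth_mkseq // -addnA nth_pair_tail.
Qed.

Lemma PT_first_length : PT first_length.
Proof. rewrite /first_length; pt. Qed.

Lemma PT_decode (v : seq bool * seq bool -> bool) :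
  PT v -> PT (fun z => v (first_word z, second_word z)).
Proof.
move=> pv; have pl := PT_first_length.
by apply: (PT_app2 pv); rewrite /first_word /second_word; pt.
Qed.

Lemma in_NP_verifier (L : language) (v : seq bool * seq bool -> bool) (T : nat -> nat) :
  PT v -> pb T -> (forall x, L x -> exists2 y, size y <= T (size x) & v (x, y)) ->
  (forall x y, v (x, y) -> L x) -> in_NP L.
Proof.
move=> pv pT HL Hv; have [c Hc] := pb_std pT.
exists (fun z => v (first_word z, second_word z)), c; split.
  exact: (PT_in_P (PT_decode pv)).
move=> x; split=> [/HL[y sy vy]|[y []]].
  by exists y; rewrite first_wordE second_wordE (leq_trans sy).
by rewrite first_wordE second_wordE => _; apply: Hv.
Qed.

(** Allows a family of at most [t] sets to be taken with exactly [t] members. *)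
Lemma invert_pad n (A : rel 'I_n) Xs j : invert_seq A (Xs ++ nseq j set0) =2 invert_seq A Xs.
Proof.
by move=> u v; rewrite !invert_seqE /parity count_cat count_nseq /= !inE addn0.
Qed.

Lemma count_iota_nth (T : Type) (x0 : T) (P : pred T) (l : seq T) :
  count (fun r => P (nth x0 l r)) (iota 0 (size l)) = count P l.
Proof. by rewrite -[l in RHS](mkseq_nth x0) count_map. Qed.

Lemma invertedE t n (A : rel 'I_n) x y Xs : encodes x A -> size Xs = t ->
  (forall r (i : 'I_n), r < t -> entry y n r i = (i \in nth set0 Xs r)) ->
  forall i j : 'I_n, inverted t (x, y, val i, val j) = invert_seq A Xs i j.
Proof.
move=> [sx Hx] sX Hy i j; rewrite invert_seqE /inverted (rootE sx) /entry !Hx /flips.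
suff -> : parity (fun r => entry y n r i && entry y n r j) (iota 0 t) =
  parity (fun X : {set 'I_n} => (i \in X) && (j \in X)) Xs by [].
rewrite /parity -(count_iota_nth set0) sX; congr odd; apply: eq_in_count => r.
by rewrite mem_iota /= add0n => lt; rewrite !Hy.
Qed.

Lemma SINV_in_NP m t : in_NP (SINV_lang m.+1 t).
Proof.
apply: (@in_NP_verifier _ (verify m t) (fun N => t * N)); [exact: PT_verify | pbt | |].
  move=> x [n [A [enc [orA [Xs [sX stA]]]]]]; have [sx Hx] := enc.
  pose Ys := Xs ++ nseq (t - size Xs) set0.
  have sY : size Ys = t by rewrite size_cat size_nseq subnKC.
  pose y := mkseq (fun q => [exists i : 'I_n, (val i == q %% n) && (i \in nth set0 Ys (q %/ n))])
    (t * n).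
  exists y; first by rewrite size_mkseq sx leq_mul2l; apply/orP; right; nia.
  have Hy r (i : 'I_n) : r < t -> entry y n r i = (i \in nth set0 Ys r).
    move=> rt; have ni := ltn_ord i; have n0 : 0 < n by apply: leq_trans ni.
    rewrite /entry nth_mkseq; last by nia.
    rewrite divnMDl // divn_small // addn0 modnMDl modn_small //.
    apply/existsP/idP => [[j /andP[/eqP/val_inj-> //]]|iY].
    by exists i; rewrite eqxx.
  rewrite /verify (rootE sx) sx eqxx /=; apply/andP; split.
    apply/allP=> i; rewrite mem_iota /= add0n => li.
    apply/allP=> j; rewrite mem_iota /= add0n => lj.
    rewrite /entry -[i]/(val (Ordinal li)) -[j]/(val (Ordinal lj)) !Hx.
    by case: orA => -> H; apply/implyP; apply: H.
  apply/strong_withoutP; apply: eq_arc_strong stA => u v.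
  by rewrite -(invert_pad A Xs (t - size Xs)); apply/esym/(invertedE enc sY Hy).
move=> x y; rewrite /verify; set n := root x => /and3P[/eqP sx orA /strong_withoutP stA].
pose A : rel 'I_n := fun i j => entry x n i j.
have enc : encodes x A by split.
exists n, A; split=> //; split.
  have or (i j : 'I_n) : ~~ A i i && (A i j ==> ~~ A j i).
    have := allP orA (val i); rewrite mem_iota /= add0n => /(_ (ltn_ord i)) /allP /(_ (val j)).
    by rewrite mem_iota /= add0n => /(_ (ltn_ord j)).
  split=> [u|u v]; first by case/andP: (or u u).
  by case/andP: (or u v) => _ /implyP.
pose Xs := mkseq (fun r => [set i : 'I_n | entry y n r i]) t.
exists Xs; rewrite size_mkseq; split=> //; apply: eq_arc_strong stA => u v.
apply: (invertedE enc); first by rewrite size_mkseq.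
by move=> r i lt; rewrite nth_mkseq // inE.
Qed.

(** * From hypergraph colouring to inversions *)

Section Connectivity.
Variables (k n : nat) (B : nat -> nat -> bool).

Definition wide_cut (P : pred nat) := exists phi : nat -> nat * nat,
  (forall i j, i < k -> j < k -> phi i = phi j -> i = j) /\
  (forall i, i < k -> [/\ (phi i).1 < n, (phi i).2 < n, P (phi i).1, ~~ P (phi i).2 &
    B (phi i).1 (phi i).2]).

(** By Menger's theorem this amounts to [k] arc-disjoint paths from [u] to [v]; stated with cuts it
    is transitive at once. *)
Definition conn u v := forall P : pred nat, P u -> ~~ P v -> wide_cut P.

Lemma conn_trans u v w : conn u w -> conn w v -> conn u v.
Proof. by move=> uw wv P Pu Pv; case Pw: (P w); [apply: wv | apply: uw; rewrite ?Pw]. Qed.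

(** Either one of the [k] out-neighbours lies on the side of [u], and its own connection to [v]
    crosses the cut, or the [k] arcs from [u] to them all do. *)
Lemma conn_out (f : nat -> nat) u v : u < n ->
  (forall i j, i < k -> j < k -> f i = f j -> i = j) ->
  (forall i, i < k -> [/\ f i < n, B u (f i) & conn (f i) v]) -> conn u v.
Proof.
move=> lu inj H P Pu Pv; case: (boolP (has (fun i => P (f i)) (iota 0 k))).
  by case/hasP=> i; rewrite mem_iota => ik Pi; case: (H i ik) => _ _ /(_ P Pi Pv).
move/hasPn=> no; exists (fun i => (u, f i)); split=> [i j ik jk [] | i ik /=].
  exact: inj.
by have [? ? _] := H i ik; split=> //; apply: no; rewrite mem_iota.
Qed.

Lemma conn_in (f : nat -> nat) u v : v < n ->
  (forall i j, i < k -> j < k -> f i = f j -> i = j) ->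
  (forall i, i < k -> [/\ f i < n, B (f i) v & conn u (f i)]) -> conn u v.
Proof.
move=> lv inj H P Pu Pv; case: (boolP (all (fun i => P (f i)) (iota 0 k))).
  move/allP=> yes; exists (fun i => (f i, v)); split=> [i j ik jk [] | i ik /=].
    exact: inj.
  by have [? ? _] := H i ik; split=> //; apply: yes; rewrite mem_iota.
by case/allPn=> i; rewrite mem_iota => ik Pi; case: (H i ik) => _ _ /(_ P Pu Pi).
Qed.

Lemma conn_arc_strong : (forall u v, u < n -> v < n -> conn u v) ->
  arc_strong k (fun i j : 'I_n => B i j).
Proof.
move=> H V1 /set0Pn[u uV]; rewrite -subTset => /subsetPn[v _ vV].
pose P w := [exists i : 'I_n, (val i == w) && (i \in V1)].
have PE (i : 'I_n) : P i = (i \in V1).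
  apply/existsP/idP => [[j /andP[/eqP/val_inj-> //]]|iV].
  by exists i; rewrite eqxx.
have [phi [inj Hphi]] : wide_cut P.
  by apply: (H _ _ (ltn_ord u) (ltn_ord v)); rewrite PE.
pose psi (i : 'I_k) : 'I_n * 'I_n := let: And5 l1 l2 _ _ _ := Hphi i (ltn_ord i) in
  (Ordinal l1, Ordinal l2).
have psiE i : (val (psi i).1, val (psi i).2) = phi i.
  by rewrite /psi; case: (Hphi i _) => ? ? _ _ _ /=; case: (phi i).
have psi_inj : injective psi.
  by move=> i j E; apply/val_inj/(inj _ _ (ltn_ord i) (ltn_ord j)); rewrite -(psiE i) -(psiE j) E.
rewrite -[k]card_ord -(card_codom psi_inj); apply: subset_leq_card; apply/subsetP=> p.
case/codomP=> i ->; rewrite inE -!PE; have := psiE i.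
by have [_ _] := Hphi i (ltn_ord i) => + + + E; rewrite -!E /= => -> -> ->.
Qed.
End Connectivity.

(** The colours are the vectors of [t] bits: a hyperedge with two points that differ in some bit is
    one that is not monochromatic. *)
Definition colorable (t np ne : nat) (mem : nat -> nat -> bool) :=
  exists c : nat -> nat -> bool, forall e, e < ne ->
    exists u v r, [/\ u < np, v < np & r < t] /\ [/\ mem e u, mem e v, c u r & ~~ c v r].

Section Reduction.
Variables (k t : nat) (np ne : nat) (mem : nat -> nat -> bool).

(* Vertices: a base [0, nb); helpers [nb, nh), arranged in [k - 1] rows and [width] columns;
   the points of the hypergraph [nh, npt); and for every hyperedge [e] and every pair of columns
   a sink, whose in-neighbours are the points of [e] and the first column, and
   whose out-neighbours are the second column. *)
Definition width := 2 ^ (k.-1 * t) + 1.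
Definition nb := 3 * k.
Definition nh := nb + k.-1 * width.
Definition npt := nh + np.
Definition nv := npt + ne * width * width.
Definition col1 w := ((w - npt) %/ width) %% width.
Definition col2 w := (w - npt) %% width.
Definition edge w := (w - npt) %/ width %/ width.
(** Pairs of equal columns keep their numbers, which makes the coding a plain product, but such
    vertices are only attached to the base. *)
Definition sink w := (npt <= w) && (col1 w != col2 w).

(** The base is a directed triangle with every vertex replaced by [k] copies, the class being the
    residue modulo 3. A vertex outside the base that is not a sink gets [k] arcs from class 0 and
    sends [k] arcs to class 1. A sink has no arc with the base, so that its degrees depend on
    helpers and points alone. *)
Definition graph_arc u v :=
  if u < nb then
    if v < nb then v %% 3 == u.+1 %% 3 else ~~ sink v && (u %% 3 == 0)
  else if v < nb then ~~ sink u && (v %% 3 == 1)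
  else [&& sink v, u < npt & if u < nh then (u - nb) %% width == col1 v
                            else mem (edge v) (u - nh)]
    || [&& sink u, v < nh & (v - nb) %% width == col2 u].

Lemma arc_oriented : oriented (fun u v : 'I_nv => graph_arc u v).
Proof.
split=> [u|u v]; rewrite /graph_arc.
  case: ltnP => ub; first by lia.
  by rewrite /sink /npt; case: (leqP _ u) => /=; rewrite ?andbF //; lia.
case: (ltnP u nb) => ub; case: (ltnP v nb) => vb; try by lia.
case/orP=> /and3P[].
  move=> sv uv H; apply/norP; split.
    by rewrite /sink leqNgt uv.
  apply/and3P=> -[_ uh]; move: H sv; rewrite uh /sink => /eqP-> /andP[_ ne2].
  by rewrite (negPf ne2).
move=> su vh /eqP H; apply/norP; split; last first.
  by rewrite /sink leqNgt /npt (leq_trans vh) // leq_addr.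
by apply/and3P=> -[_ _]; rewrite vh H; case/andP: su => _; rewrite eq_sym => /negPf->.
Qed.

Hypothesis k0 : 0 < k.

Lemma width_gt0 : 0 < width. Proof. by rewrite /width addn1. Qed.

Definition helper g m := nb + (g * width + m).
Definition point u := nh + u.
Definition sinkv e m m' := npt + ((e * width + m) * width + m').

Lemma helper_lt g m : g < k.-1 -> m < width -> helper g m < nh.
Proof. by move=> gk mw; rewrite /helper /nh ltn_add2l; nia. Qed.

Lemma helper_col g m : m < width -> (helper g m - nb) %% width = m.
Proof. by move=> mw; rewrite /helper addKn modnMDl modn_small. Qed.

Lemma helper_row g m : m < width -> (helper g m - nb) %/ width = g.
Proof. by move=> mw; rewrite /helper addKn divnMDl ?width_gt0 // divn_small // addn0. Qed.

Lemma sinkv_lt e m m' : e < ne -> m < width -> m' < width -> sinkv e m m' < nv.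
Proof.
move=> le lm lm'; rewrite /sinkv /nv ltn_add2l.
have : e * width + m < ne * width by nia.
by nia.
Qed.

Lemma sinkv_dec e m m' : m < width -> m' < width ->
  [/\ edge (sinkv e m m') = e, col1 (sinkv e m m') = m & col2 (sinkv e m m') = m'].
Proof.
move=> lm lm'; rewrite /edge /col1 /col2 /sinkv addKn modnMDl (modn_small lm').
rewrite !divnMDl ?width_gt0 // (divn_small lm') addn0 modnMDl (modn_small lm).
by rewrite divnMDl ?width_gt0 // divn_small // addn0.
Qed.

Lemma base_lt i j : i < k -> j < 3 -> 3 * i + j < nb.
Proof. by move=> ik j3; rewrite /nb; lia. Qed.

Lemma nb_le_nv : nb <= nv.
Proof. by do 2!apply: leq_trans (leq_addr _ _); exact: leq_addr. Qed.

Section Base.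
Variable B : nat -> nat -> bool.
Hypothesis B_base : forall u v, u < nb -> v < nb -> B u v = (v %% 3 == u.+1 %% 3).

(** The [k] paths from [u] to [v] through the [i]-th vertices of the two other classes are
    arc-disjoint; the arc chosen for [i] is the first one of its path to leave [P]. *)
Lemma conn_class u v : u < nb -> v < nb -> u %% 3 = v %% 3 -> conn k nv B u v.
Proof.
move=> ub vb uv P Pu Pv.
pose f1 i := 3 * i + u.+1 %% 3; pose f2 i := 3 * i + u.+2 %% 3.
have l1 i : i < k -> f1 i < nb by move=> ik; apply: base_lt => //; rewrite ltn_mod.
have l2 i : i < k -> f2 i < nb by move=> ik; apply: base_lt => //; rewrite ltn_mod.
have le := nb_le_nv.
exists (fun i => if ~~ P (f1 i) then (u, f1 i) else if ~~ P (f2 i) then (f1 i, f2 i)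
  else (f2 i, v)); split=> [i j ik jk|i ik].
  by do !case: ifP => _; rewrite /f1 /f2 => -[]; lia.
have := l1 i ik; have := l2 i ik => h2 h1.
case: ifP => [P1|/negbFE P1]; [|case: ifP => [P2|/negbFE P2]]; split=> //=; try lia;
  rewrite B_base // /f1 /f2; lia.
Qed.

Lemma conn_next u v : u < nb -> v < nb -> v %% 3 = u.+1 %% 3 -> conn k nv B u v.
Proof.
move=> ub vb uv; have le := nb_le_nv.
apply: (@conn_out k nv B (fun i => 3 * i + u.+1 %% 3)) => [|i j _ _|i ik].
- exact: leq_trans le.
- by lia.
- have l1 : 3 * i + u.+1 %% 3 < nb by apply: base_lt => //; rewrite ltn_mod.
  split; first exact: leq_trans le.
    by rewrite B_base //; lia.
  by apply: conn_class => //; lia.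
Qed.

Lemma conn_base u v : u < nb -> v < nb -> conn k nv B u v.
Proof.
move=> ub vb; case: (eqVneq (v %% 3) (u %% 3)) => [E|n1]; first exact: conn_class.
case: (eqVneq (v %% 3) (u.+1 %% 3)) => [E|n2]; first exact: conn_next.
pose w := 3 * 0 + u.+1 %% 3.
have wb : w < nb by apply: base_lt => //; rewrite ltn_mod.
by apply: (@conn_trans _ _ _ _ _ w); apply: conn_next => //; rewrite /w; lia.
Qed.

Hypothesis B_attached : forall u w, u < nb -> nb <= w < nv -> ~~ sink w ->
  B u w = (u %% 3 == 0) /\ B w u = (u %% 3 == 1).

Lemma conn_attached w : nb <= w < nv -> ~~ sink w ->
  forall u, u < nb -> conn k nv B u w /\ conn k nv B w u.
Proof.
move=> lw sw u ub; have le := nb_le_nv; have /andP[_ lw2] := lw; split.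
  apply: (@conn_in k nv B (fun i => 3 * i)) => // [i j _ _|i ik]; first by lia.
  have l1 : 3 * i < nb by rewrite /nb; lia.
  split; [exact: leq_trans le | | exact: conn_base].
  by have [-> _] := B_attached l1 lw sw; lia.
apply: (@conn_out k nv B (fun i => 3 * i + 1)) => // [i j _ _|i ik]; first by lia.
have l1 : 3 * i + 1 < nb by rewrite /nb; lia.
split; [exact: leq_trans le | | exact: conn_base].
by have [_ ->] := B_attached l1 lw sw; lia.
Qed.

Hypothesis B_sink : forall w, w < nv -> sink w -> exists f g : nat -> nat,
  [/\ forall i j, i < k -> j < k -> f i = f j -> i = j,
      forall i j, i < k -> j < k -> g i = g j -> i = j,
      forall i, i < k -> [/\ nb <= f i < nv, ~~ sink (f i) & B w (f i)] &
      forall i, i < k -> [/\ nb <= g i < nv, ~~ sink (g i) & B (g i) w]].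

Lemma conn_all u v : u < nv -> v < nv -> conn k nv B u v.
Proof.
have z0 : 0 < nb by rewrite /nb; lia.
have via_base w : w < nv -> conn k nv B 0 w /\ conn k nv B w 0.
  move=> lw; case: (ltnP w nb) => wb; first by split; apply: conn_base.
  case sw : (sink w); last by apply: conn_attached; rewrite ?wb ?sw.
  have [f [g [fi gi Hf Hg]]] := B_sink lw sw; split.
    apply: (@conn_in k nv B g) => // i ik; have [lg sg Bg] := Hg i ik; split=> //.
      by case/andP: lg.
    by have [] := conn_attached lg sg z0.
  apply: (@conn_out k nv B f) => // i ik; have [lg sg Bg] := Hf i ik; split=> //.
    by case/andP: lg.
  by have [] := conn_attached lg sg z0.
move=> /via_base[_ H1] /via_base[H2 _]; exact: conn_trans H1 H2.
Qed.
End Base.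

(** The inner product with a unit vector is a coordinate: a sink placed in a single set reverses
    exactly the arcs to its neighbours in that set. *)
Lemma parity_pick j (b : nat -> bool) : j < t -> parity (fun r => (j == r) && b r) (iota 0 t) = b j.
Proof.
move=> lj; rewrite /parity; have -> : t = j + (t - j).-1.+1 by lia.
rewrite iotaD count_cat /= eqxx add0n !oddD.
have Z l : j \notin l -> count (fun r => (j == r) && b r) l = 0.
  by move=> jl; apply/eqP; rewrite -leqn0 leqNgt -has_count; apply/hasPn=> r rl;
    case: eqP => // E; rewrite E rl in jl.
by rewrite !Z ?mem_iota ?ltnn ?andbF //=; case: (b j).
Qed.

Lemma edge_lt w : npt <= w < nv -> edge w < ne.
Proof.
case/andP=> lw; rewrite /nv /edge => lw2; rewrite -divnMA ltn_divLR ?muln_gt0 ?width_gt0 //.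
by rewrite mulnA; lia.
Qed.

Lemma arc_sink w v : sink w -> nb <= v < npt ->
  graph_arc v w = (if v < nh then (v - nb) %% width == col1 w else mem (edge w) (v - nh)) /\
  graph_arc w v = (v < nh) && ((v - nb) %% width == col2 w).
Proof.
move=> sw /andP[bv lv]; have lw : npt <= w by case/andP: sw.
have wb : (w < nb) = false by apply/negbTE; rewrite -leqNgt; lia.
have vb : (v < nb) = false by lia.
have sv : sink v = false by rewrite /sink leqNgt lv.
by rewrite /graph_arc wb vb sw sv lv /= orbF.
Qed.

Lemma nb_le_nh : nb <= nh. Proof. exact: leq_addr. Qed.
Lemma nh_le_npt : nh <= npt. Proof. exact: leq_addr. Qed.
Lemma npt_le_nv : npt <= nv. Proof. exact: leq_addr. Qed.

(** Points join the sets given by their colours, and a sink joins only the set [r] of a bit on which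
    two points [u], [v] of its hyperedge differ. The arc of [u] is then reversed and that of [v]
    kept, and the [k - 1] helpers of each of the two columns complete both degrees to [k]. *)
Lemma sinv_of_coloring : colorable t np ne mem -> sinv_le k t (fun i j : 'I_nv => graph_arc i j).
Proof.
have := (nb_le_nh, nh_le_npt, npt_le_nv) => -[[le1 le2] le3].
case=> c Hc.
pose ok e r := has (fun u => mem e u && c u r) (iota 0 np) &&
  has (fun v => mem e v && ~~ c v r) (iota 0 np).
pose pick e := find (ok e) (iota 0 t).
have pickP e : e < ne -> pick e < t /\ ok e (pick e).
  move=> /Hc[u [v [r [[lu lv lr] [mu mv cu cv]]]]].
  have h : has (ok e) (iota 0 t).
    apply/hasP; exists r; rewrite ?mem_iota //; apply/andP; split; apply/hasP.
      by exists u; rewrite ?mem_iota // mu.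
    by exists v; rewrite ?mem_iota // mv.
  have lt := h; rewrite has_find size_iota in lt; split=> //.
  by have := nth_find 0 h; rewrite nth_iota.
pose inX r w := (nh <= w < npt) && c (w - nh) r || sink w && (pick (edge w) == r).
pose B u v := if parity (fun r => inX r u && inX r v) (iota 0 t)
  then graph_arc v u else graph_arc u v.
have out r w : w < nh -> inX r w = false.
  by move=> lw; rewrite /inX /sink /npt; lia.
have B0 u v : u < nh -> B u v = graph_arc u v /\ B v u = graph_arc v u.
  have Z (b : pred nat) : (forall r, b r = false) -> parity b (iota 0 t) = false.
    by move=> b0; rewrite /parity (eq_count b0) count_pred0.
  by move=> lu; rewrite /B !Z // => r; rewrite (out r u lu) ?andbF.
exists (mkseq (fun r => [set w : 'I_nv | inX r w]) t); rewrite size_mkseq; split=> //.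
apply: (@eq_arc_strong _ _ (fun i j : 'I_nv => B i j)).
  move=> i j; rewrite invert_seqE /B /parity count_map.
  by rewrite (eq_count (a2 := fun r => inX r i && inX r j)) // => r /=; rewrite !inE.
apply: conn_arc_strong; apply: conn_all => [u v ub vb|u w ub lw sw|w lw sw].
- have [-> _] := B0 u v (leq_trans ub le1); by rewrite /graph_arc ub vb.
- have [-> ->] := B0 u w (leq_trans ub le1); have /andP[wb _] := lw.
  by rewrite /graph_arc ub ltnNge wb /= sw.
have npw : npt <= w by case/andP: sw.
have le : edge w < ne by apply: edge_lt; rewrite npw.
have [lp /andP[/hasP[u]]] := pickP _ le.
rewrite mem_iota /= add0n => lu /andP[mu cu] /hasP[v]; rewrite mem_iota /= add0n => lv /andP[mv cv].
have c1 : col1 w < width by rewrite ltn_mod width_gt0.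
have c2 : col2 w < width by rewrite ltn_mod width_gt0.
pose nbr m p i := if i < k.-1 then helper i m else point p.
have nbr_inj m p : m < width -> forall i j, i < k -> j < k -> nbr m p i = nbr m p j -> i = j.
  move=> lm i j ik jk; rewrite /nbr /point; case: ltnP => li; case: ltnP => lj; try by lia.
  - by move=> E; rewrite -(helper_row i lm) E helper_row.
  - by have := helper_lt li lm; lia.
  - by have := helper_lt lj lm; lia.
have nbr_ok m p i : m < width -> p < np ->
    nb <= nbr m p i < npt.
  move=> lm lp'; rewrite /nbr; case: ifP => li.
    by rewrite (leq_trans (helper_lt li lm) le2) andbT leq_addr.
  by rewrite /point /npt; lia.
have Bpt p : p < np -> B w (point p) = (if c p (pick (edge w)) then mem (edge w) p else false) /\
    B (point p) w = (if c p (pick (edge w)) then false else mem (edge w) p).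
  move=> lp'.
  have inP r : inX r (point p) = c p r.
    rewrite /inX /sink /point addKn leq_addr ltn_add2l lp' /=.
    by rewrite leqNgt /npt ltn_add2l lp' orbF.
  have inW r : inX r w = (pick (edge w) == r).
    by rewrite /inX sw /= ltnNge npw /= andbF.
  have lpt : nb <= point p < npt by rewrite /point /npt; lia.
  have [a1 a2] := arc_sink sw lpt.
  have ph : (point p < nh) = false by rewrite /point; lia.
  rewrite ph /point addKn -/(point p) in a1 a2.
  rewrite /B /parity (eq_count (a2 := fun r => (pick (edge w) == r) && c p r)); last first.
    by move=> r; rewrite inP inW.
  rewrite -/(parity _ _) (parity_pick _ lp).
  rewrite (eq_count (a2 := fun r => (pick (edge w) == r) && c p r)); last first.
    by move=> r; rewrite inP inW andbC.
  by rewrite -/(parity _ _) (parity_pick _ lp) a1 a2.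
have not_sink z : z < npt -> ~~ sink z by move=> lz; rewrite /sink leqNgt lz.
exists (nbr (col2 w) u), (nbr (col1 w) v); split; try exact: nbr_inj.
- move=> i ik; have /andP[n1 n2] := nbr_ok (col2 w) u i c2 lu.
  split; [by rewrite n1 (leq_trans n2) | exact: not_sink | rewrite /nbr].
  case: ifP => li; last by have [-> _] := Bpt u lu; rewrite cu.
  have lh := helper_lt li c2; have [_ ->] := B0 _ w lh.
  have lpt : nb <= helper i (col2 w) < npt by rewrite {1}/helper leq_addr (leq_trans lh).
  by have [_ ->] := arc_sink sw lpt; rewrite lh helper_col /=.
- move=> i ik; have /andP[n1 n2] := nbr_ok (col1 w) v i c1 lv.
  split; [by rewrite n1 (leq_trans n2) | exact: not_sink | rewrite /nbr].
  case: ifP => li; last by have [_ ->] := Bpt v lv; rewrite (negPf cv).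
  have lh := helper_lt li c1; have [-> _] := B0 _ w lh.
  have lpt : nb <= helper i (col1 w) < npt by rewrite {1}/helper leq_addr (leq_trans lh).
  by have [-> _] := arc_sink sw lpt; rewrite lh helper_col.
Qed.

Section OnlyIf.
Variable Xs : seq {set 'I_nv}.
Hypothesis size_Xs : size Xs = t.

Definition colour (w : nat) (r : nat) := [exists i : 'I_nv, (val i == w) && (i \in nth set0 Xs r)].

Lemma colourE (i : 'I_nv) r : colour i r = (i \in nth set0 Xs r).
Proof.
apply/existsP/idP => [[j /andP[/eqP/val_inj-> //]]|iV].
by exists i; rewrite eqxx.
Qed.

Definition par u v := parity (fun r => colour u r && colour v r) (iota 0 t).

Lemma parC u v : par u v = par v u.
Proof. by rewrite /par /parity; congr odd; apply: eq_count => r; rewrite andbC. Qed.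

Lemma par_eq w u v : (forall r, r < t -> colour u r = colour v r) -> par w u = par w v.
Proof.
move=> H; rewrite /par /parity; congr odd; apply: eq_in_count => r.
by rewrite mem_iota /= add0n => /H->.
Qed.

Lemma invert_par (i j : 'I_nv) : invert_seq (fun i j : 'I_nv => graph_arc i j) Xs i j =
  if par i j then graph_arc j i else graph_arc i j.
Proof.
rewrite invert_seqE; suff -> : parity (fun X : {set 'I_nv} => (i \in X) && (j \in X)) Xs = par i j.
  by [].
rewrite /par /parity -(count_iota_nth set0) size_Xs; congr odd; apply: eq_count => r.
by rewrite !colourE.
Qed.

(** A column of [k - 1] helpers carries [(k - 1) * t] bits, and [width] is one more than the number
    of such patterns. *)
Lemma equal_columns : exists m1 m2, [/\ m1 < width, m2 < width, m1 != m2 &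
  forall g r, g < k.-1 -> r < t -> colour (helper g m1) r = colour (helper g m2) r].
Proof.
pose F (m : 'I_width) := [ffun p : 'I_k.-1 * 'I_t => colour (helper p.1 m) p.2].
case: (boolP (injectiveb F)) => [/injectiveP inj|/injectivePn[m1 [m2 ne12 E]]].
  have := leq_card F inj.
  by rewrite card_ord card_ffun card_bool card_prod !card_ord /width addn1 ltnn.
exists m1, m2; split=> // g r lg lr.
have := congr1 (fun f : {ffun _ -> bool} => f (Ordinal lg, Ordinal lr)) E.
by rewrite !ffunE.
Qed.

(* In each row the two vertices of the equal columns are reversed together, so that at most one
   of them is an in-neighbour (or an out-neighbour) of the sink. *)
Lemma few_helpers m1 m2 w (f : bool -> nat) (P : pred 'I_nv) :
  [/\ m1 < width, m2 < width & m1 != m2] ->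
  (forall g r, g < k.-1 -> r < t -> colour (helper g m1) r = colour (helper g m2) r) ->
  (f = (fun b => if b then m1 else m2) \/ f = (fun b => if b then m2 else m1)) ->
  (forall v, P v -> nb <= v < nh /\ (v - nb) %% width = f (par w v)) ->
  #|P| <= k.-1.
Proof.
move=> [l1 l2 n12] Hcol Hf HP.
pose row (v : 'I_nv) := (v - nb) %/ width.
have rowE v : P v -> row v < k.-1 /\ val v = helper (row v) (f (par w v)).
  case/HP=> /andP[vb vh] E; split.
    by rewrite /row ltn_divLR ?width_gt0 // -(ltn_add2l nb) subnKC.
  by rewrite /helper -E -divn_eq subnKC.
have inj : {in P &, injective row}.
  move=> u v Pu Pv E; apply: val_inj; rewrite (rowE u Pu).2 (rowE v Pv).2 E.
  have [lr ev] := rowE v Pv; have [_ eu] := rowE u Pu; rewrite E in eu.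
  case: (eqVneq (par w u) (par w v)) => [-> //|pne].
  have : par w (helper (row v) m1) = par w (helper (row v) m2).
    by apply: par_eq => r; apply: Hcol.
  move: pne eu ev; case pu: (par w u); case pv: (par w v) => // _ eu ev;
    rewrite eu in pu; rewrite ev in pv; move: pu pv;
    by case: Hf => -> -> ->.
rewrite cardE -(size_map row) -[k.-1](size_iota 0); apply: uniq_leq_size.
  rewrite map_inj_in_uniq ?enum_uniq // => u v; rewrite !mem_enum; exact: inj.
by move=> d /mapP[v]; rewrite mem_enum mem_iota => Pv ->; case: (rowE v Pv).
Qed.

(** Take the sink of [e] for two equal columns. If [e] were monochromatic, its points would be all
    reversed there or all kept. In the first case only helpers send arcs to the sink, in the second
    the sink sends arcs only to helpers, and [few_helpers] leaves fewer than [k] arcs in the cut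
    around it. *)
Lemma coloring_of_strong :
  arc_strong k (invert_seq (fun i j : 'I_nv => graph_arc i j) Xs) -> colorable t np ne mem.
Proof.
have := (nb_le_nh, nh_le_npt, npt_le_nv) => -[[le1 le2] le3].
move=> strong; exists (fun u r => colour (point u) r) => e le.
have [m1 [m2 [l1 l2 n12 Hcol]]] := equal_columns.
pose w := sinkv e m1 m2; have lw : w < nv by apply: sinkv_lt.
have [ew cw1 cw2] := sinkv_dec e l1 l2.
have sw : sink w by rewrite /sink cw1 cw2 n12 /w /sinkv leq_addr.
have npw : npt <= w by case/andP: sw.
pose good r u v := [&& mem e u, mem e v, colour (point u) r & ~~ colour (point v) r].
case: (boolP (has (fun r => has (fun u => has (good r u) (iota 0 np)) (iota 0 np)) (iota 0 t))).
  case/hasP=> r; rewrite mem_iota => lr /hasP[u]; rewrite mem_iota => lu /hasP[v].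
  by rewrite mem_iota => lv /and4P[? ? ? ?]; exists u, v, r.
move=> /hasPn bad; exfalso.
have mono u v r : u < np -> v < np -> r < t -> mem e u -> mem e v ->
    colour (point u) r -> colour (point v) r.
  move=> lu lv lr mu mv cu; have := bad r; rewrite mem_iota => /(_ lr) /hasPn /(_ u).
  rewrite mem_iota => /(_ lu) /hasPn /(_ v); rewrite mem_iota => /(_ lv).
  by rewrite /good mu mv cu /= negbK.
have [be Hbe] : exists be, forall u, u < np -> mem e u -> par w (point u) = be.
  case: (boolP (has (mem e) (iota 0 np))) => [/hasP[u0]|/hasPn no].
    rewrite mem_iota /= add0n => l0 m0; exists (par w (point u0)) => u lu mu.
    by apply: par_eq => r lr; apply/idP/idP; apply: mono.
  (* For an empty hyperedge any value will do. *)
  by exists false => u lu mu; have := no u; rewrite mem_iota mu => /(_ lu).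
pose wo := Ordinal lw.
have arcs (v : 'I_nv) : (graph_arc v w = [&& nb <= v, v < npt &
    if v < nh then (v - nb) %% width == m1 else mem e (v - nh)]) /\
   (graph_arc w v = [&& nb <= v, v < nh & (v - nb) %% width == m2]).
  case: (leqP nb v) => bv /=; last first.
    have wb : (w < nb) = false by apply/negbTE; rewrite -leqNgt; lia.
    by rewrite /graph_arc bv wb sw.
  case: (ltnP v npt) => vp /=.
    have [-> ->] := arc_sink sw (v := v) ltac:(by rewrite bv).
    by rewrite ew cw1 cw2.
  have wb : (w < nb) = false by apply/negbTE; rewrite -leqNgt; lia.
  have vb : (v < nb) = false by lia.
  have wp : (w < npt) = false by lia.
  have vh : (v < nh) = false by lia.
  have wh : (w < nh) = false by lia.
  have vp' : (v < npt) = false by lia.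
  by rewrite /graph_arc wb vb wp wh vp' vh /= !andbF.
have wn0 : [set wo] != set0 by apply/set0Pn; exists wo; rewrite inE.
have z0 : 0 < nv by exact: (leq_ltn_trans (leq0n w) lw).
have zw : Ordinal z0 != wo.
  by rewrite -val_eqE /= neq_ltn (leq_trans _ npw) // (leq_trans _ le2) //
    (leq_trans _ le1) // /nb; lia.
have kk : k.-1 < k by rewrite prednK.
pose A' := invert_seq (fun i j : 'I_nv => graph_arc i j) Xs.
case: be Hbe => Hbe.
- have V0 : ~: [set wo] != set0 by apply/set0Pn; exists (Ordinal z0); rewrite !inE.
  have VT : ~: [set wo] != setT.
    by apply/negP=> /eqP/setP/(_ wo); rewrite !inE eqxx.
  have := strong _ V0 VT; rewrite leqNgt => /negP; apply; apply: leq_ltn_trans kk.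
  pose P := [pred v : 'I_nv | A' v wo].
  have := @few_helpers m1 m2 w (fun b => if b then m2 else m1) P (And3 l1 l2 n12) Hcol
    (or_intror erefl) _.
  move=> /(_ _)/wrap[]; last first.
    apply: leq_trans; rewrite -(card_imset P (f := fun v => (v, wo))); last by move=> x y [].
    apply: subset_leq_card; apply/subsetP=> -[x y]; rewrite !inE /= negbK => /and3P[_ /eqP-> H].
    by apply/imsetP; exists x.
  move=> v; rewrite inE /A' invert_par /= parC; have [-> ->] := arcs v.
  case: ifP => [pv /and3P[-> ->] /eqP-> //|pv /and3P[-> vp]].
  case: ltnP => vh; first by move/eqP=> ->.
  move=> mv; have lp : v - nh < np by move: vp; rewrite /npt; lia.
  by have := Hbe _ lp mv; rewrite /point subnKC // pv.
- have VT : [set wo] != setT.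
    by apply/negP=> /eqP/setP/(_ (Ordinal z0)); rewrite !inE (negPf zw).
  have := strong _ wn0 VT; rewrite leqNgt => /negP; apply; apply: leq_ltn_trans kk.
  pose P := [pred v : 'I_nv | A' wo v].
  have := @few_helpers m1 m2 w (fun b => if b then m1 else m2) P (And3 l1 l2 n12) Hcol
    (or_introl erefl) _.
  move=> /(_ _)/wrap[]; last first.
    apply: leq_trans; rewrite -(card_imset P (f := fun v => (wo, v))); last by move=> x y [].
    apply: subset_leq_card; apply/subsetP=> -[x y]; rewrite !inE /= => /and3P[/eqP-> _ H].
    by apply/imsetP; exists y.
  move=> v; rewrite inE /A' invert_par /=; have [-> ->] := arcs v.
  case: ifP => [pv /and3P[-> vp]|pv /and3P[-> ->] /eqP-> //].
  case: ltnP => vh; first by move/eqP=> ->.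
  move=> mv; have lp : v - nh < np by move: vp; rewrite /npt; lia.
  by have := Hbe _ lp mv; rewrite /point subnKC // pv.
Qed.
End OnlyIf.

Lemma sinv_coloring : sinv_le k t (fun i j : 'I_nv => graph_arc i j) <-> colorable t np ne mem.
Proof.
split=> [[Xs [sX st]]|]; last exact: sinv_of_coloring.
apply: (@coloring_of_strong (Xs ++ nseq (t - size Xs) set0)).
  by rewrite size_cat size_nseq subnKC.
by apply: eq_arc_strong st => u v; rewrite invert_pad.
Qed.
End Reduction.

Lemma hypergraph_reduction k t (L : language) (np ne : seq bool -> nat)
  (mem : seq bool * nat * nat -> bool) : 0 < k -> PT np -> PT ne -> PT mem ->
  (forall x, L x <-> colorable t (np x) (ne x) (fun e u => mem (x, e, u))) ->
  poly_reduces L (SINV_lang k t).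
Proof.
move=> k0 pnp pne pmem HL.
pose N x := nv k t (np x) (ne x).
pose A x := graph_arc k t (np x) (fun e u => mem (x, e, u)).
exists (fun x => mkseq (fun q => A x (q %/ N x) (q %% N x)) (N x * N x)); split.
  apply: PT_poly_computable.
  have pN : PT N by rewrite /N /nv /npt; pt.
  apply: PT_mkseq; last by pt.
  by rewrite /A /graph_arc /sink /col1 /col2 /edge /nh /nb /npt; pt.
move=> x; rewrite HL -(sinv_coloring _ _ _ _ k0) -/(N x) -/(A x).
have nthA (i j : 'I_(N x)) : nth false (mkseq (fun q => A x (q %/ N x) (q %% N x))
    (N x * N x)) (i * N x + j) = A x i j.
  have := ltn_ord i; have := ltn_ord j => lj li; have n0 : 0 < N x by lia.
  rewrite nth_mkseq ?divnMDl ?modnMDl ?(divn_small lj) ?(modn_small lj) ?addn0 //; nia.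
split=> [H|[n [B [[sx HB] [_ H]]]]].
  exists (N x), (fun i j => A x i j); split; last by split=> //; exact: arc_oriented.
  by split; [rewrite size_mkseq | exact: nthA].
rewrite size_mkseq in sx.
(* The length of the word determines the number of vertices, so the graph in [SINV_lang] is the one
   built from [x]. *)
have En : n = N x by nia.
subst n; case: H => Xs [sX st]; exists Xs; split=> //.
apply: eq_arc_strong st => i j; rewrite !invert_seqE.
by rewrite -!HB !nthA.
Qed.

(** * From satisfiability to hypergraph colouring *)

(** [lit j i b] means that clause [j] contains the literal of variable [i] which is true when the
    variable has value [b]. As a predicate it allows clauses of any length. *)
Definition satisfiable (nvar ncl : nat) (lit : nat -> nat -> bool -> bool) :=
  exists v : nat -> bool, forall j, j < ncl ->
    exists i b, [/\ i < nvar, lit j i b & v i = b].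

Lemma bits_differ t a b : a < 2 ^ t -> b < 2 ^ t -> a != b ->
  exists2 r, r < t & odd (a %/ 2 ^ r) != odd (b %/ 2 ^ r).
Proof.
elim: t a b => [|t IH] a b; first by rewrite expn0; lia.
rewrite expnS => la lb ab; case: (eqVneq (odd a) (odd b)) => [E|ne]; last first.
  by exists 0; rewrite // expn0 !divn1.
have [|||r lr Hr] := IH (a %/ 2) (b %/ 2).
- by rewrite ltn_divLR // mulnC.
- by rewrite ltn_divLR // mulnC.
- by apply: contraNneq ab => H; rewrite (divn_eq a 2) (divn_eq b 2) H !modn2 E.
by exists r.+1; rewrite // expnS !divnMA.
Qed.

Section ColoringOfFormula.
Variables (t nvar ncl : nat) (lit : nat -> nat -> bool -> bool).
Hypothesis t0 : 0 < t.

(* The points are [2 ^ t] pairwise adjacent ones, standing for the colours, and two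
   literals per variable, which can only have the colour of point 0 (false) or
   of point 1 (true). *)
Definition nsat := 2 ^ t + 2 * nvar.
Definition adjacent u v := (u != v) &&
  [|| (u < 2 ^ t) && (v < 2 ^ t), (2 ^ t <= u) && (1 < v < 2 ^ t) |
    [&& 2 ^ t <= u, 2 ^ t <= v & (u - 2 ^ t) %/ 2 == (v - 2 ^ t) %/ 2]].
Definition nhyp := nsat * nsat + ncl.
(** The hyperedges are numbered by all ordered pairs of points, followed by the clauses. A pair that
    is not adjacent receives the harmless hyperedge of the points 0 and 1, which are adjacent
    anyway. *)
Definition sat_mem e w :=
  if e < nsat * nsat then
    if adjacent (e %/ nsat) (e %% nsat) then (w == e %/ nsat) || (w == e %% nsat)
    else (w == 0) || (w == 1)
  else (w == 0) ||
    (2 ^ t <= w) && lit (e - nsat * nsat) ((w - 2 ^ t) %/ 2) ((w - 2 ^ t) %% 2 == 1).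

Let q_gt1 : 1 < 2 ^ t.
Proof. by case: t t0 => // k _; rewrite expnS; have := expn_gt0 2 k; lia. Qed.

Let literal i (b : bool) := 2 ^ t + (2 * i + b).

Let literal_lt i b : i < nvar -> literal i b < nsat.
Proof. by move=> li; rewrite /literal /nsat ltn_add2l; case: b; lia. Qed.

Let literal_var i b : (literal i b - 2 ^ t) %/ 2 = i.
Proof. by rewrite /literal addKn; case: b; lia. Qed.

Let literal_sign i b : ((literal i b - 2 ^ t) %% 2 == 1) = b.
Proof. by rewrite /literal addKn; case: b; lia. Qed.

Lemma coloring_of_sat : satisfiable nvar ncl lit -> colorable t nsat nhyp sat_mem.
Proof.
case=> v Hv.
(* A palette point gets its own number as colour; a literal gets 1 or 0 according to its truth
   value. *)
pose num w := if w < 2 ^ t then w else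
  (v ((w - 2 ^ t) %/ 2) == ((w - 2 ^ t) %% 2 == 1)) : nat.
have num_lt w : num w < 2 ^ t.
  by rewrite /num; case: ifP => // _; case: (_ == _) => /=; lia.
have sep e u w : u < nsat -> w < nsat -> sat_mem e u -> sat_mem e w -> num u != num w ->
    exists u v r, [/\ u < nsat, v < nsat & r < t] /\
    [/\ sat_mem e u, sat_mem e v, odd (num u %/ 2 ^ r) & ~~ odd (num v %/ 2 ^ r)].
  move=> lu lw mu mw /(bits_differ (num_lt u) (num_lt w))[r lr].
  case Ou: (odd (num u %/ 2 ^ r)); case Ow: (odd (num w %/ 2 ^ r)) => // _.
    by exists u, w, r; rewrite Ou Ow.
  by exists w, u, r; rewrite Ou Ow.
have l0 : 0 < nsat by rewrite /nsat; lia.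
have l1 : 1 < nsat by rewrite /nsat; lia.
have n0 : num 0 = 0 by rewrite /num (ltnW q_gt1).
exists (fun w r => odd (num w %/ 2 ^ r)) => e; rewrite /nhyp => le.
case: (ltnP e (nsat * nsat)) => le2; last first.
  have [|i [b [li Hl vi]]] := Hv (e - nsat * nsat); first by lia.
  have mb : sat_mem e (literal i b).
    by rewrite /sat_mem ltnNge le2 /= literal_var literal_sign Hl {1}/literal leq_addr orbT.
  apply: (sep e _ _ l0 (literal_lt b li)) mb _; first by rewrite /sat_mem ltnNge le2.
  rewrite n0 /num literal_var literal_sign vi eqxx {1}/literal.
  by rewrite ltnNge leq_addr.
case adj: (adjacent (e %/ nsat) (e %% nsat)); last first.
  have m01 w : w < 2 -> sat_mem e w by rewrite /sat_mem le2 adj; lia.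
  by apply: (sep e _ _ l0 l1); rewrite ?m01 // n0 /num q_gt1.
apply: (sep e (e %/ nsat) (e %% nsat)).
- by rewrite ltn_divLR.
- by rewrite ltn_mod.
- by rewrite /sat_mem le2 adj eqxx.
- by rewrite /sat_mem le2 adj eqxx orbT.
move: adj; set u := e %/ nsat; set w := e %% nsat; rewrite /adjacent /num.
case: (ltnP u) => lu; case: (ltnP w) => lw /=; rewrite ?andbT ?andbF ?orbF //.
  by case: (_ == _ :> bool) => /=; lia.
case/andP=> uw /eqP E; rewrite E.
have : (u - 2 ^ t) %% 2 != (w - 2 ^ t) %% 2.
  apply: contraNneq uw => E2; apply/eqP.
  have := divn_eq (u - 2 ^ t) 2; have := divn_eq (w - 2 ^ t) 2; rewrite E E2; lia.
have := ltn_pmod (u - 2 ^ t) (isT : 0 < 2); have := ltn_pmod (w - 2 ^ t) (isT : 0 < 2).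
by case: ((u - _) %% 2) => [|[|]] //; case: ((w - _) %% 2) => [|[|]] //; case: (v _).
Qed.

(** The palette is injective into as many colours as it has points, so it uses all of them. A
    literal differs from the points 2, 3, ... and hence has the colour of 0 or of 1. A clause
    contains point 0 and is not monochromatic, so one of its literals has the colour of 1. *)
Lemma sat_of_coloring : colorable t nsat nhyp sat_mem -> satisfiable nvar ncl lit.
Proof.
case=> c Hc; pose F w := [ffun r : 'I_t => c w r].
have edgeE u v : u < nsat -> v < nsat -> adjacent u v -> F u != F v.
  move=> lu lv adj; have nz : 0 < nsat by apply: leq_ltn_trans lu.
  have d1 : (u * nsat + v) %/ nsat = u by rewrite divnMDl // divn_small // addn0.
  have d2 : (u * nsat + v) %% nsat = v by rewrite modnMDl modn_small.
  have lt : u * nsat + v < nsat * nsat by nia.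
  have [|u' [v' [r [[_ _ lr] []]]]] := Hc (u * nsat + v); first by rewrite /nhyp; lia.
  rewrite /sat_mem lt d1 d2 adj => m1 m2 cu cv.
  apply/eqP=> /ffunP/(_ (Ordinal lr)); rewrite !ffunE /= => E.
  by case/orP: m1 cu => /eqP->; case/orP: m2 cv => /eqP->; rewrite ?E => /negP.
have inj : injective (fun a : 'I_(2 ^ t) => F a).
  move=> a b E; apply: contraTeq (eqxx (F a)) => ab; rewrite {2}E; apply: edgeE.
  - by apply: leq_trans (ltn_ord a) _; apply: leq_addr.
  - by apply: leq_trans (ltn_ord b) _; apply: leq_addr.
  - by rewrite /adjacent !ltn_ord andbT /= andbT.
have onto f : exists2 a, a < 2 ^ t & f = F a.
  have := inj_card_onto inj; rewrite card_ffun card_bool !card_ord leqnn => /(_ isT f).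
  by case/codomP=> a ->; exists a.
have two i b : i < nvar -> F (literal i b) = F 0 \/ F (literal i b) = F 1.
  move=> li; have [a la E] := onto (F (literal i b)).
  case: a la E => [|[|a]] la E; [by left | by right | exfalso].
  have := edgeE (literal i b) a.+2 (literal_lt b li).
  rewrite E eqxx => H; suff: false by []; apply: H; first by apply: leq_trans la _; apply: leq_addr.
  by rewrite /adjacent /literal la leq_addr /= orbT andbT; lia.
have opp i : i < nvar -> F (literal i true) != F (literal i false).
  move=> li; apply: edgeE; try exact: literal_lt.
  by rewrite /adjacent !literal_var eqxx /literal !leq_addr /= !orbT andbT; lia.
pose v i := F (literal i true) == F 1.
exists v => j lj.
have [|u [w [r [[lu lw lr] [mu mw cu cw]]]]] := Hc (nsat * nsat + j).
  by rewrite /nhyp; lia.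
have uw : F u != F w.
  by apply/eqP=> /ffunP/(_ (Ordinal lr)); rewrite !ffunE /= cu (negPf cw).
have [z [lz mz Fz]] : exists z, [/\ z < nsat, sat_mem (nsat * nsat + j) z & F z != F 0].
  case: (eqVneq (F u) (F 0)) => [E|ne]; last by exists u.
  by exists w; rewrite -E eq_sym.
move: mz; rewrite /sat_mem ltnNge leq_addr /= addKn.
case/orP=> [/eqP E|/andP[qz Hl]]; first by rewrite E eqxx in Fz.
set i := (z - _) %/ 2 in Hl *; set b := _ == 1 in Hl *.
have ez : z = literal i b.
  by rewrite /literal /i /b; have := divn_eq (z - 2 ^ t) 2; lia.
have li : i < nvar by move: lz; rewrite ez /nsat /literal; case: (b); lia.
exists i, b; split=> //; rewrite /v.
rewrite ez in Fz.
have E1 : F (literal i b) = F 1 by case: (two i b li) => // E; rewrite E eqxx in Fz.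
by case: (b) E1 (opp i li) => ->; rewrite ?eqxx // => /negPf.
Qed.
End ColoringOfFormula.

Lemma sat_reduction k t (L : language) (nvar ncl : seq bool -> nat)
  (lit : seq bool * nat * nat * bool -> bool) : 0 < k -> 0 < t ->
  PT nvar -> PT ncl -> PT lit ->
  (forall x, L x <-> satisfiable (nvar x) (ncl x) (fun j i b => lit (x, j, i, b))) ->
  poly_reduces L (SINV_lang k t).
Proof.
move=> k0 t0 pnv pnc pl HL.
apply: (@hypergraph_reduction k t L (fun x => nsat t (nvar x)) (fun x => nhyp t (nvar x) (ncl x))
  (fun p => sat_mem t (nvar p.1.1) (fun j i b => lit (p.1.1, j, i, b)) p.1.2 p.2) k0).
- by rewrite /nsat; pt.
- by rewrite /nhyp /nsat; pt.
- by rewrite /sat_mem /adjacent /nsat; pt.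
move=> x; rewrite HL; split; [exact: coloring_of_sat | exact: sat_of_coloring].
Qed.

(** * The Cook-Levin tableau *)

Section Trajectory.
Variable M : TM.

Definition next_move (q : tm_state M) (h : option bool) : tm_state M * option bool * move :=
  if tm_halt q then (q, h, MoveS) else tm_delta q h.

Definition move_pos (m : move) (p : nat) :=
  match m with MoveL => p.-1 | MoveR => p.+1 | MoveS => p end.

(** A configuration has no absolute positions; the last component is the position of the head, from
    which [cell] numbers the whole tape. *)
Definition snapshot := (tm_state M * tape * nat)%type.

Definition advance (c : snapshot) : snapshot :=
  let: (q, tp, hp) := c in let: (q', w, m) := next_move q tp.1.2 in
  (q', tmove w m tp, move_pos m hp).

Definition cell (hp : nat) (tp : tape) (p : nat) : option bool :=
  if p == hp then tp.1.2 else
  if p < hp then nth None tp.1.1 (hp.-1 - p) else nth None tp.2 (p - hp.+1).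

Lemma cell_head hp tp : cell hp tp hp = tp.1.2.
Proof. by rewrite /cell eqxx. Qed.

(** At position 0 a move to the left would keep the truncated position while the tape moves under
    it, hence [0 < hp]. *)
Lemma cell_move hp tp w m p : 0 < hp ->
  cell (move_pos m hp) (tmove w m tp) p = if p == hp then w else cell hp tp p.
Proof.
case: hp => // hp _; case: tp => [[l h] r]; rewrite /cell.
case: m => /=.
- have -> : (if l is a :: l' then (l', a, w :: r) else ([::], None, w :: r)) =
      (behead l, nth None l 0, w :: r) by case: l.
  rewrite /= ; case: (ltngtP p hp) => [lt|gt|->]; last 2 first.
  + case: (eqVneq p hp.+1) => [->|ne]; first by rewrite subnn.
    have -> : (p < hp.+1) = false by lia.
    by have -> : p - hp.+1 = (p - hp.+2).+1 by lia.
  + by rewrite (ltn_eqF (ltnSn _)) ltnSn subnn.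
  have -> : (p == hp.+1) = false by lia.
  have -> : (p < hp.+1) = true by lia.
  by rewrite nth_behead; congr nth; lia.
- have -> : (if r is a :: r' then (w :: l, a, r') else (w :: l, None, [::])) =
      (w :: l, nth None r 0, behead r) by case: r.
  rewrite /=; case: (ltngtP p hp.+1) => [lt|gt|->].
  + have -> : (p == hp.+2) = false by lia.
    have -> : (p < hp.+2) = true by lia.
    by have -> : hp.+1 - p = (hp - p).+1 by lia.
  + case: (eqVneq p hp.+2) => [->|ne]; first by rewrite subnn.
    have -> : (p < hp.+2) = false by lia.
    by rewrite nth_behead; congr nth; lia.
  + by rewrite (ltn_eqF (ltnSn _)) ltnSn subnn.
- by case: eqP.
Qed.

Definition trajectory (z : seq bool) p0 s : snapshot :=
  iter s advance (tm_start M, start_tape z, p0).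

Lemma step_advance q tp hp : step (conf q tp) =
  conf (advance (q, tp, hp)).1.1 (advance (q, tp, hp)).1.2.
Proof.
rewrite /advance /next_move; case: (boolP (tm_halt q)) => hq; last first.
  by rewrite step_conf //; case: (tm_delta q tp.1.2) => [[]].
by case: tp => [[l h] r]; rewrite /conf /step /= hq.
Qed.

Lemma run_trajectory z p0 s :
  run s (init M z) = conf (trajectory z p0 s).1.1 (trajectory z p0 s).1.2.
Proof.
elim: s => [|s IH]; first exact: init_conf.
rewrite /run iterS -/(run s _) IH /trajectory iterS -/(trajectory z p0 s).
by case: (trajectory z p0 s) => [[q tp] hp]; apply: step_advance.
Qed.

Lemma trajectory_pos z p0 s : p0 <= (trajectory z p0 s).2 + s /\ (trajectory z p0 s).2 <= p0 + s.
Proof.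
elim: s => [|s]; first by rewrite /= !addn0.
rewrite /trajectory iterS -/(trajectory z p0 s).
case: (trajectory z p0 s) => [[q tp] hp] /=.
by case: (next_move q tp.1.2) => [[q' w] []] /= [H1 H2]; split; lia.
Qed.

Lemma cell_start z p0 p : cell p0 (start_tape z) p =
  if p < p0 then None else nth None (map Some z) (p - p0).
Proof.
rewrite /cell; case: (ltngtP p p0) => [lt|gt|->].
- by case: z => [|b z] /=; rewrite nth_nil.
- have -> : p - p0 = (p - p0.+1).+1 by lia.
  by case: z => [|b z] //=; rewrite nth_nil.
- by rewrite subnn; case: z.
Qed.

Lemma run_halted m (c : config M) : tm_halt (cstate c) -> run m c = c.
Proof.
move=> hc; elim: m => // m IH; rewrite /run iterS -/(run m c) IH.
by case: c hc {IH} => [[[q l] h] r] /= ->.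
Qed.

(** A halted configuration is fixed by [step], so the answer can be read at one common time [t]. *)
Lemma decides_run (L : language) (T : nat -> nat) z t : decides_in M L T -> T (size z) <= t ->
  L z <-> tm_acc (cstate (run t (init M z))).
Proof.
move=> /(_ z)[m [le [hm am]]] lt; rewrite -am.
suff -> : run t (init M z) = run m (init M z) by [].
have -> : t = (t - m) + m by rewrite subnK // (leq_trans le).
by rewrite /run iterD -/(run _ _) run_halted.
Qed.
End Trajectory.

Lemma pack_lt a b m n : a < m -> b < n -> a * n + b < m * n.
Proof. by move=> am bn; have := leq_mul am (leqnn n); rewrite mulSn; lia. Qed.

(** * The clauses of the tableau *)

Section Tableau.
Variable M : TM.
Variables (tmax ymax : seq bool -> nat).

(** In [tmax x] steps the head started here cannot reach position 0. The margin on the right in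
    [dim] has the same purpose, and [dim] bounds times as well as positions. *)
Definition origin x := (tmax x).+1.
Definition ystart x := origin x + (2 * size x + 2).
Definition yend x := ystart x + ymax x.
Definition dim x := yend x + (tmax x).+3.

Definition prefix_bit (x : seq bool) d :=
  if d < 2 * size x then nth false x (d %/ 2) else d == (2 * size x).+1.

Lemma prefix_bitE x y d : d < 2 * size x + 2 -> nth false (pair_enc x y) d = prefix_bit x d.
Proof.
rewrite /prefix_bit => ld; case: ltnP => lt.
  have hd : d %/ 2 < size x by rewrite ltn_divLR // mulnC.
  have [e0 e1] := nth_double y hd.
  have := modn2 d; have := divn_eq d 2; rewrite [_ * 2]mulnC; case: (odd d) => /= ed em.
    by rewrite -e1 [in LHS]ed em addn1.
  by rewrite -e0 [in LHS]ed em addn0.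
have -> : d = 2 * size x + (d - 2 * size x) by lia.
rewrite nth_pair_tail; have : d - 2 * size x < 2 by lia.
case: (d - _) => [|[|]] //= _; first by rewrite addn0 ltn_eqF.
by rewrite addn1 eqxx.
Qed.

Local Notation Q := (tm_state M).

Definition symcode (a : option bool) := if a is Some b then b.+1 else 0.
Definition head_var (q : Q) : nat := enum_rank q.
Definition cell_var (a : option bool) : nat := #|Q| + symcode a.
Definition nkind := #|Q| + 3.

(* A literal is (sign, time offset, place, kind); a clause is the number of its guard with its
   literals, and is instantiated at a time [s] and two positions [p], [p']. *)
Definition literal := (bool * bool * nat * nat)%type.
Definition clause := (nat * seq literal)%type.
Definition context := (seq bool * nat * nat * nat)%type.

Definition place (k : nat) (c : context) : nat :=
  let: (x, s, p, p') := c in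
  match k with 0 => p | 1 => p' | 2 => p.+1 | _ => p.-1 end.

(** Guards 0 to 5 concern the initial configuration, 6 to 8 the transitions, and 9 the final time.
    Numbering them keeps the clause schemes finite data independent of [x]. *)
Definition guard (g : nat) (c : context) : bool :=
  let: (x, s, p, p') := c in
  match g with
  | 0 => (s == 0) && (p == origin x)
  | 1 => (s == 0) && ((p < origin x) || (yend x <= p))
  | 2 => [&& s == 0, origin x <= p, p < ystart x & ~~ prefix_bit x (p - origin x)]
  | 3 => [&& s == 0, origin x <= p, p < ystart x & prefix_bit x (p - origin x)]
  | 4 => [&& s == 0, ystart x <= p & p < yend x]
  | 5 => [&& s == 0, ystart x <= p & p.+1 < yend x]
  | 6 => [&& s < tmax x, 0 < p & p.+1 < dim x]
  | 7 => s < tmax x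
  | 8 => (s < tmax x) && (p != p')
  | _ => s == tmax x
  end.

Definition move_place m := match m with MoveL => 3 | MoveR => 2 | MoveS => 0 end.

Definition head_rule (qa : Q * option bool) : clause := let: (q', w, m) := next_move qa.1 qa.2 in
  (6, [:: (false, false, 0, head_var qa.1); (false, false, 0, cell_var qa.2);
          (true, true, move_place m, head_var q')]).
Definition write_rule (qa : Q * option bool) : clause := let: (q', w, m) := next_move qa.1 qa.2 in
  (7, [:: (false, false, 0, head_var qa.1); (false, false, 0, cell_var qa.2);
          (true, true, 0, cell_var w)]).
(** The head at [p'] and the cell at another position [p]: this rule is the reason for having two
    positions. *)
Definition keep_rule (qa : Q * option bool) : clause :=
  (8, [:: (false, false, 1, head_var qa.1); (false, false, 0, cell_var qa.2);
          (true, true, 0, cell_var qa.2)]).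
(** It is instantiated with the states that do not accept, and so excludes them at the final
    time. *)
Definition accept_rule (q : Q) : clause := (9, [:: (false, false, 0, head_var q)]).

(** The clause with guard 4 guesses the cells of the certificate; the one with guard 5 makes the
    certificate end at its first blank. *)
Definition start_rules : seq clause :=
  [:: (0, [:: (true, false, 0, head_var (tm_start M))]);
      (1, [:: (true, false, 0, cell_var None)]);
      (2, [:: (true, false, 0, cell_var (Some false))]);
      (3, [:: (true, false, 0, cell_var (Some true))]);
      (4, [:: (true, false, 0, cell_var None); (true, false, 0, cell_var (Some false));
              (true, false, 0, cell_var (Some true))]);
      (5, [:: (false, false, 0, cell_var None); (true, false, 2, cell_var None)])].

Definition clauses : seq clause :=
  start_rules ++ map head_rule (enum {: Q * option bool}) ++
  map write_rule (enum {: Q * option bool}) ++ map keep_rule (enum {: Q * option bool}) ++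
  [seq accept_rule q | q <- enum Q & ~~ tm_acc q].

Definition var_index x s p k := (s * dim x + p) * nkind + k.
Definition nvars x := dim x * dim x * nkind.
Definition nclauses x := dim x * dim x * dim x * size clauses.

Definition context_of x j : context :=
  (x, j %/ size clauses %/ dim x %/ dim x, j %/ size clauses %/ dim x %% dim x,
   j %/ size clauses %% dim x).

(** Where its guard fails a clause contains all literals, so that every number below [nclauses x]
    denotes a clause and the vacuous ones hold trivially. *)
Definition has_literal (cl : clause) (t : seq bool * nat * nat * bool) :=
  let: (x, j, i, b) := t in let c := context_of x j in
  ~~ guard cl.1 c || has (fun l : literal => (l.1.1.1 == b) &&
    (i == var_index x (c.1.1.2 + l.1.1.2) (place l.1.2 c) l.2)) cl.2.

Definition literal_in (t : seq bool * nat * nat * bool) :=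
  nth (fun=> false) (map has_literal clauses) (t.1.1.2 %% size clauses) t.

Lemma size_clauses_gt0 : 0 < size clauses. Proof. by rewrite size_cat. Qed.

Lemma literal_inE x j i b : literal_in (x, j, i, b) =
  has_literal (nth (0, [::]) clauses (j %% size clauses)) (x, j, i, b).
Proof. by rewrite /literal_in (nth_map (0, [::])) // ltn_mod size_clauses_gt0. Qed.

Lemma dim_gt0 x : 0 < dim x. Proof. by rewrite /dim addnS. Qed.

Definition holds (v : nat -> nat -> nat -> bool) (c : context) (l : literal) :=
  v (c.1.1.2 + l.1.1.2) (place l.1.2 c) l.2 == l.1.1.1.

Definition models x (v : nat -> nat -> nat -> bool) := forall s p p' cl,
  s < dim x -> p < dim x -> p' < dim x -> cl \in clauses -> guard cl.1 (x, s, p, p') ->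
  has (holds v (x, s, p, p')) cl.2.

Definition in_range x (c : context) (l : literal) :=
  [&& c.1.1.2 + l.1.1.2 < dim x, place l.1.2 c < dim x & l.2 < nkind].

Lemma context_index x s p p' r : r < size clauses -> s < dim x -> p < dim x -> p' < dim x ->
  let j := ((s * dim x + p) * dim x + p') * size clauses + r in
  [/\ j < nclauses x, context_of x j = (x, s, p, p') & j %% size clauses = r].
Proof.
move=> lr ls lp lp' j; have d0 := dim_gt0 x; split.
- rewrite /j /nclauses; set D := dim x in ls lp lp' *.
  have h1 : s * D + p < D * D by apply: pack_lt.
  have h2 : (s * D + p) * D + p' < D * D * D by apply: pack_lt.
  exact: pack_lt.
- have e1 : j %/ size clauses = (s * dim x + p) * dim x + p'.
    by rewrite /j divnMDl ?size_clauses_gt0 // divn_small // addn0.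
  have e2 : j %/ size clauses %/ dim x = s * dim x + p.
    by rewrite e1 divnMDl // divn_small // addn0.
  rewrite /context_of e2 e1 !modnMDl !modn_small // divnMDl // divn_small // addn0 //.
- by rewrite /j modnMDl modn_small.
Qed.

Lemma models_of_sat x :
  satisfiable (nvars x) (nclauses x) (fun j i b => literal_in (x, j, i, b)) ->
  exists v, models x v.
Proof.
case=> v Hv; exists (fun s p k => v (var_index x s p k)) => s p p' cl ls lp lp' cin g.
have lr : index cl clauses < size clauses by rewrite index_mem.
have [lj ej er] := context_index lr ls lp lp'.
have [i [b [_]]] := Hv _ lj; rewrite literal_inE er nth_index //.
rewrite /has_literal ej g /= => /hasP[l lin /andP[/eqP eb /eqP->]] vi.
by apply/hasP; exists l => //; rewrite /holds /= vi eb.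
Qed.

Lemma sat_of_models x v :
  (forall s p p' cl, s < dim x -> p < dim x -> p' < dim x -> cl \in clauses ->
    guard cl.1 (x, s, p, p') ->
    has (fun l => in_range x (x, s, p, p') l && holds v (x, s, p, p') l) cl.2) ->
  satisfiable (nvars x) (nclauses x) (fun j i b => literal_in (x, j, i, b)).
Proof.
move=> Hv; have d0 := dim_gt0 x; have k0 : 0 < nkind by rewrite /nkind addn3.
exists (fun i => v (i %/ nkind %/ dim x) (i %/ nkind %% dim x) (i %% nkind)) => j lj.
pose c := context_of x j; pose r := j %% size clauses.
have lr : r < size clauses by rewrite ltn_mod size_clauses_gt0.
pose cl := nth (0, [::]) clauses r; have cin : cl \in clauses by apply: mem_nth.
have lite i b : literal_in (x, j, i, b) = has_literal cl (x, j, i, b).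
  exact: literal_inE.
case: (boolP (guard cl.1 c)) => [g|ng]; last first.
  (* The clause contains both literals of variable 0; the one with the sign given by the assignment
     is true. *)
  exists 0, (v (0 %/ nkind %/ dim x) (0 %/ nkind %% dim x) (0 %% nkind)).
  by split=> //; [rewrite /nvars !muln_gt0 d0 k0 | rewrite lite /has_literal -/c ng].
have [|||l lin] := hasP (Hv _ _ _ cl _ _ _ cin g).
- by rewrite !ltn_divLR ?size_clauses_gt0.
- by rewrite ltn_mod.
- by rewrite ltn_mod.
case/andP=> /and3P[ls lp lk] /eqP hl.
exists (var_index x (c.1.1.2 + l.1.1.2) (place l.1.2 c) l.2), l.1.1.1; split.
- have h1 : (c.1.1.2 + l.1.1.2) * dim x + place l.1.2 c < dim x * dim x.
    exact: pack_lt.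
  exact: pack_lt.
- rewrite lite /has_literal -/c g /=; apply/hasP; exists l => //; by rewrite !eqxx.
- rewrite -hl /var_index; congr v.
  + by rewrite divnMDl // (divn_small lk) addn0 divnMDl // divn_small // addn0.
  + by rewrite divnMDl // (divn_small lk) addn0 modnMDl modn_small.
  + by rewrite modnMDl modn_small.
Qed.

Lemma head_var_lt q : head_var q < nkind.
Proof. by rewrite /nkind ltn_addr ?ltn_ord. Qed.

Lemma cell_var_lt a : cell_var a < nkind.
Proof. by rewrite /cell_var /nkind ltn_add2l; case: a => [[]|]. Qed.

Lemma head_var_eq q q' : (head_var q == head_var q') = (q == q').
Proof. by rewrite /head_var (inj_eq val_inj) (inj_eq enum_rank_inj). Qed.

Lemma cell_var_eq a b : (cell_var a == cell_var b) = (a == b).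
Proof. by rewrite /cell_var eqn_add2l; case: a => [[]|]; case: b => [[]|]. Qed.

Lemma head_cell_var q a : (head_var q == cell_var a) = false.
Proof. by apply: ltn_eqF; apply: leq_trans (ltn_ord _) (leq_addr _ _). Qed.

Section Soundness.
Variables x y : seq bool.
Hypothesis size_y : size y <= ymax x.
Let traj := trajectory M (pair_enc x y) (origin x).
Hypothesis accepting : tm_acc (traj (tmax x)).1.1.

Definition actual s p k := (k == head_var (traj s).1.1) && (p == (traj s).2) ||
  (k == cell_var (cell (traj s).2 (traj s).1.2 p)).

Let actual_head s p q : actual s p (head_var q) = (q == (traj s).1.1) && (p == (traj s).2).
Proof. by rewrite /actual head_var_eq head_cell_var orbF. Qed.

Let actual_cell s p a : actual s p (cell_var a) = (a == cell (traj s).2 (traj s).1.2 p).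
Proof. by rewrite /actual cell_var_eq [_ == head_var _]eq_sym head_cell_var. Qed.

Let actual0 p : cell (traj 0).2 (traj 0).1.2 p =
  if p < origin x then None else nth None (map Some (pair_enc x y)) (p - origin x).
Proof. exact: cell_start. Qed.

Let nth_some d : d < size (pair_enc x y) ->
  nth None (map Some (pair_enc x y)) d = Some (nth false (pair_enc x y) d).
Proof. by move=> lt; rewrite (nth_map false). Qed.

Let traj_next s : traj s.+1 = advance (traj s).
Proof. by []. Qed.

Let traj_gt0 s : s <= tmax x -> 0 < (traj s).2.
Proof. by have [] := trajectory_pos M (pair_enc x y) (origin x) s; rewrite -/traj /origin; lia. Qed.

Lemma actual_models s p p' cl : s < dim x -> p < dim x -> p' < dim x -> cl \in clauses ->
  guard cl.1 (x, s, p, p') ->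
  has (fun l => in_range x (x, s, p, p') l && holds actual (x, s, p, p') l) cl.2.
Proof.
move=> ls lp lp'; have sp := size_pair x y.
have rH q : (head_var q < nkind) = true by apply: head_var_lt.
have rC a : (cell_var a < nkind) = true by apply: cell_var_lt.
rewrite !mem_cat => /or4P[|/mapP[[q a] _ ->]|/mapP[[q a] _ ->]|/orP[/mapP[[q a] _ ->]|]].
- rewrite !inE /in_range /holds /=.
  do 5?[case/orP]; move/eqP=> -> /=; rewrite ?orbF !addn0 ?actual_head ?actual_cell ?rH ?rC lp.
  + by case/andP=> /eqP-> /eqP->; rewrite !eqxx dim_gt0.
  + case/andP=> /eqP-> H; rewrite actual0 dim_gt0 /=.
    case: ltnP => // le; rewrite nth_default // size_map sp.
    by move: H; rewrite /yend /ystart; lia.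
  + case/and4P=> /eqP-> le; rewrite /ystart => lt /negPf bit; rewrite actual0 dim_gt0 ltnNge le /=.
    rewrite nth_some; last by rewrite sp; lia.
    by rewrite prefix_bitE ?bit //; lia.
  + case/and4P=> /eqP-> le; rewrite /ystart => lt bit; rewrite actual0 dim_gt0 ltnNge le /=.
    rewrite nth_some; last by rewrite sp; lia.
    by rewrite prefix_bitE ?bit //; lia.
  + case/and3P=> /eqP-> _ _; rewrite dim_gt0 /=.
    by case: (cell _ _ _) => [[]|].
  + case/and3P=> /eqP-> le lt; rewrite dim_gt0 /= !actual0.
    have -> : p.+1 < dim x by rewrite /dim; lia.
    have -> : (p < origin x) = false by move: le; rewrite /ystart; lia.
    have -> : (p.+1 < origin x) = false by move: le; rewrite /ystart; lia.
    case: (ltnP (p - origin x) (size (pair_enc x y))) => h.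
      by rewrite nth_some.
    rewrite [nth _ _ (p.+1 - _)]nth_default ?eqxx ?orbT // size_map.
    by apply: leq_trans h _; lia.
- rewrite /head_rule /=; case E: (next_move q a) => [[q' w] m] /= /and3P[st p0 lp1].
  have ls1 : s.+1 < dim x by rewrite /dim; lia.
  have lmv : move_pos m p < dim x by case: (m) => /=; lia.
  case et: (traj s) => [[q0 tp] hp].
  case: m E lmv => E /= lmv;
    rewrite /in_range /holds /= !addn0 addn1 ls lp !rH !rC !actual_head actual_cell orbF ls1 ?lmv;
    rewrite traj_next et /=; case: (eqVneq q q0) => //= eq; case: (eqVneq p hp) => //= ep;
    rewrite ep cell_head; case: (eqVneq a tp.1.2) => //= ea; by rewrite -ea -eq E /= !eqxx.
- rewrite /write_rule /=; case E: (next_move q a) => [[q' w] m] /= st.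
  rewrite /in_range /holds /= !addn0 addn1 ls lp !rH !rC !actual_head !actual_cell orbF.
  have ls1 : s.+1 < dim x by rewrite /dim; lia.
  rewrite ls1 traj_next; have := traj_gt0 (ltnW st).
  case et: (traj s) => [[q0 tp] hp] /= hp0.
  case: (eqVneq q q0) => //= eq; case: (eqVneq p hp) => //= ep.
  rewrite ep cell_head; case: (eqVneq a tp.1.2) => //= ea.
  by rewrite -ea -eq E /= cell_move // !eqxx.
- case/andP=> st pp.
  rewrite /keep_rule /in_range /holds /= !addn0 addn1 ls lp lp' !rH !rC.
  rewrite !actual_head !actual_cell orbF.
  have ls1 : s.+1 < dim x by rewrite /dim; lia.
  rewrite ls1 traj_next; have := traj_gt0 (ltnW st).
  case et: (traj s) => [[q0 tp] hp] /= hp0.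
  case: (eqVneq q q0) => //= eq; case: (eqVneq p' hp) => //= ep.
  case: (eqVneq a _) => //= ea.
  case E: (next_move q0 tp.1.2) => [[q' w] m] /=.
  by rewrite cell_move // -ep (negPf pp) ep -ea eqxx.
- case/mapP=> q; rewrite mem_filter => /andP[nacc _] -> /= /eqP es.
  rewrite /in_range /holds /= !addn0 ls lp rH actual_head orbF /= es.
  by case: (eqVneq q _) => // eq; rewrite eq accepting in nacc.
Qed.
End Soundness.

Section Completeness.
Variables (x : seq bool) (v : nat -> nat -> nat -> bool).
Hypothesis mv : models x v.

Let ylen := find (fun i => v 0 (ystart x + i) (cell_var None)) (iota 0 (ymax x)).
(** A model may allow several symbols in one cell. A definite certificate is read off by stopping at
    the first cell that may be blank and by preferring true to false. *)
Definition witness := mkseq (fun i => v 0 (ystart x + i) (cell_var (Some true))) ylen.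
Let z := pair_enc x witness.
Let traj := trajectory M z (origin x).

Lemma size_witness : size witness <= ymax x.
Proof. by rewrite size_mkseq -[ymax x](size_iota 0) find_size. Qed.

Let start_rule n s p : n < size start_rules -> s < dim x -> p < dim x ->
  guard (nth (0, [::]) start_rules n).1 (x, s, p, 0) ->
  has (holds v (x, s, p, 0)) (nth (0, [::]) start_rules n).2.
Proof.
move=> ln ls lp; apply: mv => //.
by rewrite mem_cat mem_nth.
Qed.

Let bounds : origin x <= ystart x <= yend x /\ yend x < dim x.
Proof. by rewrite /dim /yend /ystart; lia. Qed.

Let blank_after i : ylen <= i < ymax x -> v 0 (ystart x + i) (cell_var None).
Proof.
elim: i => [|i IH] /andP[le lt].
  have hs : has (fun i => v 0 (ystart x + i) (cell_var None)) (iota 0 (ymax x)).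
    by rewrite has_find size_iota -/ylen; lia.
  by have := nth_find 0 hs; rewrite -/ylen nth_iota //; move: le; rewrite leqn0 => /eqP->.
case: (ltnP i ylen) => li.
  have hs : has (fun i => v 0 (ystart x + i) (cell_var None)) (iota 0 (ymax x)).
    by rewrite has_find size_iota -/ylen; lia.
  have := nth_find 0 hs; rewrite -/ylen nth_iota; last by lia.
  by have -> : ylen = i.+1 by lia.
have vi : v 0 (ystart x + i) (cell_var None) by apply: IH; lia.
have := @start_rule 5 0 (ystart x + i) isT; rewrite dim_gt0 => /(_ isT).
have lp : ystart x + i < dim x by case: bounds; rewrite /yend; lia.
move=> /(_ lp); rewrite /= /holds /= orbF vi addnS /= => H; apply/eqP; apply: H.
by rewrite /yend; lia.
Qed.

Let start_cells p : p < dim x ->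
  v 0 p (cell_var (if p < origin x then None else nth None (map Some z) (p - origin x))).
Proof.
move=> lp; have d0 := dim_gt0 x; have [/andP[le1 le2] le3] := bounds.
have R n := @start_rule n 0 p; have sz := size_pair x witness.
have sw : size witness = ylen by rewrite size_mkseq.
case: ltnP => lo.
  by have := R 1 isT d0 lp; rewrite /= lo /= /holds /= orbF => /(_ isT) /eqP.
case: (ltnP p (ystart x)) => ly.
  have lz : p - origin x < 2 * size x + 2 by move: ly; rewrite /ystart; lia.
  rewrite (nth_map false); last by rewrite sz; lia.
  rewrite prefix_bitE //; case bit: (prefix_bit x (p - origin x)).
    have := R 3 isT d0 lp; rewrite /= lo ly bit /= /holds /= orbF => /(_ isT) /eqP //.
  by have := R 2 isT d0 lp; rewrite /= lo ly bit /= /holds /= orbF => /(_ isT) /eqP.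
have ei : p = ystart x + (p - ystart x) by rewrite subnKC.
have ed : p - origin x = 2 * size x + 2 + (p - ystart x) by move: ly; rewrite /ystart; lia.
case: (ltnP (p - ystart x) ylen) => li; last first.
  rewrite nth_default; last by rewrite size_map sz sw ed leq_add2l.
  case: (ltnP p (yend x)) => le.
    by rewrite ei; apply: blank_after; rewrite li /=; move: le; rewrite /yend; lia.
  by have := R 1 isT d0 lp; rewrite /= le orbT /= /holds /= orbF => /(_ isT) /eqP.
rewrite (nth_map false); last by rewrite sz sw ed ltn_add2l.
have -> : nth false z (p - origin x) = v 0 p (cell_var (Some true)).
  by rewrite /z ed -addnA nth_pair_tail add2n /= nth_mkseq // -ei.
have lye : p < yend x by have := size_witness; rewrite sw /yend; lia.
have := R 4 isT d0 lp; rewrite /= ly lye /= /holds /= orbF => /(_ isT).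
have nb : v 0 p (cell_var None) = false.
  have := before_find 0 li; rewrite nth_iota -?ei //.
  by have := size_witness; rewrite sw; lia.
(* The cell lies before the first possible blank, so the guessing clause leaves one of the two
   bits. *)
rewrite nb /=; case vt: (v 0 p (cell_var (Some true))) => //.
by rewrite orbF => /eqP.
Qed.

Let rule s p p' cl : s < tmax x -> p < dim x -> p' < dim x -> cl \in clauses ->
  guard cl.1 (x, s, p, p') -> has (holds v (x, s, p, p')) cl.2.
Proof. by move=> st; apply: mv; rewrite /dim; lia. Qed.

(** Only one inclusion is proved: the facts of the actual run hold in the model, as the premises of
    each rule used are facts of the run. The model may contain others. *)
Let follows s : s <= tmax x -> v s (traj s).2 (head_var (traj s).1.1) /\
  forall p, p < dim x -> v s p (cell_var (cell (traj s).2 (traj s).1.2 p)).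
Proof.
have d0 := dim_gt0 x; have [/andP[le1 le2] le3] := bounds.
elim: s => [_|s IH st].
  split; last by move=> p lp; rewrite cell_start; apply: start_cells.
  have lo : origin x < dim x by lia.
  by have := @start_rule 0 0 (origin x) isT d0 lo;
    rewrite /= eqxx /= /holds /= orbF => /(_ isT) /eqP.
have [vh vc] := IH (ltnW st).
have [p1 p2] := trajectory_pos M z (origin x) s; rewrite -/traj in p1 p2.
have -> : traj s.+1 = advance (traj s) by [].
case et: (traj s) vh vc p1 p2 => [[q tp] hp] /= vh vc p1 p2.
have hp0 : 0 < hp by move: p1; rewrite /origin; lia.
have lhp : hp.+1 < dim x by rewrite /dim /yend /ystart; lia.
have vhp := vc hp (ltnW lhp); rewrite cell_head in vhp.
case E: (next_move q tp.1.2) => [[q' w] m] /=; split.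
  have := @rule s hp 0 (head_rule (q, tp.1.2)) st (ltnW lhp) d0.
  rewrite !mem_cat map_f ?mem_enum ?orbT // => /(_ isT).
  rewrite /head_rule /= E /= st hp0 lhp /= => /(_ isT).
  rewrite /holds /= addn0 addn1 vh vhp orbF /=.
  by case: (m) => /= /eqP.
move=> p lp; rewrite cell_move //; case: (eqVneq p hp) => [->|ne].
  have := @rule s hp 0 (write_rule (q, tp.1.2)) st (ltnW lhp) d0.
  rewrite !mem_cat [write_rule _ \in map write_rule _]map_f ?mem_enum ?orbT // => /(_ isT).
  rewrite /write_rule /= E /= st => /(_ isT).
  by rewrite /holds /= addn0 addn1 vh vhp orbF /= => /eqP.
have vp := vc p lp; set a := cell hp tp p in vp *.
have := @rule s p hp (keep_rule (q, a)) st lp (ltnW lhp).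
rewrite !mem_cat [keep_rule _ \in map keep_rule _]map_f ?mem_enum ?orbT // => /(_ isT).
rewrite /= st ne => /(_ isT).
by rewrite /holds /= addn0 addn1 vh vp orbF /= => /eqP.
Qed.

Lemma witness_accepted : tm_acc (traj (tmax x)).1.1.
Proof.
have [vh _] := follows (leqnn _); have [p1 p2] := trajectory_pos M z (origin x) (tmax x).
rewrite -/traj in p1 p2; apply: contraT => nacc.
have lp : (traj (tmax x)).2 < dim x by rewrite /dim /yend /ystart; move: p2; lia.
have ls : tmax x < dim x by rewrite /dim; lia.
have cin : accept_rule (traj (tmax x)).1.1 \in clauses.
  rewrite !mem_cat; do 4!(apply/orP; right).
  by apply: map_f; rewrite mem_filter nacc mem_enum.
have := mv ls lp (dim_gt0 x) cin (eqxx _).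
by rewrite /= /holds /= addn0 vh.
Qed.
End Completeness.

Lemma tableau_correct x :
  satisfiable (nvars x) (nclauses x) (fun j i b => literal_in (x, j, i, b)) <->
  exists2 y, size y <= ymax x & tm_acc (cstate (run (tmax x) (init M (pair_enc x y)))).
Proof.
split=> [/models_of_sat[v mv]|[y sy]].
  exists (witness x v); first exact: size_witness.
  by rewrite (run_trajectory _ _ (origin x)); apply: witness_accepted.
rewrite (run_trajectory _ _ (origin x)) => acc.
exact: sat_of_models (actual_models sy acc).
Qed.

(** * The tableau is computed in polynomial time *)

Hypotheses (PT_tmax : PT tmax) (PT_ymax : PT ymax).

Let PT_origin : PT origin. Proof. by rewrite /origin; pt. Qed.
Let PT_ystart : PT ystart. Proof. by have := PT_origin; rewrite /ystart => ?; pt. Qed.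
Let PT_yend : PT yend. Proof. by have := PT_ystart; rewrite /yend => ?; pt. Qed.
Let PT_dim : PT dim. Proof. by have := PT_yend; rewrite /dim => ?; pt. Qed.

Lemma PT_nvars : PT nvars.
Proof. by have := PT_dim; rewrite /nvars => ?; pt. Qed.

Lemma PT_nclauses : PT nclauses.
Proof. by have := PT_dim; rewrite /nclauses => ?; pt. Qed.

Let contextE := prod_env (prod_env (prod_env bits_env nat_val) nat_val) nat_val.

Lemma PT_guard g : PT (fun c : contextE => guard g c).
Proof.
have po := PT_origin; have ps := PT_ystart; have pe := PT_yend; have pd := PT_dim.
do 9?[case: g => [|g]].
- by apply: (@PT_ext contextE _ (fun c => (c.1.1.2 == 0) && (c.1.2 == origin c.1.1.1)));
    [case=> [[[]]] | pt].
- by apply: (@PT_ext contextE _ (fun c => (c.1.1.2 == 0) &&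
    ((c.1.2 < origin c.1.1.1) || (yend c.1.1.1 <= c.1.2)))); [case=> [[[]]] | pt].
- apply: (@PT_ext contextE _ (fun c => [&& c.1.1.2 == 0, origin c.1.1.1 <= c.1.2,
    c.1.2 < ystart c.1.1.1 & ~~ prefix_bit c.1.1.1 (c.1.2 - origin c.1.1.1)])).
    by case=> [[[]]].
  by rewrite /prefix_bit; pt.
- apply: (@PT_ext contextE _ (fun c => [&& c.1.1.2 == 0, origin c.1.1.1 <= c.1.2,
    c.1.2 < ystart c.1.1.1 & prefix_bit c.1.1.1 (c.1.2 - origin c.1.1.1)])).
    by case=> [[[]]].
  by rewrite /prefix_bit; pt.
- by apply: (@PT_ext contextE _ (fun c => [&& c.1.1.2 == 0, ystart c.1.1.1 <= c.1.2 &
    c.1.2 < yend c.1.1.1])); [case=> [[[]]] | pt].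
- by apply: (@PT_ext contextE _ (fun c => [&& c.1.1.2 == 0, ystart c.1.1.1 <= c.1.2 &
    c.1.2.+1 < yend c.1.1.1])); [case=> [[[]]] | pt].
- by apply: (@PT_ext contextE _ (fun c => [&& c.1.1.2 < tmax c.1.1.1, 0 < c.1.2 &
    c.1.2.+1 < dim c.1.1.1])); [case=> [[[]]] | pt].
- by apply: (@PT_ext contextE _ (fun c => c.1.1.2 < tmax c.1.1.1)); [case=> [[[]]] | pt].
- by apply: (@PT_ext contextE _ (fun c => (c.1.1.2 < tmax c.1.1.1) && (c.1.2 != c.2)));
    [case=> [[[]]] | pt].
- by apply: (@PT_ext contextE _ (fun c => c.1.1.2 == tmax c.1.1.1)); [case=> [[[]]] | pt].
Qed.

Lemma PT_place k : PT (fun c : contextE => place k c).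
Proof.
do 3?[case: k => [|k]].
- by apply: (@PT_ext contextE _ (fun c => c.1.2)); [case=> [[[]]] | pt].
- by apply: (@PT_ext contextE _ (fun c => c.2)); [case=> [[[]]] | pt].
- by apply: (@PT_ext contextE _ (fun c => c.1.2.+1)); [case=> [[[]]] | pt].
- by apply: (@PT_ext contextE _ (fun c => c.1.2.-1)); [case=> [[[]]] | pt].
Qed.

Let literalE := prod_env (prod_env (prod_env bits_env nat_val) nat_val) bool_val.

Lemma PT_has_literal cl : PT (fun t : literalE => has_literal cl t).
Proof.
have pd := PT_dim; have pg := PT_guard cl.1.
apply: (@PT_ext literalE _ (fun t => ~~ guard cl.1 (context_of t.1.1.1 t.1.1.2) ||
  has (fun l : literal => (t.2 == l.1.1.1) && (t.1.2 == var_index t.1.1.1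
    (t.1.1.2 %/ size clauses %/ dim t.1.1.1 %/ dim t.1.1.1 + l.1.1.2)
    (place l.1.2 (context_of t.1.1.1 t.1.1.2)) l.2)) cl.2)).
  case=> [[[x j] i] b] /=; congr (_ || _); apply: eq_has => l.
  by rewrite [b == _]eq_sym.
apply: PT_or; first by rewrite /context_of; pt.
refine (@PT_has_const literalE literal (fun l t => (t.2 == l.1.1.1) && (t.1.2 ==
  var_index t.1.1.1 (t.1.1.2 %/ size clauses %/ dim t.1.1.1 %/ dim t.1.1.1 + l.1.1.2)
    (place l.1.2 (context_of t.1.1.1 t.1.1.2)) l.2)) cl.2 _) => l.
have pp := PT_place l.1.2.
by rewrite /var_index /context_of; pt.
Qed.

Lemma PT_literal_in : PT (fun t : literalE => literal_in t).
Proof.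
apply: (@PT_nth_const literalE (map has_literal clauses) (fun t => t.1.1.2 %% size clauses));
  last by pt.
move=> i; case: (ltnP i (size clauses)) => li; last first.
  by rewrite nth_default ?size_map //; apply: (PT_const _ false).
by rewrite (nth_map (0, [::])) //; apply: PT_has_literal.
Qed.
End Tableau.

Theorem SINV_NP_hard k t : 0 < k -> 0 < t -> NP_hard (SINV_lang k t).
Proof.
move=> k0 t0 L [V [c [[M [c' HM]] HL]]].
pose ymax (x : seq bool) := size x ^ c + c.
(* The time bound of the machine for [V] on the longest pair, with a certificate of length
   [ymax x]. *)
pose tmax (x : seq bool) := (2 * size x + 2 + ymax x) ^ c' + c'.
have py : PT ymax by rewrite /ymax; pt.
have pm : PT tmax by rewrite /tmax; pt.
apply: (sat_reduction k0 t0 (PT_nvars M pm py) (PT_nclauses M pm py) (PT_literal_in M pm py)).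
move=> x; rewrite HL tableau_correct.
have E y : size y <= ymax x ->
    V (pair_enc x y) <-> tm_acc (cstate (run (tmax x) (init M (pair_enc x y)))).
  move=> sy; apply: (decides_run HM); rewrite size_pair /tmax leq_add2r.
  by case: (c') => // d; rewrite leq_exp2r // leq_add2l.
split=> [[y [sy Vy]]|[y sy Vy]]; first by exists y => //; apply/E.
by exists y; split=> //; apply/E.
Qed.

Theorem theorem1p2 (k t : nat) : 0 < k -> 0 < t -> NP_complete (SINV_lang k t).
Proof.
by case: k => // k k0 t0; split; [exact: SINV_in_NP | exact: SINV_NP_hard].
Qed.
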